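(* Let $\ell\in\mathbb N$ and, for $1\le k\le\ell$, let $\mathbf Z_k=\mathbf X_k\sqcup\mathbf Y_k$, where $\mathbf X_k=(X_{k,1},\ldots,X_{k,n_k})$ and $\mathbf Y_k=(Y_{k,1},\ldots,Y_{k,m_k})$ are tuples of self-adjoint operators ($n_k,m_k\ge0$, $n_k+m_k\ge1$) in a C$^*$-non-commutative probability space $(\mathcal A,\varphi)$, such that \[ \Big(\bigcup_{k=1}^\ell\{X_{k,i}\}_{i=1}^{n_k},\ \bigcup_{k=1}^\ell\{Y_{k,j}\}_{j=1}^{m_k}\Big) \] is a tracially bi-partite system. Then $\mathbf Z_1,\ldots,\mathbf Z_\ell$ are bi-free with respect to $\varphi$ and individually have finite-dimensional approximants if and only if $\chi_{\mathrm{orb}}(\mathbf Z_1,\ldots,\mathbf Z_\ell)=0$.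
   Context: A C$^*$-non-commutative probability space $(\mathcal A,\varphi)$ is a unital C$^*$-algebra with a state $\varphi$. A tracially bi-partite system $(\{X_i\}_{i=1}^n,\{Y_j\}_{j=1}^m)$ in $(\mathcal A,\varphi)$ consists of self-adjoint operators $X_1,\ldots,X_n$ (left variables) and $Y_1,\ldots,Y_m$ (right variables) in $\mathcal A$ such that every $X_i$ commutes with every $Y_j$ (in distribution: interchanging adjacent $X_i,Y_j$ in a word does not change $\varphi$ of the word) and $\varphi$ is tracial on the unital algebra generated by the $X_i$ and on the unital algebra generated by the $Y_j$; $\varphi$ is not assumed tracial or faithful on $\mathcal A$. Microstates. $\mathcal M_d$ is the algebra of complex $d\times d$ matrices, $\mathcal M_d^{sa}$ its self-adjoint part, $\tau_d$ its normalized trace, $\|\cdot\|$ the operator norm. For $M,d\in\mathbb N$ and $R,\epsilon>0$, $\Gamma_R(X_1,\ldots,X_n\sqcup Y_1,\ldots,Y_m;M,d,\epsilon)$ is the set of $(A_1,\ldots,A_n,B_1,\ldots,B_m)\in(\mathcal M_d^{sa})^{n+m}$ with $\|A_i\|,\|B_j\|\le R$ for all $i,j$ and \[ |\varphi(X_{i_1}\cdots X_{i_p}Y_{j_1}\cdots Y_{j_q})-\tau_d(A_{i_1}\cdots A_{i_p}B_{j_q}\cdots B_{j_1})|<\epsilon \] for all $p,q\ge0$ with $1\le p+q\le M$ and all indices. A tracially bi-partite system has finite-dimensional approximants if for every $M\in\mathbb N$, $\epsilon>0$ and $R>\max\{\max_i\|X_i\|,\max_j\|Y_j\|\}$ there is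 $D\in\mathbb N$ with $\Gamma_R(X_1,\ldots,X_n\sqcup Y_1,\ldots,Y_m;M,d,\epsilon)\ne\emptyset$ for all $d\ge D$. Orbital bi-free entropy. Let $U(d)$ be the unitary group of $\mathcal M_d$ with normalized Haar measure $\gamma_d$, and $E_d=\prod_{k=1}^\ell(\mathcal M_d^{sa})^{n_k}\times\prod_{k=1}^\ell(\mathcal M_d^{sa})^{m_k}$. Define $\Phi_d:U(d)^\ell\times E_d\to E_d$ by $\Phi_d((U_k)_k,(\mathbf A_k)_k,(\mathbf B_k)_k)=((U_k^*\mathbf A_kU_k)_k,(U_k^*\mathbf B_kU_k)_k)$, where conjugation is applied entrywise. For a regular Borel probability measure $\mu$ on $E_d$ put (with $\log0=-\infty$) $\chi_{\mathrm{orb},R}(\mathbf Z_1,\ldots,\mathbf Z_\ell;M,d,\epsilon;\mu)=\log\big((\gamma_d^{\otimes\ell}\otimes\mu)(\Phi_d^{-1}(\Gamma_R(\mathbf X_1,\ldots,\mathbf X_\ell\sqcup\mathbf Y_1,\ldots,\mathbf Y_\ell;M,d,\epsilon)))\big)$, where the left (right) variables are those in the $\mathbf X_k$ (the $\mathbf Y_k$) in the order listed; let $\chi_{\mathrm{orb},R}(\cdot;M,d,\epsilon)$ be the supremum over all such $\mu$; $\chi_{\mathrm{orb},R}(\cdot;M,\epsilon)=\limsup_{d\to\infty}\frac1{d^2}\chi_{\mathrm{orb},R}(\cdot;M,d,\epsilon)$; $\chi_{\mathrm{orb},R}(\cdot)=\inf_{M\in\mathbb N,\epsilon>0}\chi_{\mathrm{orb},R}(\cdot;M,\epsilon)$;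 and $\chi_{\mathrm{orb}}(\mathbf Z_1,\ldots,\mathbf Z_\ell)=\sup_{0<R<\infty}\chi_{\mathrm{orb},R}(\mathbf Z_1,\ldots,\mathbf Z_\ell)\in[-\infty,0]$. Bi-freeness. Given vector spaces with specified state vectors $(\mathcal X_k,\mathcal X_k^\circ,\xi_k)$, $\mathcal X_k=\mathbb C\xi_k\oplus\mathcal X_k^\circ$, their free product is $\mathcal X=\mathbb C\xi\oplus\bigoplus_{r\ge1}\bigoplus_{k_1\ne k_2\ne\cdots\ne k_r}\mathcal X_{k_1}^\circ\otimes\cdots\otimes\mathcal X_{k_r}^\circ$. Let $\mathcal X(\ell,k)$ (resp. $\mathcal X(r,k)$) be the span of $\xi$ and the summands with first index (resp. last index) $\neq k$. Using the canonical isomorphisms $V_k:\mathcal X_k\otimes\mathcal X(\ell,k)\to\mathcal X$ and $W_k:\mathcal X(r,k)\otimes\mathcal X_k\to\mathcal X$, put $\lambda_k(T)=V_k(T\otimes I)V_k^{-1}$ and $\rho_k(T)=W_k(I\otimes T)W_k^{-1}$ for linear maps $T$ on $\mathcal X_k$. Pairs $(C_k,D_k)_{k\in K}$ of unital subalgebras of $\mathcal A$ are bi-free with respect to $\varphi$ if there exist such $\mathcal X_k$ and unital homomorphisms $l_k:C_k\to L(\mathcal X_k)$, $r_k:D_k\to L(\mathcal X_k)$ such that for every word $z_1\cdots z_N$ in elements of the $C_k$'s and $D_k$'s, $\varphi(z_1\cdots z_N)$ equals the $\xi$-coefficient of $T_1\cdots T_N\xi$, where $T_i=\lambda_k(l_k(z_i))$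 if $z_i$ is taken from $C_k$ and $T_i=\rho_k(r_k(z_i))$ if $z_i$ is taken from $D_k$. The families $\mathbf Z_1,\ldots,\mathbf Z_\ell$ are bi-free if the pairs $(\mathrm{alg}(\mathbf X_k),\mathrm{alg}(\mathbf Y_k))$ of generated unital algebras are. *)

(* Defs.v *)
From HB Require Import structures.
From mathcomp Require Import all_boot all_order all_algebra.
From mathcomp Require Import spectral complex.
From mathcomp Require Import all_classical all_reals all_analysis.

Set Implicit Arguments.
Unset Strict Implicit.
Unset Printing Implicit Defensive.

Import Order.TTheory GRing.Theory Num.Theory.
Import numFieldNormedType.Exports.

Local Open Scope classical_set_scope.
Local Open Scope ring_scope.
Local Open Scope complex_scope.
Local Open Scope sesquilinear_scope.

(* MathComp-Analysis normed modules over C have no join with algebras, hence a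
   record over [algType]; [algType] makes the algebra unital and nonzero. *)
Record cstar_algebra (R : realType) := CStarAlgebra {
  cstar_alg :> algType R[i] ;
  star : cstar_alg -> cstar_alg ;
  cnorm : cstar_alg -> R ;
  starK : involutive star ;
  starM : forall x y, star (x * y) = star y * star x ;
  star_antilinear : forall (c : R[i]) x y,
    star (c *: x + y) = c^* *: star x + star y ;
  cnorm_eq0 : forall x, cnorm x = 0 -> x = 0 ;
  cnormD : forall x y, cnorm (x + y) <= cnorm x + cnorm y ;
  cnormZ : forall (c : R[i]) x, (cnorm (c *: x))%:C = `|c| * (cnorm x)%:C ;
  cnormM : forall x y, cnorm (x * y) <= cnorm x * cnorm y ;
  cnorm_star : forall x, cnorm (star x * x) = cnorm x ^+ 2 ;
  cnorm_complete : forall u : nat -> cstar_alg,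
    (forall e, 0 < e -> exists N, forall p q, (N <= p)%N -> (N <= q)%N ->
      cnorm (u p - u q) < e) ->
    exists l, forall e, 0 < e -> exists N, forall p, (N <= p)%N ->
      cnorm (u p - l) < e
}.

Section CStarProbability.
Context {R : realType} {A : cstar_algebra R}.
Implicit Types (phi : {scalar A}) (S : set A).

Definition is_state phi := (forall a : A, 0 <= phi (star a * a)) /\ phi 1 = 1.

Definition selfadjoint (a : A) := star a = a.

Definition unital_subalgebra S :=
  [/\ S 1, forall (c : R[i]) x y, S x -> S y -> S (c *: x + y)
    & forall x y, S x -> S y -> S (x * y)].

Definition alg_gen S : set A :=
  \bigcap_(B in [set B | unital_subalgebra B /\ S `<=` B]) B.

Definition tracial_on phi S :=
  forall x y, S x -> S y -> phi (x * y) = phi (y * x).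

Definition tracially_bipartite phi (I J : Type) (X : I -> A) (Y : J -> A) :=
  [/\ (forall i, selfadjoint (X i)) /\ (forall j, selfadjoint (Y j)),
      forall (i : I) (j : J) (u v : seq (I + J)),
        let letter z := match z with inl i => X i | inr j => Y j end in
        phi ((\prod_(z <- u) letter z) * (X i * Y j) * \prod_(z <- v) letter z) =
        phi ((\prod_(z <- u) letter z) * (Y j * X i) * \prod_(z <- v) letter z),
      tracial_on phi (alg_gen (range X))
    & tracial_on phi (alg_gen (range Y))].

End CStarProbability.

Section BiFreeness.
Context {R : realType}.

(* A vector space with specified state vector: V = C xi (+) V°, where
   [ps_coef x] is the coefficient of xi in the decomposition of x. *)
Record pointed_space := PointedSpace {
  ps_space :> lmodType R[i] ;
  ps_xi : ps_space ;
  ps_circ : set ps_space ;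
  ps_coef : ps_space -> R[i] ;
  ps_circ0 : ps_circ 0 ;
  ps_circ_lin : forall (c : R[i]) x y,
    ps_circ x -> ps_circ y -> ps_circ (c *: x + y) ;
  ps_decomp : forall x, ps_circ (x - ps_coef x *: ps_xi) ;
  ps_direct : forall c, ps_circ (c *: ps_xi) -> c = 0
}.

Definition ps_rest (V : pointed_space) (x : V) : V := x - ps_coef x *: ps_xi V.

Section FreeProduct.
Context {K : eqType} (P : K -> pointed_space).

Definition letter := {k : K & P k}.
Definition mk_letter k (x : P k) : letter := existT (fun k => P k : Type) k x.

Definition head_ne (k : K) (w : seq letter) : Prop :=
  if w is z :: _ then tag z != k else True.
Definition last_ne (k : K) (w : seq letter) : Prop := head_ne k (rev w).

(* [:: (k_1, x_1); ...; (k_r, x_r)] with x_i in P(k_i)° and k_i <> k_(i+1);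
   it indexes the elementary tensor x_1 (x) ... (x) x_r. *)
Fixpoint reduced (w : seq letter) : Prop :=
  if w is z :: w' then
    [/\ ps_circ (tagged z), head_ne (tag z) w' & reduced w']
  else True.

Definition multilinear (V : lmodType R[i]) (g : seq letter -> V) :=
  forall (u v : seq letter) k (x y : P k) (c : R[i]),
    reduced (u ++ mk_letter x :: v) -> reduced (u ++ mk_letter y :: v) ->
    g (u ++ mk_letter (c *: x + y) :: v) =
    c *: g (u ++ mk_letter x :: v) + g (u ++ mk_letter y :: v).

(* X = C xi (+) the direct sum, over r >= 1 and k_1 <> k_2 <> ... <> k_r, of
   P(k_1)° (x) ... (x) P(k_r)°, by the universal property of direct sums of
   tensor products; [tensor w] is the elementary tensor of the reduced word w,
   and the values of [tensor] at other words are irrelevant. *)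
Definition is_free_product (X : pointed_space) (tensor : seq letter -> X) :=
  [/\ multilinear tensor,
      tensor [::] = ps_xi X,
      forall z w, reduced (z :: w) -> ps_circ (tensor (z :: w))
    & forall (V : lmodType R[i]) (g : seq letter -> V), multilinear g ->
      exists h : {linear X -> V},
        (forall w, reduced w -> h (tensor w) = g w) /\
        forall h' : {linear X -> V},
          (forall w, reduced w -> h' (tensor w) = g w) -> h' =1 h].

Section Operators.
Context (X : pointed_space) (tensor : seq letter -> X).

(* V_k (x (x) w) for w in X(l,k), and W_k (w (x) x) for w in X(r,k). *)
Definition free_V k (x : P k) (w : seq letter) : X :=
  ps_coef x *: tensor w + tensor (mk_letter (ps_rest x) :: w).
Definition free_W k (w : seq letter) (x : P k) : X :=
  ps_coef x *: tensor w + tensor (rcons w (mk_letter (ps_rest x))).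

(* L V_k = V_k (T (x) I), resp. L W_k = W_k (I (x) T), on elementary tensors. *)
Definition is_lambda k (T : {linear P k -> P k}) (L : {linear X -> X}) :=
  forall (x : P k) w, reduced w -> head_ne k w ->
    L (free_V x w) = free_V (T x) w.
Definition is_rho k (T : {linear P k -> P k}) (L : {linear X -> X}) :=
  forall (x : P k) w, reduced w -> last_ne k w ->
    L (free_W w x) = free_W w (T x).

End Operators.
End FreeProduct.

Definition unital_hom {A : cstar_algebra R} (S : set A) (V : lmodType R[i])
    (h : A -> {linear V -> V}) :=
  [/\ h 1 =1 id,
      forall (c : R[i]) a b, S a -> S b ->
        h (c *: a + b) =1 (fun x => c *: h a x + h b x)
    & forall a b, S a -> S b -> h (a * b) =1 h a \o h b].

(* In a word w, (inl k, a) stands for a taken from C_k and (inr k, a) for a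
   taken from D_k. *)
Definition bifree {A : cstar_algebra R} (phi : {scalar A}) (K : eqType)
    (C D : K -> set A) : Prop :=
  exists (P : K -> pointed_space) (X : pointed_space)
    (tensor : seq (letter P) -> X)
    (l r : forall k, A -> {linear P k -> P k})
    (lambda rho : forall k, {linear P k -> P k} -> {linear X -> X}),
  [/\ is_free_product tensor,
      forall k, unital_hom (C k) (l k) /\ unital_hom (D k) (r k),
      forall k (T : {linear P k -> P k}), is_lambda tensor T (lambda k T),
      forall k (T : {linear P k -> P k}), is_rho tensor T (rho k T)
    & forall w : seq ((K + K) * A),
        (forall z, z \in w ->
          match z.1 with inl k => C k z.2 | inr k => D k z.2 end) ->
        phi (\prod_(z <- w) z.2) =
        ps_coef (foldr
          (fun z v => match z.1 with
                      | inl k => lambda k (l k z.2) v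
                      | inr k => rho k (r k z.2) v
                      end)
          (ps_xi X) w)].

End BiFreeness.

(* R[i] carries no topology in the libraries; give it the one of its norm, so
   that matrices over R[i] get the entrywise topology. *)
HB.instance Definition _ (R : realType) :=
  PseudoPointedMetric.copy R[i] (R[i] : numFieldType)^o.

Section Matrices.
Context {R : realType}.

Definition l2norm d (v : 'cV[R[i]]_d) : R :=
  Num.sqrt (\sum_i (complex.Re (v i 0) ^+ 2 + complex.Im (v i 0) ^+ 2)).

Definition opnorm d (M : 'M[R[i]]_d) : R :=
  sup [set l2norm (M *m v) | v in [set v | l2norm v <= 1]].

Definition ntr d (M : 'M[R[i]]_d) : R[i] := \tr M / d%:R.

Lemma herm0 d : (0 : 'M[R[i]]_d) \is hermsymmx.
Proof. by rewrite is_hermitianmxE expr0 scale1r linear0 map_mx0. Qed.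

Lemma herm_conj d (U M : 'M[R[i]]_d) :
  M \is hermsymmx -> U^t* *m M *m U \is hermsymmx.
Proof.
move=> /is_hermitianmxP; rewrite expr0 scale1r => MH.
apply/is_hermitianmxP; rewrite expr0 scale1r !trmx_mul !map_mxM -MH -mulmxA.
congr (_ *m (_ *m _)).
rewrite map_trmx trmxK -map_mx_comp map_mx_id //; exact: conjCK.
Qed.

Lemma unitary1 d : (1%:M : 'M[R[i]]_d) \is unitarymx.
Proof. by apply/unitarymxP; rewrite trmx1 map_mx1 mulmx1. Qed.

Definition herm_mx d := set_type [set M : 'M[R[i]]_d | M \is hermsymmx].
HB.instance Definition _ d := Topological.on (herm_mx d).
Definition mk_herm d (M : 'M[R[i]]_d) (hM : M \is hermsymmx) : herm_mx d :=
  SigSub (mem_set (hM : [set M : 'M[R[i]]_d | M \is hermsymmx] M)).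
HB.instance Definition _ d := isPointed.Build (herm_mx d) (mk_herm (herm0 d)).

Definition unitary_group d := set_type [set M : 'M[R[i]]_d | M \is unitarymx].
HB.instance Definition _ d := Topological.on (unitary_group d).
Definition mk_unitary d (M : 'M[R[i]]_d) (hM : M \is unitarymx) : unitary_group d :=
  SigSub (mem_set (hM : [set M : 'M[R[i]]_d | M \is unitarymx] M)).
HB.instance Definition _ d :=
  isPointed.Build (unitary_group d) (mk_unitary (unitary1 d)).

Definition unitary_mul d (U V : unitary_group d) : unitary_group d :=
  mk_unitary (mul_unitarymx (set_valP U) (set_valP V)).

(* U^* M U *)
Definition herm_act d (U : unitary_group d) (M : herm_mx d) : herm_mx d :=
  mk_herm (herm_conj (set_val U) (set_valP M)).

End Matrices.

Definition borel (T : ptopologicalType) := g_sigma_algebraType (@open T).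

Section Measures.
Context {R : realType}.

Definition regular_measure (T : ptopologicalType)
    (mu : probability (borel T) R) :=
  forall B : set (borel T), measurable B ->
    mu B = ereal_inf [set mu U | U in [set U | @open T U /\ B `<=` U]] /\
    mu B = ereal_sup [set mu K | K in [set K | @compact T K /\ K `<=` B]].

Section PowerProbability.
Context {d} {T : measurableType d}.

Definition tcons n (x : T * n.-tuple T) : n.+1.-tuple T :=
  [tuple of x.1 :: x.2].

Lemma measurable_tcons n : measurable_fun [set: T * n.-tuple T] (@tcons n).
Proof. exact: measurable_cons. Qed.

HB.instance Definition _ n :=
  isMeasurableFun.Build _ _ _ _ (@tcons n) (@measurable_tcons n).

(* The n-fold product measure. *)
Fixpoint power_prob (P : probability T R) n : probability (n.-tuple T) R :=
  match n return probability (n.-tuple T) R with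
  | 0 => dirac [tuple]
  | n'.+1 => distribution (P \x power_prob P n')%E (@tcons n')
  end.

End PowerProbability.

(* Invariant Borel probability measure on the compact group U(d). *)
Definition is_haar d (g : probability (borel (@unitary_group R d)) R) :=
  forall (V : unitary_group d) (B : set (borel (unitary_group d))),
    measurable B ->
    g [set unitary_mul V W | W in B] = g B /\
    g [set unitary_mul W V | W in B] = g B.

Definition herm_space (I J : Type) d : Type :=
  ({ptws I -> @herm_mx R d} * {ptws J -> @herm_mx R d})%type.
HB.instance Definition _ I J d := Topological.on (herm_space I J d).
HB.instance Definition _ I J d :=
  isPointed.Build (herm_space I J d) (fun=> point, fun=> point).

End Measures.

Section Microstates.
Context {R : realType} {A : cstar_algebra R} (phi : {scalar A}).
Context {I J : Type} (X : I -> A) (Y : J -> A).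

(* [rho] is the cutoff on operator norms; the right matrices B_j appear in the
   reversed order, as opposed to the Y_j. *)
Definition microstates (rho : R) (M d : nat) (eps : R) :
    set (herm_space I J d) :=
  [set AB : herm_space I J d |
    let a i := set_val (AB.1 i) in let b j := set_val (AB.2 j) in
    [/\ forall i, opnorm (a i) <= rho, forall j, opnorm (b j) <= rho
      & forall (s : seq I) (t : seq J), (1 <= size s + size t <= M)%N ->
        `|phi ((\prod_(i <- s) X i) * \prod_(j <- t) Y j)
          - ntr ((\prod_(i <- s) a i) * \prod_(j <- rev t) b j)| < eps%:C]].

Definition has_fd_approximants :=
  forall (M : nat) (eps rho : R), (0 < M)%N -> 0 < eps ->
    (forall i, cnorm (X i) < rho) -> (forall j, cnorm (Y j) < rho) ->
    exists D, forall d, (D <= d)%N -> @microstates rho M d eps !=set0.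

End Microstates.

Arguments microstates {R A} phi {I J} X Y rho M d eps.

Section OrbitalEntropy.
Context {R : realType} {A : cstar_algebra R} (phi : {scalar A}).
Context {ell : nat} {n m : 'I_ell -> nat}.

Definition indices (p : 'I_ell -> nat) := {k : 'I_ell & 'I_(p k)}.

Definition all_vars (p : 'I_ell -> nat) (X : forall k, 'I_(p k) -> A) :
    indices p -> A :=
  fun z => X (tag z) (tagged z).

Definition orb_map d
    (x : ell.-tuple (@unitary_group R d) * herm_space (indices n) (indices m) d) :
    herm_space (indices n) (indices m) d :=
  (fun z => herm_act (tnth x.1 (tag z)) (x.2.1 z),
   fun z => herm_act (tnth x.1 (tag z)) (x.2.2 z)).

Context (gamma : forall d, probability (borel (@unitary_group R d)) R).
Context (X : forall k, 'I_(n k) -> A) (Y : forall k, 'I_(m k) -> A).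

Local Open Scope ereal_scope.

Definition chi_orb_mu (rho : R) (M d : nat) (eps : R)
    (mu : probability (borel (herm_space (indices n) (indices m) d)) R) : \bar R :=
  lne ((power_prob (gamma d) ell \x mu)
    (@orb_map d @^-1` microstates phi (all_vars X) (all_vars Y) rho M d eps)).

Definition chi_orb_d (rho : R) (M d : nat) (eps : R) : \bar R :=
  ereal_sup [set @chi_orb_mu rho M d eps mu | mu in [set mu | regular_measure mu]].

Definition chi_orb_lim (rho : R) (M : nat) (eps : R) : \bar R :=
  limn_esup (fun d => ((d%:R ^+ 2)^-1)%:E * chi_orb_d rho M d eps).

Definition chi_orb_R (rho : R) : \bar R :=
  ereal_inf [set x | exists (M : nat) (eps : R),
    [/\ (0 < M)%N, (0 < eps)%R & x = chi_orb_lim rho M eps]].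

Definition chi_orb : \bar R :=
  ereal_sup [set chi_orb_R rho | rho in [set rho | (0 < rho)%R]].

End OrbitalEntropy.

(* Main.v *)
(* Bi-freeness of the Z_k amounts to the vanishing of phi on the products of
   centred one-coloured blocks of alternating colours, over the words whose left
   letters precede the right ones: exactly the words which microstates control.

   Let f be the normalized trace of an alternating product of centred matrices
   U_k^* C U_k, with U_1, ..., U_l independent Haar unitaries and the C bounded in
   norm. Integration by parts along U_k -> U_k V, with V close to 1, expresses
   E|f|^(2p) through shorter words, and induction yields
   E|f|^(2p) <= (c p / d^2)^p with c independent of d, p and the matrices.

   With p = 1, Markov's inequality shows that randomly rotated individual
   microstates are, with probability tending to 1, joint microstates of the
   bi-free distribution; a Dirac measure then gives chi_orb = 0. With p of order
   d^2, |f| is small off a set of measure at most exp(- theta d^2). If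
   chi_orb = 0, then for every eta > 0 some fixed matrices have rotations which
   are joint microstates on a set of measure greater than exp(- eta d^2), for
   arbitrarily large d; for eta < theta some of these have small centred words,
   and phi vanishes on those words. The cutoff on norms is lowered by clipping
   spectra, and microstates in all large dimensions come from direct sums of
   copies of a single one. *)
Require Import Defs.
From HB Require Import structures.
From mathcomp Require Import all_boot all_order all_algebra.
From mathcomp Require Import spectral complex.
From mathcomp Require Import all_classical all_reals all_analysis.
From mathcomp Require Import ring lra.
From mathcomp Require Import measurable_realfun.

(** * Centred products *)

(** [phi] is tracial on each side only, whereas microstates are evaluated by a trace. Right letters
    are therefore stored in reverse order: a product of left variables followed by right ones
    becomes one linear word, on which left operators act from one end and right operators from the
    other, and whose letters the matrices multiply in that same order. Bi-freeness then reads like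
    freeness of alternating centred words, except that the first and the last block may share a
    colour; for matrices, cyclicity of the trace merges these two. In the converse direction the
    cutoff provided by chi_orb = 0 depends on eta, whereas theta depends on the cutoff. Clipping to
    one fixed cutoff breaks this circle. It is cheap because microstates also reproduce a high even
    moment, which controls the spectrum beyond the norms of the variables. A bound of the form (c P
    / d^2)^P tolerates any loss of the form C^P, so all inequalities may be crude; with P
    proportional to d^2 it decays at the speed at which entropy is normalized. *)

Section Words.
Local Set Implicit Arguments.
Local Unset Strict Implicit.
Import Order.TTheory GRing.Theory Num.Theory.
Import numFieldNormedType.Exports.
Local Open Scope classical_set_scope.
Local Open Scope ring_scope.

Context {L : Type} {K : eqType} (col : L -> K) (isr : L -> bool).

(** The shape of the words that microstates control. It survives the deletion of inner blocks, which
    the expansion of a centred product requires. *)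
Definition valid (w : seq L) : bool := sorted (fun x y => isr x ==> isr y) w.

Definition mono (k : K) (w : seq L) : bool := all (fun x => col x == k) w.

Definition wf_blocks (bs : seq (K * seq L)) : bool :=
  all (fun b => ~~ nilp b.2 && mono b.1 b.2) bs &&
  sorted (fun b b' => b.1 != b'.1) bs.

Definition flat (bs : seq (K * seq L)) : seq L := flatten (map snd bs).

Lemma valid_catl u v : valid (u ++ v) -> valid u.
Proof.
by rewrite /valid; case: u => //= x u; rewrite cat_path => /andP[].
Qed.

Lemma path_isr_weak x y s : (isr x ==> isr y) ->
  path (fun x y => isr x ==> isr y) y s -> path (fun x y => isr x ==> isr y) x s.
Proof. by case: s => //= z s; move: (isr x) (isr y) (isr z) => [] [] []. Qed.

Lemma valid_catr u v : valid (u ++ v) -> valid v.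
Proof.
rewrite /valid; elim: u => //= x u IH h; apply: IH.
by case: (u ++ v) h => //= y s /andP[].
Qed.

Lemma valid_del u v t : valid (u ++ v ++ t) -> valid (u ++ t).
Proof.
rewrite /valid; elim: u => [|x u IH] /=; first exact: valid_catr.
case: u IH => [|y u] IH /=; last by move=> /andP[-> /IH].
by elim: v {IH} => //= y v IHv /andP[xy h]; apply: IHv; exact: path_isr_weak h.
Qed.

Lemma valid_cat_left s t : ~~ has isr s -> valid t -> valid (s ++ t).
Proof.
elim: s => [|x s IH] //=; rewrite negb_or => /andP[xl sl] vt.
have := IH sl vt; rewrite /valid /=.
by case: (s ++ t) => //= y u ->; rewrite (negbTE xl).
Qed.

Lemma valid_right t : all isr t -> valid t.
Proof.
rewrite /valid; case: t => //= x t /andP[_]; elim: t x => //= y t IH x /andP[yr tr].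
by rewrite yr implybT IH.
Qed.

Lemma all_isr_path x w : isr x -> path (fun x y => isr x ==> isr y) x w -> all isr w.
Proof. by elim: w x => //= y w IH x -> /= /andP[yr /(IH _ yr) ->]; rewrite yr. Qed.

Lemma blocksP w : exists2 bs, wf_blocks bs & flat bs = w.
Proof.
elim: w => [|x w [bs wbs <-]]; first by exists [::].
case: bs wbs => [|[k b] bs] wbs.
  by exists [:: (col x, [:: x])] => //; rewrite /wf_blocks /mono /= eqxx.
have [xk|xk] := eqVneq (col x) k.
  exists ((k, x :: b) :: bs) => //; move: wbs => /andP[/= /andP[/andP[_ mb] ab] pb].
  by rewrite /wf_blocks /= xk eqxx mb ab /=; case: bs pb {ab}.
exists ((col x, [:: x]) :: (k, b) :: bs) => //; move: wbs.
by rewrite /wf_blocks /= eqxx xk.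
Qed.

Context {C : numFieldType}.

(* The value of [psi] on [acc * prod_b (b - psi b)], expanded. *)
Fixpoint cent (psi : seq L -> C) (acc : seq L) (bs : seq (K * seq L)) : C :=
  if bs is b :: bs' then
    cent psi (acc ++ b.2) bs' - psi b.2 * cent psi acc bs'
  else psi acc.

Context {T : Type} (F : set_system T) {FF : Filter F}.
Implicit Types f g : T -> C.

Definition cv f (a : C) := f @ F --> a.

Lemma cvP f a : cv f a <-> forall e : C, 0 < e -> F [set t | `|f t - a| < e].
Proof.
rewrite /cv; split.
  by move=> /cvgrPdist_lt h e e0; apply: filterS (h _ e0) => t; rewrite /= distrC.
move=> h; apply/cvgrPdist_lt => e e0; apply: filterS (h _ e0) => t.
by rewrite /= distrC.
Qed.

Variables (psi : T -> seq L -> C) (phi : seq L -> C).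

Lemma cent_cv acc bs : valid (acc ++ flat bs) ->
  (forall w, (size w <= size (acc ++ flat bs))%N -> valid w ->
     cv (psi^~ w) (phi w)) ->
  cv (fun t => cent (psi t) acc bs) (cent phi acc bs).
Proof.
elim: bs acc => [|b bs IH] acc /=.
  by rewrite /flat /= cats0 => va; apply.
rewrite /flat /= -/(flat bs) => va h; apply: cvgB.
  by apply: IH; rewrite -catA.
apply: cvgM.
  apply: h; first by rewrite !size_cat addnCA leq_addr.
  exact: valid_catl (valid_catr va).
apply: IH; first exact: valid_del va.
move=> w hw; apply: h; apply: leq_trans hw _.
by rewrite !size_cat leq_add2l leq_addl.
Qed.

(** In the expanded product only one term has full length, namely [psi] of the whole word. In every
    other term some nonempty block has been replaced by its scalar, so only shorter words occur. *)
Lemma cent_top_cv acc bs : valid (acc ++ flat bs) ->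
  all (fun b => ~~ nilp b.2) bs ->
  all (fun b => size b.2 < size (acc ++ flat bs))%N bs ->
  (forall w, (size w < size (acc ++ flat bs))%N -> valid w ->
     cv (psi^~ w) (phi w)) ->
  cv (fun t => cent (psi t) acc bs - psi t (acc ++ flat bs))
     (cent phi acc bs - phi (acc ++ flat bs)).
Proof.
elim: bs acc => [|b bs IH] acc /=.
  rewrite /flat /= cats0 => _ _ _ _; rewrite subrr.
  by under eq_fun do rewrite subrr; apply: cvg_cst.
rewrite /flat /= -/(flat bs) => va /andP[b0 bs0] /andP[sb sbs] h.
rewrite (_ : (fun t => _) = (fun t => (cent (psi t) (acc ++ b.2) bs
    - psi t ((acc ++ b.2) ++ flat bs)) - psi t b.2 * cent (psi t) acc bs)); last first.
  by apply/funext => t; rewrite -catA addrAC.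
rewrite addrAC catA; apply: cvgB.
  by apply: IH; rewrite // -catA.
apply: cvgM.
  by apply: h => //; exact: valid_catl (valid_catr va).
apply: cent_cv; first exact: valid_del va.
move=> w hw; apply: h; apply: leq_ltn_trans hw _.
by rewrite !size_cat ltn_add2l -[X in (X < _)%N]add0n ltn_add2r lt0n.
Qed.

Hypothesis pure_cv : forall k w, valid w -> mono k w -> cv (psi^~ w) (phi w).
Hypothesis phi_free : forall bs, (1 < size bs)%N -> wf_blocks bs ->
  valid (flat bs) -> cent phi [::] bs = 0.
Hypothesis psi_free : forall bs, (1 < size bs)%N -> wf_blocks bs ->
  valid (flat bs) -> cv (fun t => cent (psi t) [::] bs) 0.
Hypothesis nil_cv : cv (psi^~ [::]) (phi [::]).

(** Moments of single colours together with the vanishing of centred products determine all moments,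
    by induction on length: the centred product tends to 0, and what it adds to [psi w] involves
    shorter words only. The filter is left general because the lemma serves both for convergence in
    probability and, over a one-point type, for equality. *)
Lemma moments_cv w : valid w -> cv (psi^~ w) (phi w).
Proof.
have [N sN] := ubnP (size w); elim: N => // N IH in w sN *.
have [bs wbs bsw] := blocksP w.
case: bs => [|b [|c bs]] in wbs bsw *; first by rewrite -bsw.
  move=> vw; apply: (@pure_cv b.1) => //; rewrite -bsw /flat /= cats0.
  by move: wbs => /andP[/= /andP[/andP[]]].
move=> vw; move: (wbs) => /andP[nl _].
have nl0 : all (fun b => ~~ nilp b.2) [:: b, c & bs].
  by apply: sub_all nl => x /andP[].
have lts : all (fun b0 => size b0.2 < size ([::] ++ flat [:: b, c & bs]))%N [:: b, c & bs].
  move: nl0; rewrite /flat /= !size_cat => /and3P[b0 c0 bs0].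
  have b1 : (0 < size b.2)%N by rewrite lt0n.
  have c1 : (0 < size c.2)%N by rewrite lt0n.
  apply/and3P; split.
  - by rewrite -addn1 leq_add2l (leq_trans c1) ?leq_addr.
  - by rewrite addnCA -addn1 leq_add2l (leq_trans b1) ?leq_addr.
  elim: bs {wbs bsw nl bs0} => //= d bs IHbs; rewrite size_cat.
  apply/andP; split.
    by rewrite addnA addnCA -addn1 leq_add2l (leq_trans b1) -?addnA ?leq_addr.
  by apply: sub_all IHbs => x hx; apply: leq_trans hx _; rewrite !leq_add2l leq_addl.
have vf : valid ([::] ++ flat [:: b, c & bs]) by rewrite bsw.
have H := @cent_top_cv [::] _ vf nl0 lts.
have {}H : cv (fun t => cent (psi t) [::] [:: b, c & bs] - psi t w) (- phi w).
  rewrite -[- phi w]add0r -(@phi_free [:: b, c & bs]) // -?bsw //.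
  apply: H => u su vu; apply: IH => //; rewrite -ltnS.
  by apply: leq_trans sN; rewrite -bsw ltnS.
have H2 := cvgB (@psi_free [:: b, c & bs] isT wbs vf) H.
rewrite opprK add0r in H2.
rewrite /cv (_ : psi^~ w = (fun t => cent (psi t) [::] [:: b, c & bs] -
   (cent (psi t) [::] [:: b, c & bs] - psi t w))); first exact: H2.
by apply/funext => t; rewrite opprB addrC subrK.
Qed.

End Words.
(** * Free products and bi-freeness *)

Section PointedSpaces.
Local Set Implicit Arguments.
Local Unset Strict Implicit.
Import GRing.Theory.
Local Open Scope ring_scope.
Local Open Scope complex_scope.
Context {R : realType}.
Implicit Types V : @pointed_space R.

Lemma ps_circB V (x y : V) : ps_circ x -> ps_circ y -> ps_circ (x - y).
Proof. by move=> hx hy; rewrite addrC -scaleN1r; apply: ps_circ_lin. Qed.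

Lemma ps_coef_unique V (c : R[i]) (x : V) : ps_circ (x - c *: ps_xi V) -> ps_coef x = c.
Proof.
move=> h; apply/eqP; rewrite -subr_eq0; apply/eqP; apply: (@ps_direct _ V).
have := ps_circB h (ps_decomp x).
by rewrite opprB addrC addrA subrK -scalerBl.
Qed.

Lemma ps_coef_lin V (c : R[i]) (x y : V) : ps_coef (c *: x + y) = c * ps_coef x + ps_coef y.
Proof.
apply: ps_coef_unique.
have := ps_circ_lin c (ps_decomp x) (ps_decomp y).
by rewrite scalerBr scalerA addrACA -opprD -scalerDl.
Qed.

Lemma ps_coef0 V (x : V) : ps_circ x -> ps_coef x = 0.
Proof. by move=> h; apply: ps_coef_unique; rewrite scale0r subr0. Qed.

Lemma ps_coef_xi V : ps_coef (ps_xi V) = 1.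
Proof. by apply: ps_coef_unique; rewrite scale1r subrr; apply: ps_circ0. Qed.

Lemma ps_coefZ V c (x : V) : ps_coef (c *: x) = c * ps_coef x.
Proof. by rewrite -[c *: x]addr0 ps_coef_lin (ps_coef0 (ps_circ0 V)) addr0. Qed.

Lemma ps_coefB V (x y : V) : ps_coef (x - y) = ps_coef x - ps_coef y.
Proof. by rewrite addrC -scaleN1r ps_coef_lin mulN1r addrC. Qed.

Lemma ps_rest_circ V (x : V) : ps_circ (ps_rest x).
Proof. exact: ps_decomp. Qed.

Lemma ps_rest_id V (x : V) : ps_circ x -> ps_rest x = x.
Proof. by move=> h; rewrite /ps_rest ps_coef0 // scale0r subr0. Qed.

Lemma ps_rest_xi V : ps_rest (ps_xi V) = 0.
Proof. by rewrite /ps_rest ps_coef_xi scale1r subrr. Qed.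

Lemma ps_rest_lin V c (x y : V) : ps_rest (c *: x + y) = c *: ps_rest x + ps_rest y.
Proof.
by rewrite /ps_rest ps_coef_lin scalerBr scalerA addrACA -opprD -scalerDl.
Qed.

End PointedSpaces.

(** * Centred products of left and right operators on a free product *)

Section BiFreeWords.
Local Set Implicit Arguments.
Local Unset Strict Implicit.
Import GRing.Theory.
Local Open Scope ring_scope.
Local Open Scope complex_scope.
Context {R : realType} {K : eqType} (P : K -> @pointed_space R).
Local Notation lett := (letter P).

Lemma reduced_rcons (w : seq lett) z :
  reduced w -> last_ne (tag z) w -> ps_circ (tagged z) -> reduced (rcons w z).
Proof.
elim: w => [|y w IH] //= [cy hy rw] lw cz; split=> //.
  case: w {IH} hy lw rw => //= _ lw _.
  by move: lw; rewrite /last_ne /= eq_sym.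
apply: IH => //; move: lw; rewrite /last_ne rev_cons.
by elim/last_ind: w {hy rw} => // w u _; rewrite rev_rcons /=.
Qed.

Lemma last_ne_rcons k (w : seq lett) z : last_ne k (rcons w z) = (tag z != k).
Proof. by rewrite /last_ne rev_rcons. Qed.

Context (X : @pointed_space R) (tensor : seq lett -> X).
Hypothesis fp : is_free_product tensor.

Let multi : multilinear tensor. Proof. by case: fp. Qed.

Lemma tensor_zero u v k : reduced (u ++ mk_letter (0 : P k) :: v) ->
  tensor (u ++ mk_letter (0 : P k) :: v) = 0.
Proof.
move=> h; have := @multi u v k 0 0 (-1) h h.
by rewrite scaler0 addr0 scaleN1r addNr.
Qed.

Lemma free_V_xi k w : reduced w -> head_ne k w ->
  free_V tensor (ps_xi (P k)) w = tensor w.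
Proof.
move=> rw hw; rewrite /free_V ps_coef_xi scale1r ps_rest_xi.
rewrite -[_ :: w]cat0s tensor_zero ?addr0 //=; split=> //; exact: ps_circ0.
Qed.

Lemma free_W_xi k w : reduced w -> last_ne k w ->
  free_W tensor w (ps_xi (P k)) = tensor w.
Proof.
move=> rw hw; rewrite /free_W ps_coef_xi scale1r ps_rest_xi -cats1.
rewrite tensor_zero ?addr0 // cats1; apply: reduced_rcons => //; exact: ps_circ0.
Qed.

Lemma free_VW_nil k (x : P k) : free_V tensor x [::] = free_W tensor [::] x.
Proof. by []. Qed.

Lemma coef_tensor z w : reduced (z :: w) -> ps_coef (tensor (z :: w)) = 0.
Proof. by case: fp => _ _ h _ /h; exact: ps_coef0. Qed.

Lemma coef_free_V k (x : P k) : ps_coef (free_V tensor x [::]) = ps_coef x.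
Proof.
rewrite /free_V ps_coef_lin coef_tensor; last by split=> //; exact: ps_rest_circ.
by case: fp => _ -> _ _; rewrite ps_coef_xi mulr1 addr0.
Qed.

Context (lambda rho : forall k, {linear P k -> P k} -> {linear X -> X}).
Hypothesis lambdaP : forall k (T : {linear P k -> P k}), is_lambda tensor T (lambda T).
Hypothesis rhoP : forall k (T : {linear P k -> P k}), is_rho tensor T (rho T).

Context {L : Type} (col : L -> K) (isr : L -> bool).
Context (t : L -> forall k, {linear P k -> P k}).

Definition theta (x : L) : {linear X -> X} :=
  if isr x then rho (t x (col x)) else lambda (t x (col x)).

Definition act (s : seq L) (v : X) : X := foldr (fun x => theta x) v s.
Definition act1 k (s : seq L) (v : P k) : P k := foldr (fun x => t x k) v s.

Lemma act_cat s s' v : act (s ++ s') v = act s (act s' v).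
Proof. by rewrite /act foldr_cat. Qed.

Lemma act_lin s c v v' : act s (c *: v + v') = c *: act s v + act s v'.
Proof. by elim: s => //= x s ->; rewrite linearP. Qed.

Lemma actB s v v' : act s (v - v') = act s v - act s v'.
Proof. by rewrite addrC -scaleN1r act_lin scaleN1r addrC. Qed.

Lemma actZ s c v : act s (c *: v) = c *: act s v.
Proof. by elim: s => //= x s ->; rewrite linearZ. Qed.

Lemma act_left k s (x : P k) w : reduced w -> head_ne k w -> mono col k s -> ~~ has isr s ->
  act s (free_V tensor x w) = free_V tensor (act1 s x) w.
Proof.
move=> rw hw; elim: s => //= y s IH /andP[/eqP yk ms]; rewrite negb_or => /andP[yl sl].
by rewrite IH // /theta (negbTE yl) yk lambdaP.
Qed.

Lemma act_right k s (x : P k) w : reduced w -> last_ne k w -> mono col k s -> all isr s ->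
  act s (free_W tensor w x) = free_W tensor w (act1 s x).
Proof.
move=> rw hw; elim: s => //= y s IH /andP[/eqP yk ms] /andP[yr sr].
by rewrite IH // /theta yr yk rhoP.
Qed.

(* The word [w] stands for the product of its left letters followed by its
   right letters in reverse order. *)
Definition lr (w : seq L) : seq L :=
  [seq x <- w | ~~ isr x] ++ rev [seq x <- w | isr x].

Definition mom (w : seq L) : R[i] := ps_coef (act (lr w) (ps_xi X)).

Lemma tensor_nil : tensor [::] = ps_xi X.
Proof. by case: fp. Qed.

Lemma mono_filter (p : pred L) k w : mono col k w -> mono col k [seq x <- w | p x].
Proof. by move=> h; rewrite /mono all_filter; apply: sub_all h => x /= h; apply/implyP. Qed.

Lemma mono_rev k w : mono col k (rev w) = mono col k w.
Proof. exact: all_rev. Qed.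

Lemma has_filterN w : ~~ has isr [seq x <- w | ~~ isr x].
Proof. by elim: w => //= x w IH; case: ifP => //=; rewrite negb_or => ->. Qed.

Lemma filter_isr_all w : all isr w ->
  [seq x <- w | isr x] = w /\ [seq x <- w | ~~ isr x] = [::].
Proof. by elim: w => //= x w IH /andP[-> /IH[-> ->]]. Qed.

Lemma filter_isr_none w : ~~ has isr w ->
  [seq x <- w | isr x] = [::] /\ [seq x <- w | ~~ isr x] = w.
Proof. by elim: w => //= x w IH; rewrite negb_or => /andP[/negbTE -> /IH[-> ->]]. Qed.

Lemma act_mono k w : mono col k w ->
  act (lr w) (ps_xi X) = free_V tensor (act1 (lr w) (ps_xi (P k))) [::].
Proof.
move=> mw; rewrite -tensor_nil -(@free_V_xi k) // /lr act_cat.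
rewrite free_VW_nil act_right ?mono_rev ?mono_filter //; last first.
  by rewrite all_rev; exact: filter_all.
rewrite -free_VW_nil act_left ?mono_filter ?has_filterN //.
by rewrite /act1 foldr_cat.
Qed.

Lemma mom_mono k w : mono col k w -> mom w = ps_coef (act1 (lr w) (ps_xi (P k))).
Proof. by move=> mw; rewrite /mom (act_mono mw) coef_free_V. Qed.

(** Since [lr] reverses the right letters, the first right block acts first; left blocks act in the
    usual order, the first one last. This is why [dright] passes its vector on as an accumulator and
    [dleft] does not. *)
Fixpoint dright (bs : seq (K * seq L)) (v : X) : X :=
  if bs is b :: bs' then dright bs' (act (rev b.2) v - mom b.2 *: v) else v.

Fixpoint dleft (bs : seq (K * seq L)) (v : X) : X :=
  if bs is b :: bs' then act b.2 (dleft bs' v) - mom b.2 *: dleft bs' v else v.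

Lemma dright_lin bs c v v' : dright bs (c *: v + v') = c *: dright bs v + dright bs v'.
Proof.
elim: bs v v' => //= b bs IH v v'; rewrite -IH; congr dright.
by rewrite act_lin scalerBr scalerDr !scalerA [mom _ * c]mulrC opprD addrACA.
Qed.

Lemma drightB bs v v' : dright bs (v - v') = dright bs v - dright bs v'.
Proof. by rewrite addrC -scaleN1r dright_lin scaleN1r addrC. Qed.

Lemma drightZ bs c v : dright bs (c *: v) = c *: dright bs v.
Proof.
have h0 : dright bs 0 = 0 by have := drightB bs 0 0; rewrite !subrr.
by rewrite -[c *: v]addr0 dright_lin h0 addr0.
Qed.

Lemma cent_right acc bs : all (fun b => all isr b.2) bs ->
  cent mom acc bs = ps_coef (act [seq x <- acc | ~~ isr x]
    (dright bs (act (rev [seq x <- acc | isr x]) (ps_xi X)))).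
Proof.
elim: bs acc => [|b bs IH] acc /=; first by rewrite /mom /lr act_cat.
move=> /andP[br bsr]; rewrite !IH // !filter_cat.
have [-> ->] := filter_isr_all br.
rewrite cats0 rev_cat act_cat drightB drightZ actB actZ.
by rewrite ps_coefB ps_coefZ.
Qed.

Lemma cent_left acc bl bt v : ~~ has isr acc -> all (fun b => ~~ has isr b.2) bl ->
  (forall acc, ~~ has isr acc -> cent mom acc bt = ps_coef (act acc v)) ->
  cent mom acc (bl ++ bt) = ps_coef (act acc (dleft bl v)).
Proof.
move=> accl + h; elim: bl acc accl => [|b bl IH] acc accl /=; first by move=> _; exact: h.
move=> /andP[bL blL]; rewrite !IH //; last by rewrite has_cat negb_or accl.
by rewrite act_cat actB actZ ps_coefB ps_coefZ.
Qed.

(** At most one block of a valid word mixes both sides. The block [j] is the first one containing a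
    right letter, or the last block if there is none. *)
Lemma junction (bs : seq (K * seq L)) : valid isr (flat bs) -> ~~ nilp bs ->
  exists bl j br, [/\ bs = bl ++ j :: br, all (fun b => ~~ has isr b.2) bl
    & all (fun b => all isr b.2) br].
Proof.
elim: bs => // b bs IH vb _; case hb : (has isr b.2).
  exists [::], b, bs; split=> //.
  move: vb; rewrite /flat /= -/(flat bs); case: b hb => k b /=.
  elim: b => //= x b IHb /orP[xr|bh].
    move=> /(all_isr_path xr); rewrite all_cat => /andP[_].
    by elim: bs {IH IHb} => //= b' bs IHbs; rewrite /flat /= all_cat => /andP[-> /IHbs].
  by move=> h; apply: IHb => //; apply: (@valid_catr _ isr [:: x]).
have [/nilP ->|bs0] := boolP (nilp bs).
  by exists [::], b, [::].
have [|bl [j [br [-> hl hr]]]] := IH _ bs0.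
  by move: vb; rewrite /flat /=; exact: valid_catr.
by exists (b :: bl), j, br; split=> //=; rewrite hb.
Qed.

(** On a reduced word not ending in its colour, a right block yields its moment times the word plus
    the word extended by a centred letter. Centring removes the first term, so each block appends
    one letter; the next colour differs, and the argument repeats. *)
Lemma dright_tensor br : all (fun b => mono col b.1 b.2) br ->
  all (fun b => all isr b.2) br ->
  sorted (fun b b' => b.1 != b'.1) br ->
  exists2 ys : seq lett, map tag ys = map fst br &
   forall w, reduced w -> (if br is b :: _ then last_ne b.1 w else True) ->
     reduced (w ++ ys) /\ dright br (tensor w) = tensor (w ++ ys).
Proof.
move=> + + +; elim: br => [|b br IH] /=.
  by move=> _ _ _; exists [::] => // u ru _; rewrite cats0.
move=> /andP[mb mbr] /andP[rb rbr] pb.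
have [|ys tys hys] := IH mbr rbr; first exact: path_sorted pb.
pose y := act1 (rev b.2) (ps_xi (P b.1)).
exists (mk_letter (ps_rest y) :: ys) => [|u ru lu]; first by rewrite /= tys.
have rz : reduced (rcons u (mk_letter (ps_rest y))).
  by apply: reduced_rcons => //; exact: ps_rest_circ.
rewrite -cat_rcons; have -> : act (rev b.2) (tensor u) - mom b.2 *: tensor u =
    tensor (rcons u (mk_letter (ps_rest y))).
  rewrite -{1}(free_W_xi ru lu) act_right ?mono_rev // ?all_rev // /free_W.
  rewrite (mom_mono mb) /lr.
  have [-> ->] := filter_isr_all rb; rewrite cat0s -/y.
  by rewrite addrAC subrr add0r.
apply: hys => //.
by case: br {IH mbr rbr tys} pb => //= c br /andP[bc _]; rewrite last_ne_rcons.
Qed.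


Lemma dleft_tensor bl z (w : seq lett) : all (fun b => mono col b.1 b.2) bl ->
  all (fun b => ~~ has isr b.2) bl -> reduced (z :: w) ->
  sorted (fun i j => i != j) (rcons (map fst bl) (tag z)) ->
  exists z' w', [/\ dleft bl (tensor (z :: w)) = tensor (z' :: w'),
    reduced (z' :: w') & tag z' = head (tag z) (map fst bl)].
Proof.
move=> + + rz; elim: bl => [|b bl IH] /=; first by move=> _ _ _; exists z, w.
move=> /andP[mb mbl] /andP[lb lbl] pb.
have [|z' [w' [-> rz' tz']]] := IH mbl lbl; first exact: path_sorted pb.
pose y := act1 b.2 (ps_xi (P b.1)).
have hz' : head_ne b.1 (z' :: w').
  rewrite /= tz' eq_sym; case: bl pb {IH mbl lbl tz'} => [|c bl] /= /andP[]; by [].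
exists (mk_letter (ps_rest y)), (z' :: w'); split=> //; last first.
  by split=> //; exact: ps_rest_circ.
rewrite -{1}(free_V_xi rz' hz') act_left // /free_V (mom_mono mb) /lr.
have [-> ->] := filter_isr_none lb; rewrite cats0 -/y.
by rewrite addrAC subrr add0r.
Qed.

(** The junction block contributes one centred letter, right blocks append letters behind it and
    left blocks prepend letters in front. The outcome is the tensor of a nonempty reduced word,
    which has no component along the state vector. *)
Lemma bifree_cent bs : ~~ nilp bs -> wf_blocks col bs -> valid isr (flat bs) ->
  cent mom [::] bs = 0.
Proof.
move=> bs0 /andP[mbs sbs] vbs.
have [bl [j [br [ebs hl hr]]]] := junction vbs bs0.
have {}mbs : all (fun b => mono col b.1 b.2) bs by apply: sub_all mbs => b /andP[].
have {}sbs : sorted (fun i j => i != j) (map fst bs).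
  by move: sbs; rewrite -(@map_id _ bs) map_id sorted_map.
move: mbs sbs; rewrite ebs all_cat map_cat /= => /and3P[mbl mj mbr] sbs.
have sbl : sorted (fun i j => i != j) (rcons (map fst bl) j.1).
  by move: sbs; rewrite -cat_rcons; case: (rcons _ _) => //= i s; rewrite cat_path => /andP[].
have sbr : path (fun i j => i != j) j.1 (map fst br).
  by move: sbs; case: (map fst bl) => //= i s; rewrite cat_path /= => /and3P[].
have sbr' : sorted (fun b b' : K * seq L => b.1 != b'.1) br.
  by move: (path_sorted sbr); rewrite sorted_map.
pose y := act1 (lr j.2) (ps_xi (P j.1)).
pose x := act1 (rev [seq x <- j.2 | isr x]) (ps_xi (P j.1)).
have [ys tys hys] := dright_tensor mbr hr sbr'.
have hne : head_ne j.1 ys.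
  move: tys sbr; case: br {hys mbr hr sbr' sbs ebs} => [|b br] /=; case: ys => //= z ys.
  by case=> -> _ /andP[bj _]; rewrite eq_sym.
have [ry dr0] : reduced ys /\ dright br (tensor [::]) = tensor ys.
  by apply: (hys [::]) => //; case: (br).
(* The right half of the junction block produces [x], and later right blocks extend the word behind
   it only. So [x] stays at the left end, within reach of the left half of the block. *)
have drV : dright br (free_V tensor x [::]) = free_V tensor x ys.
  rewrite /free_V dright_lin dr0; congr (_ + _).
  have [||_ ->] := hys [:: mk_letter (ps_rest x)] => //=.
    by split=> //; exact: ps_rest_circ.
  by case: (br) sbr => //= b br' /andP[jb _]; rewrite /last_ne.
have rz : reduced (mk_letter (ps_rest y) :: ys) by split=> //; exact: ps_rest_circ.
have [|z' [w' [hd rz' _]]] := dleft_tensor mbl hl rz; first by [].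
pose v := tensor (mk_letter (ps_rest y) :: ys).
rewrite (@cent_left _ _ _ v) //; first by rewrite /= hd coef_tensor.
move=> acc al /=; rewrite !cent_right // !filter_cat.
have [-> ->] := filter_isr_none al; rewrite cat0s /=.
have -> : act (rev [seq x0 <- j.2 | isr x0]) (ps_xi X) = free_V tensor x [::].
  rewrite -tensor_nil -(@free_W_xi j.1) //.
  rewrite act_right ?mono_rev ?mono_filter //.
  by rewrite all_rev; exact: filter_all.
rewrite drV -tensor_nil dr0 act_cat.
rewrite (@act_left j.1) ?mono_filter ?has_filterN //.
have -> : act1 [seq x0 <- j.2 | ~~ isr x0] x = y by rewrite /y /lr /act1 foldr_cat.
rewrite (mom_mono mj) -/y -ps_coefZ -ps_coefB -actZ -actB; congr (ps_coef (act _ _)).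
by rewrite /free_V addrAC subrr add0r.
Qed.


End BiFreeWords.

(** * Existence of free products of pointed spaces *)

Section FreeProductConstruction.
Local Set Implicit Arguments.
Local Unset Strict Implicit.
Import GRing.Theory.
Local Open Scope classical_set_scope.
Local Open Scope ring_scope.
Local Open Scope complex_scope.
Context {R : realType} {K : eqType} (P : K -> @pointed_space R).
Local Notation lett := (letter P).

Definition fsum : Type := seq (R[i] * seq lett).

(* Words that are not reduced count as zero. *)
Definition fsum_eval (V : lmodType R[i]) (g : seq lett -> V) (s : fsum) : V :=
  \sum_(p <- s) (if `[< reduced p.2 >] then p.1 *: g p.2 else 0).

(** The universal property taken as a definition of equality: formal sums are identified when no
    multilinear map separates them. Linear operations and evaluations then descend to the quotient
    without any explicit tensor relations. *)
Definition fsum_eq (s s' : fsum) : Prop :=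
  forall (V : lmodType R[i]) (g : seq lett -> V), multilinear g ->
    fsum_eval g s = fsum_eval g s'.

Definition fprod_car : Type :=
  {S : set fsum | exists s, S = [set s' | fsum_eq s s']}.

HB.instance Definition _ := gen_eqMixin fprod_car.
HB.instance Definition _ := gen_choiceMixin fprod_car.

Definition fpi (s : fsum) : fprod_car := exist _ _ (ex_intro _ s erefl).
Definition frepr (q : fprod_car) : fsum := projT1 (cid (proj2_sig q)).
Definition feval (V : lmodType R[i]) (g : seq lett -> V) (q : fprod_car) : V :=
  fsum_eval g (frepr q).

Lemma feval_pi (V : lmodType R[i]) (g : seq lett -> V) s :
  multilinear g -> feval g (fpi s) = fsum_eval g s.
Proof.
move=> mg; rewrite /feval /frepr; case: cid => s' /= e.
have : [set s'' | fsum_eq s' s''] s by rewrite -e /=.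
by apply.
Qed.

Lemma feval_ext q q' :
  (forall (V : lmodType R[i]) (g : seq lett -> V), multilinear g -> feval g q = feval g q') ->
  q = q'.
Proof.
rewrite /feval /frepr; case: q => S hS; case: q' => S' hS' /=.
case: cid => s /= e; case: cid => s' /= e' h.
have E : S = S'.
  rewrite e e'; apply/seteqP; split=> u /= hu V g mg.
    by rewrite -hu // h.
  by rewrite -hu // h.
by rewrite {h e e'}E in hS *; congr exist; exact: Prop_irrelevance.
Qed.

Lemma fsum_eval_cat (V : lmodType R[i]) (g : seq lett -> V) s s' :
  fsum_eval g (s ++ s') = fsum_eval g s + fsum_eval g s'.
Proof. by rewrite /fsum_eval big_cat. Qed.

Lemma fsum_evalZ (V : lmodType R[i]) (g : seq lett -> V) c s :
  fsum_eval g [seq (c * p.1, p.2) | p <- s] = c *: fsum_eval g s.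
Proof.
rewrite /fsum_eval big_map scaler_sumr; apply: eq_bigr => p _ /=.
by case: ifP; rewrite ?scalerA ?scaler0.
Qed.

Definition fadd q q' := fpi (frepr q ++ frepr q').
Definition fscale c q := fpi [seq (c * p.1, p.2) | p <- frepr q].

Lemma feval_add (V : lmodType R[i]) (g : seq lett -> V) q q' :
  multilinear g -> feval g (fadd q q') = feval g q + feval g q'.
Proof. by move=> mg; rewrite feval_pi // fsum_eval_cat. Qed.

Lemma feval_scale (V : lmodType R[i]) (g : seq lett -> V) c q :
  multilinear g -> feval g (fscale c q) = c *: feval g q.
Proof. by move=> mg; rewrite feval_pi // fsum_evalZ. Qed.

Lemma feval0 (V : lmodType R[i]) (g : seq lett -> V) :
  multilinear g -> feval g (fpi [::]) = 0.
Proof. by move=> mg; rewrite feval_pi // /fsum_eval big_nil. Qed.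

Lemma faddA : associative fadd.
Proof. by move=> x y z; apply: feval_ext => V g mg; rewrite !feval_add // addrA. Qed.
Lemma faddC : commutative fadd.
Proof. by move=> x y; apply: feval_ext => V g mg; rewrite !feval_add // addrC. Qed.
Lemma fadd0 : left_id (fpi [::]) fadd.
Proof. by move=> x; apply: feval_ext => V g mg; rewrite feval_add // feval0 // add0r. Qed.
Lemma faddN : left_inverse (fpi [::]) (fscale (-1)) fadd.
Proof.
move=> x; apply: feval_ext => V g mg.
by rewrite feval_add // feval_scale // feval0 // scaleN1r addNr.
Qed.

HB.instance Definition _ := GRing.isZmodule.Build fprod_car faddA faddC fadd0 faddN.

Lemma fscaleA c c' q : fscale c (fscale c' q) = fscale (c * c') q.
Proof. by apply: feval_ext => V g mg; rewrite !feval_scale // scalerA. Qed.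
Lemma fscale1 : left_id 1 fscale.
Proof. by move=> q; apply: feval_ext => V g mg; rewrite feval_scale // scale1r. Qed.
Lemma fscaleDr : right_distributive fscale +%R.
Proof.
by move=> c x y; apply: feval_ext => V g mg; rewrite !(feval_scale, feval_add) // scalerDr.
Qed.
Lemma fscaleDl q : {morph fscale^~ q : c c' / c + c' >-> c + c'}.
Proof.
by move=> c x; apply: feval_ext => V g mg; rewrite !(feval_scale, feval_add) // scalerDl.
Qed.

HB.instance Definition _ :=
  GRing.Zmodule_isLmodule.Build R[i] fprod_car fscaleA fscale1 fscaleDr fscaleDl.

Lemma feval_linear (V : lmodType R[i]) (g : seq lett -> V) : multilinear g ->
  linear (feval g : fprod_car -> V).
Proof. by move=> mg c x y; rewrite feval_add // feval_scale. Qed.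

Definition ftensor (w : seq lett) : fprod_car := fpi [:: (1, w)].

Lemma feval_tensor (V : lmodType R[i]) (g : seq lett -> V) w : multilinear g ->
  reduced w -> feval g (ftensor w) = g w.
Proof.
by move=> mg rw; rewrite feval_pi // /fsum_eval big_seq1 /= asboolT // scale1r.
Qed.

Definition fcoef_word (w : seq lett) : R[i]^o := (nilp w)%:R.

Lemma fcoef_multi : multilinear fcoef_word.
Proof.
move=> u v k x y c _ _; rewrite /fcoef_word /nilp !size_cat /= !addnS /=.
by rewrite scaler0 addr0.
Qed.

Definition fcoef (q : fprod_car) : R[i] := feval fcoef_word q.

Lemma fcoef_lin c x y : fcoef (c *: x + y) = c * fcoef x + fcoef y.
Proof. exact: (feval_linear fcoef_multi). Qed.

Lemma fcoef_xi : fcoef (ftensor [::]) = 1.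
Proof. by rewrite /fcoef feval_tensor //; exact: fcoef_multi. Qed.

Lemma fcirc0 : [set q | fcoef q = 0] 0.
Proof. exact: feval0 fcoef_multi. Qed.

Lemma fcirc_lin (c : R[i]) x y : fcoef x = 0 -> fcoef y = 0 -> fcoef (c *: x + y) = 0.
Proof. by rewrite fcoef_lin => -> ->; rewrite mulr0 addr0. Qed.

Lemma fdecomp x : fcoef (x - fcoef x *: ftensor [::]) = 0.
Proof. by rewrite addrC -scaleNr fcoef_lin fcoef_xi mulr1 addNr. Qed.

Lemma fdirect c : fcoef (c *: ftensor [::]) = 0 -> c = 0.
Proof.
rewrite -[_ *: _]addr0 fcoef_lin fcoef_xi mulr1.
by rewrite (fcirc0 : fcoef 0 = 0) addr0.
Qed.

Definition fprod_space : @pointed_space R :=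
  @PointedSpace R fprod_car (ftensor [::]) [set q | fcoef q = 0] fcoef
    fcirc0 fcirc_lin fdecomp fdirect.

Lemma reduced_lin (u v : seq lett) k (x y : P k) (c : R[i]) :
  reduced (u ++ mk_letter x :: v) -> reduced (u ++ mk_letter y :: v) ->
  reduced (u ++ mk_letter (c *: x + y) :: v).
Proof.
elim: u => [|z u IH] /=.
  by move=> [cx hx rv] [cy _ _]; split=> //; exact: ps_circ_lin.
by move=> [cz hz ru] [_ _ ru']; split=> //; [case: (u) hz | exact: IH].
Qed.

Lemma fprod_free : @is_free_product R K P fprod_space ftensor.
Proof.
split=> //.
- move=> u v k x y c rx ry.
  apply: feval_ext => V g mg.
  have := feval_linear mg c (ftensor (u ++ mk_letter x :: v)) (ftensor (u ++ mk_letter y :: v)).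
  move=> ->; rewrite !feval_tensor //; last exact: reduced_lin.
  by rewrite mg.
- move=> z w rw; rewrite /= /fcoef feval_tensor //; exact: fcoef_multi.
move=> V g mg.
pose hm := GRing.isLinear.Build _ _ _ _ _ (feval_linear mg).
pose h : {linear fprod_space -> V} := HB.pack (feval g : fprod_space -> V) hm.
exists h; split=> [w rw|h' hh' q] /=; first exact: feval_tensor.
(* Reduced tensors span, which gives uniqueness of the linear extension; words that are not reduced
   contribute zero on both sides. *)
have -> : q = \sum_(p <- frepr q) (if `[< reduced p.2 >] then p.1 *: ftensor p.2 else 0).
  apply: feval_ext => W f mf.
  have fl := feval_linear mf.
  pose fm := GRing.isLinear.Build _ _ _ _ _ fl.
  pose l : {linear fprod_space -> W} := HB.pack (feval f : fprod_space -> W) fm.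
  rewrite {1}/feval -[RHS]/(l _) linear_sum /= /fsum_eval; apply: eq_bigr => p _.
  case: ifPn => [/asboolP rp|_]; last by rewrite -[RHS]/(l 0) linear0.
  by rewrite -[RHS]/(l _) linearZ /= feval_tensor.
rewrite -[RHS]/(h _) !linear_sum; apply: eq_bigr => p _.
case: ifPn => [/asboolP rp|_]; last by rewrite !linear0.
by rewrite !linearZ /= hh' // feval_tensor.
Qed.

End FreeProductConstruction.

(** * Left and right operators on a free product *)

Section FreeProductOperators.
Local Set Implicit Arguments.
Local Unset Strict Implicit.
Import GRing.Theory.
Local Open Scope ring_scope.
Local Open Scope complex_scope.
(* All factors are equal, so that the vector carried by a letter can be compared
   with a vector of the k-th space without transport. *)
Context {R : realType} {K : eqType} (Q : @pointed_space R).
Let P := fun _ : K => Q.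
Local Notation lett := (letter P).
Context (X : @pointed_space R) (tensor : seq lett -> X).
Hypothesis fp : is_free_product tensor.

Let multi : multilinear tensor. Proof. by case: fp. Qed.

Lemma free_V_multi k (y : P k) u v k' (x x' : P k') (c : R[i]) :
  head_ne k (u ++ mk_letter x :: v) ->
  reduced (u ++ mk_letter x :: v) -> reduced (u ++ mk_letter x' :: v) ->
  free_V tensor y (u ++ mk_letter (c *: x + x') :: v) =
  c *: free_V tensor y (u ++ mk_letter x :: v) + free_V tensor y (u ++ mk_letter x' :: v).
Proof.
move=> hk rx rx'; have hk' : head_ne k (u ++ mk_letter x' :: v) by case: (u) hk.
rewrite /free_V multi // -!cat_cons multi //=; try by split=> //; exact: ps_rest_circ.
by rewrite !scalerDr !scalerA [c * _]mulrC addrACA.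
Qed.

Lemma free_W_multi k (y : P k) u v k' (x x' : P k') (c : R[i]) :
  last_ne k (u ++ mk_letter x :: v) ->
  reduced (u ++ mk_letter x :: v) -> reduced (u ++ mk_letter x' :: v) ->
  free_W tensor (u ++ mk_letter (c *: x + x') :: v) y =
  c *: free_W tensor (u ++ mk_letter x :: v) y + free_W tensor (u ++ mk_letter x' :: v) y.
Proof.
move=> hk rx rx'.
have hk' : last_ne k (u ++ mk_letter x' :: v).
  move: hk; rewrite /last_ne !rev_cat !rev_cons -!cats1.
  by case: (rev v).
rewrite /free_W multi // !rcons_cat !rcons_cons multi //; first last.
- rewrite -rcons_cons -rcons_cat; apply: reduced_rcons => //; exact: ps_rest_circ.
- rewrite -rcons_cons -rcons_cat; apply: reduced_rcons => //; exact: ps_rest_circ.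
by rewrite !scalerDr !scalerA [c * _]mulrC addrACA.
Qed.

Lemma free_V_lin k (x y : P k) c w : reduced w -> head_ne k w ->
  free_V tensor (c *: x + y) w = c *: free_V tensor x w + free_V tensor y w.
Proof.
move=> rw hw; rewrite /free_V ps_coef_lin ps_rest_lin -[_ :: w]cat0s multi //=;
  try by split=> //; exact: ps_rest_circ.
by rewrite scalerDl scalerDr !scalerA addrACA.
Qed.

Lemma free_W_lin k (x y : P k) c w : reduced w -> last_ne k w ->
  free_W tensor w (c *: x + y) = c *: free_W tensor w x + free_W tensor w y.
Proof.
move=> rw hw; rewrite /free_W ps_coef_lin ps_rest_lin -!cats1 multi; first last.
- rewrite cats1; apply: reduced_rcons => //; exact: ps_rest_circ.
- rewrite cats1; apply: reduced_rcons => //; exact: ps_rest_circ.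
by rewrite scalerDl scalerDr !scalerA addrACA.
Qed.

Section Lambda.
Variables (k : K) (T : {linear Q -> Q}).
(** A reduced word is read as a vector of the [k]-th space in front of a word not starting in [k]:
    that vector is the head if the head has colour [k], and the state vector otherwise. *)
Definition lambda_word (w : seq lett) : X :=
  match w with
  | z :: w' => if tag z == k then free_V tensor (T (tagged z) : P k) w'
               else free_V tensor (T (ps_xi Q) : P k) w
  | [::] => free_V tensor (T (ps_xi Q) : P k) [::]
  end.

Lemma lambda_word_multi : multilinear lambda_word.
Proof.
case=> [|z u] v k' x x' c /=.
  case: eqVneq => [->|nk] rx rx'.
    by case: rx => _ hv rv; rewrite linearP free_V_lin.
  by rewrite -[mk_letter _ :: v]cat0s free_V_multi.
move=> [cz hz rx] [_ hz' rx']; case: eqVneq => [e|nk].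
  by rewrite free_V_multi // -e.
by rewrite -!cat_cons free_V_multi.
Qed.

Lemma lambda_exists : exists L : {linear X -> X}, @is_lambda R K P X tensor k T L.
Proof.
case: fp => _ _ _ univ; have [L [hL _]] := univ _ _ lambda_word_multi.
exists L => x w rw hw; rewrite {1}/free_V linearD linearZ /= !hL //; last first.
  by split=> //; exact: ps_rest_circ.
rewrite /= eqxx; have -> : lambda_word w = free_V tensor (T (ps_xi Q) : P k) w.
  by case: (w) hw => //= z w'; case: eqP.
rewrite -free_V_lin //; congr free_V; rewrite -linearP; congr (T _).
by rewrite /ps_rest addrC subrK.
Qed.
End Lambda.

Section Rho.
Variables (k : K) (T : {linear Q -> Q}).
Definition rho_word (w : seq lett) : X :=
  match rev w with
  | z :: w' => if tag z == k then free_W tensor (rev w') (T (tagged z) : P k)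
               else free_W tensor w (T (ps_xi Q) : P k)
  | [::] => free_W tensor [::] (T (ps_xi Q) : P k)
  end.

Lemma reduced_rconsl (w : seq lett) z : reduced (rcons w z) ->
  [/\ reduced w, last_ne (tag z) w & ps_circ (tagged z)].
Proof.
elim: w => [|y w IH] /=; first by case.
move=> [cy hy /IH[rw lw cz]]; split=> //; first by split=> //; case: (w) hy.
move: hy; rewrite /last_ne rev_cons; case/lastP: w lw {IH rw} => [|w u].
  by move=> _ /=; rewrite eq_sym.
by rewrite /last_ne rev_rcons.
Qed.

Lemma rho_word_multi : multilinear rho_word.
Proof.
move=> u v k' x x' c; rewrite /rho_word; case/lastP: v => [|v z].
  rewrite !cats1 !rev_rcons /=.
  case: eqVneq => [->|nk] rx rx'; rewrite ?revK.
    by have [ru lu _] := reduced_rconsl rx; rewrite linearP free_W_lin.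
  rewrite -!cats1 in rx rx' *.
  by rewrite free_W_multi // cats1 last_ne_rcons.
rewrite -!rcons_cons -!rcons_cat !rev_rcons => rx rx'.
case: eqVneq => [e|nk]; rewrite ?revK.
  have [ru lu _] := reduced_rconsl rx; have [ru' _ _] := reduced_rconsl rx'.
  by rewrite free_W_multi // -e.
rewrite !rcons_cat !rcons_cons in rx rx' *.
by rewrite free_W_multi // -rcons_cons -rcons_cat last_ne_rcons.
Qed.

Lemma rho_exists : exists L : {linear X -> X}, @is_rho R K P X tensor k T L.
Proof.
case: fp => _ _ _ univ; have [L [hL _]] := univ _ _ rho_word_multi.
exists L => x w rw hw; rewrite {1}/free_W linearD linearZ /= !hL //; last first.
  by apply: reduced_rcons => //; exact: ps_rest_circ.
rewrite /rho_word rev_rcons /= eqxx revK.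
have -> : match rev w with
  | z :: w' => if tag z == k then free_W tensor (rev w') (T (tagged z) : P k)
               else free_W tensor w (T (ps_xi Q) : P k)
  | [::] => free_W tensor [::] (T (ps_xi Q) : P k)
  end = free_W tensor w (T (ps_xi Q) : P k).
  by case/lastP: (w) hw => // s z; rewrite last_ne_rcons rev_rcons; case: eqP.
rewrite -free_W_lin //; congr free_W; rewrite -linearP; congr (T _).
by rewrite /ps_rest addrC subrK.
Qed.
End Rho.

(** The uniqueness clause of the universal property is all that is used, so identities between
    operators need only be checked on reduced words. *)
Lemma linear_tensor_ext (V : lmodType R[i]) (f g : {linear X -> V}) :
  (forall w, reduced w -> f (tensor w) = g (tensor w)) -> f =1 g.
Proof.
move=> h; case: fp => _ _ _ univ.
have mf : multilinear (fun w => f (tensor w)).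
  by move=> u v k x y c rx ry; rewrite multi // linearP.
have [l [_ ul]] := univ _ _ mf.
have ef := ul f (fun w _ => erefl).
by move=> x; rewrite ef (ul g) // => w rw; rewrite h.
Qed.

Context (lambda rho : forall k : K, {linear Q -> Q} -> {linear X -> X}).
Hypothesis lambdaP : forall k T, @is_lambda R K P X tensor k T (lambda k T).
Hypothesis rhoP : forall k T, @is_rho R K P X tensor k T (rho k T).

(* Every reduced word is [x (x) w] with [w] not starting in [k]. *)
Lemma word_free_V k w : reduced w -> exists (x : P k) w',
  [/\ reduced w', head_ne k w' & tensor w = free_V tensor x w'].
Proof.
case: w => [|z w] rw; first by exists (ps_xi Q), [::]; rewrite free_V_xi.
have [e|nk] := eqVneq (tag z) k; last by exists (ps_xi Q), (z :: w); rewrite free_V_xi.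
case: z e rw => k' x /= e; rewrite -{k}e => -[cx hx rw]; exists x, w; split=> //.
by rewrite /free_V ps_coef0 // scale0r add0r ps_rest_id.
Qed.

Lemma word_free_W k w : reduced w -> exists (x : P k) w',
  [/\ reduced w', last_ne k w' & tensor w = free_W tensor w' x].
Proof.
case/lastP: w => [|w z] rw; first by exists (ps_xi Q), [::]; rewrite free_W_xi.
have [e|nk] := eqVneq (tag z) k; last first.
  by exists (ps_xi Q), (rcons w z); rewrite free_W_xi // last_ne_rcons.
case: z e rw => k' x /= e; rewrite -{k}e => /reduced_rconsl[rw lw cx].
exists x, w; split=> //.
by rewrite /free_W ps_coef0 // scale0r add0r ps_rest_id.
Qed.

Lemma lambda_comp k (T S U : {linear Q -> Q}) : (forall x, U x = T (S x)) ->
  forall v, lambda k U v = lambda k T (lambda k S v).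
Proof.
move=> h; apply: (@linear_tensor_ext _ _ (lambda k T \o lambda k S)) => w rw /=.
have [x [w' [rw' hw' ->]]] := word_free_V k rw.
by rewrite !lambdaP // h.
Qed.

Lemma rho_comp k (T S U : {linear Q -> Q}) : (forall x, U x = T (S x)) ->
  forall v, rho k U v = rho k T (rho k S v).
Proof.
move=> h; apply: (@linear_tensor_ext _ _ (rho k T \o rho k S)) => w rw /=.
have [x [w' [rw' hw' ->]]] := word_free_W k rw.
by rewrite !rhoP // h.
Qed.

Lemma lambda_lin k c (T S U : {linear Q -> Q}) : (forall x, U x = c *: T x + S x) ->
  forall v, lambda k U v = c *: lambda k T v + lambda k S v.
Proof.
move=> h; have := @linear_tensor_ext _ (lambda k U) ((c \*: lambda k T) \+ lambda k S).
apply=> w rw /=; have [x [w' [rw' hw' ->]]] := word_free_V k rw.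
by rewrite !lambdaP // h free_V_lin.
Qed.

Lemma rho_lin k c (T S U : {linear Q -> Q}) : (forall x, U x = c *: T x + S x) ->
  forall v, rho k U v = c *: rho k T v + rho k S v.
Proof.
move=> h; have := @linear_tensor_ext _ (rho k U) ((c \*: rho k T) \+ rho k S).
apply=> w rw /=; have [x [w' [rw' hw' ->]]] := word_free_W k rw.
by rewrite !rhoP // h free_W_lin.
Qed.

Lemma lambda_id k (T : {linear Q -> Q}) : T =1 id -> forall v, lambda k T v = v.
Proof.
move=> h; apply: (@linear_tensor_ext _ _ idfun) => w rw /=.
by have [x [w' [rw' hw' ->]]] := word_free_V k rw; rewrite lambdaP // h.
Qed.

Lemma rho_id k (T : {linear Q -> Q}) : T =1 id -> forall v, rho k T v = v.
Proof.
move=> h; apply: (@linear_tensor_ext _ _ idfun) => w rw /=.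
by have [x [w' [rw' hw' ->]]] := word_free_W k rw; rewrite rhoP // h.
Qed.

(** A right operator only touches the last factor, so the vector [x] in front is carried along: [s],
    [u1] and [u2] do not depend on it. The excluded case is the one where [x] itself is the last
    factor and has colour [k]. *)
Lemma rho_free_V j k (S : {linear Q -> Q}) w : reduced w -> head_ne j w ->
  ~~ (nilp w && (j == k)) ->
  exists s u1 u2, [/\ reduced u1 /\ head_ne j u1, reduced u2 /\ head_ne j u2 &
    forall x : P j, rho k S (free_V tensor x w) =
      s *: free_V tensor x u1 + free_V tensor x u2].
Proof.
move=> rw hw hn.
have [y [m [rm hm lm htm Hm]]] : exists (y : P k) (m : seq lett),
  [/\ reduced m, head_ne j m, last_ne k m,
      (forall x : P j, ps_circ x -> last_ne k (mk_letter x :: m)) &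
      (tensor w = free_W tensor m y /\ forall x : P j, ps_circ x ->
       tensor (mk_letter x :: w) = free_W tensor (mk_letter x :: m) y)].
  case/lastP: w rw hw hn => [|w z] rw hw /=.
    move=> jk; exists (ps_xi Q), [::]; split=> //; split; first by rewrite free_W_xi.
    by move=> x cx; rewrite free_W_xi.
  move=> _; have [e|nk] := eqVneq (tag z) k; last first.
    exists (ps_xi Q), (rcons w z); split=> //; first by rewrite last_ne_rcons.
      by move=> x _; rewrite -rcons_cons last_ne_rcons.
    split=> [|x cx]; first by rewrite free_W_xi // last_ne_rcons.
    by rewrite free_W_xi // -?rcons_cons ?last_ne_rcons.
  case: z e rw hw => k' y /= e; rewrite -{k}e => /reduced_rconsl[/= rw lw cy] hw.
  exists y, w; split=> //; first by case: (w) hw.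
    move=> x _; case/lastP: w lw hw {rw} => [_|w z lw _].
      by rewrite /last_ne /= eq_sym.
    by rewrite -rcons_cons last_ne_rcons -(@last_ne_rcons _ _ P _ w).
  split=> [|x cx].
    by rewrite /free_W ps_coef0 // scale0r add0r ps_rest_id.
  by rewrite /free_W ps_coef0 // scale0r add0r ps_rest_id.
have rs : reduced (rcons m (mk_letter (ps_rest (S y) : P k))).
  by apply: reduced_rcons => //; exact: ps_rest_circ.
exists (ps_coef (S y)), m, (rcons m (mk_letter (ps_rest (S y) : P k))); split=> //.
  split=> //; case: m rm hm lm htm Hm rs => //= _ _ _ h _ _.
  by have := h _ (ps_circ0 Q); rewrite /last_ne /= eq_sym.
move=> x; case: Hm => H1 H2; rewrite {1}/free_V linearD linearZ /= H1 H2; last exact: ps_rest_circ.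
have rxm : reduced (mk_letter (ps_rest x : P j) :: m) by split=> //; exact: ps_rest_circ.
rewrite !rhoP //; last by apply: htm; exact: ps_rest_circ.
by rewrite /free_W /free_V !scalerDr !scalerA [_ * ps_coef x]mulrC addrACA.
Qed.

(* Left and right operators act at the two ends of a word; the ends meet only on
   words of length at most one, where commutation of [T] and [S] is needed. *)
Lemma lambda_rho_comm j k (T S : {linear Q -> Q}) :
  (j = k -> forall x, T (S x) = S (T x)) ->
  forall v, lambda j T (rho k S v) = rho k S (lambda j T v).
Proof.
move=> h; apply: (@linear_tensor_ext _ (lambda j T \o rho k S) (rho k S \o lambda j T)).
move=> w rw /=; have [x [w' [rw' hw' ->]]] := word_free_V j rw.
(* On a single factor of the common colour both operators act on the same vector, and [h] gives
   commutation there; otherwise they act at different ends. *)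
have [/andP[/nilP w0 /eqP jk]|hn] := boolP (nilp w' && (j == k)).
  rewrite w0 -{k}jk in h *; rewrite lambdaP // !free_VW_nil !rhoP //.
  by rewrite -!free_VW_nil lambdaP // h.
have [s [u1 [u2 [[r1 h1] [r2 h2] H]]]] := rho_free_V S rw' hw' hn.
by rewrite H linearD linearZ /= !lambdaP // H.
Qed.


End FreeProductOperators.

(** * A pointed space on which the two sides of the algebra commute *)

Section BilinearSpace.
Local Set Implicit Arguments.
Local Unset Strict Implicit.
Import GRing.Theory.
Local Open Scope ring_scope.
Local Open Scope complex_scope.
Context {R : realType} {A : cstar_algebra R} (phi : {scalar A}).

(* The action of both sides by [F a b |-> F (a * x) b] and [F a b |-> F a (b * y)]
   on bilinear forms makes left and right operators commute exactly, whereas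
   letters in the algebra commute only in distribution. *)
Definition bilin : pred (A -> A -> R[i]^o) := fun F =>
  `[< (forall (c : R[i]) a a' b, F (c *: a + a') b = c * F a b + F a' b) /\
      (forall (c : R[i]) a b b', F a (c *: b + b') = c * F a b + F a b') >].

Lemma bilin_submod : submod_closed bilin.
Proof.
have e0 a b : (0 : A -> A -> R[i]^o) a b = 0 by [].
have eD c (F G : A -> A -> R[i]^o) a b : (c *: F + G) a b = c * F a b + G a b by [].
split=> [|c F G].
  by apply/asboolP; split=> c a a' b; rewrite !e0 mulr0 addr0.
move=> /asboolP[F1 F2] /asboolP[G1 G2]; apply/asboolP; split=> c' a a' b;
  rewrite !eD ?F1 ?F2 ?G1 ?G2; ring.
Qed.

HB.instance Definition _ := GRing.isSubmodClosed.Build _ _ bilin bilin_submod.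

Definition bilin_fun := {F : A -> A -> R[i]^o | bilin F}.
HB.instance Definition _ := [isSub of bilin_fun for @sval _ _].
HB.instance Definition _ := [Choice of bilin_fun by <:].
HB.instance Definition _ := [SubChoice_isSubLmodule of bilin_fun by <:].

Definition bf (F : bilin_fun) (a b : A) : R[i] := val F a b.

Lemma bfP (c : R[i]) (F G : bilin_fun) a b : bf (c *: F + G) a b = c * bf F a b + bf G a b.
Proof. by rewrite /bf linearP. Qed.

Lemma bf_l (F : bilin_fun) (c : R[i]) a a' b : bf F (c *: a + a') b = c * bf F a b + bf F a' b.
Proof. by have /asboolP[h _] := valP F; rewrite /bf h. Qed.

Lemma bf_r (F : bilin_fun) (c : R[i]) a b b' : bf F a (c *: b + b') = c * bf F a b + bf F a b'.
Proof. by have /asboolP[_ h] := valP F; rewrite /bf h. Qed.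

Lemma bf_ext (F G : bilin_fun) : (forall a b, bf F a b = bf G a b) -> F = G.
Proof. by move=> h; apply: val_inj; apply/funext => a; apply/funext => b; exact: h. Qed.

Lemma bl_subproof (x : A) (F : bilin_fun) : bilin (fun a b => bf F (a * x) b : R[i]^o).
Proof.
by apply/asboolP; split=> *; rewrite ?mulrDl -?scalerAl ?bf_l ?bf_r.
Qed.
Definition bl (x : A) (F : bilin_fun) : bilin_fun := exist (fun F => bilin F) _ (bl_subproof x F).

Lemma br_subproof (y : A) (F : bilin_fun) : bilin (fun a b => bf F a (b * y) : R[i]^o).
Proof.
by apply/asboolP; split=> *; rewrite ?mulrDl -?scalerAl ?bf_l ?bf_r.
Qed.
Definition br (y : A) (F : bilin_fun) : bilin_fun := exist (fun F => bilin F) _ (br_subproof y F).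

Lemma bl_linear x : linear (bl x).
Proof. by move=> c F G; apply: bf_ext => a b; rewrite bfP /= /bf /= -!/(bf _ _ _) bfP. Qed.
Lemma br_linear y : linear (br y).
Proof. by move=> c F G; apply: bf_ext => a b; rewrite bfP /= /bf /= -!/(bf _ _ _) bfP. Qed.
HB.instance Definition _ x := GRing.isLinear.Build _ _ _ _ (bl x) (bl_linear x).
HB.instance Definition _ x := GRing.isLinear.Build _ _ _ _ (br x) (br_linear x).

(** The form [phi (a * b)] is the state vector. Left letters multiply its first argument and right
    letters its second, so evaluating at (1, 1) returns [phi] of the left product times the right
    product. *)
Lemma bxi_subproof : bilin (fun a b => phi (a * b) : R[i]^o).
Proof.
by apply/asboolP; split=> *; rewrite ?mulrDl ?mulrDr -?scalerAl -?scalerAr linearP.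
Qed.
Definition bxi : bilin_fun := exist (fun F => bilin F) _ bxi_subproof.

Hypothesis phi1 : phi 1 = 1.

Definition bcirc : set bilin_fun := fun F => bf F 1 1 = 0.
Lemma bcirc0 : bcirc 0. Proof. by rewrite /bcirc /bf raddf0. Qed.
Lemma bcirc_lin (c : R[i]) x y : bcirc x -> bcirc y -> bcirc (c *: x + y).
Proof. by rewrite /bcirc bfP => -> ->; rewrite mulr0 addr0. Qed.
Lemma bxi11 : bf bxi 1 1 = 1. Proof. by rewrite /bf /= mulr1. Qed.
Lemma bdecomp x : bcirc (x - bf x 1 1 *: bxi).
Proof. by rewrite /bcirc addrC -scaleNr bfP bxi11 mulr1 addNr. Qed.
Lemma bdirect c : bcirc (c *: bxi) -> c = 0.
Proof. by rewrite /bcirc -[_ *: _]addr0 bfP bxi11 mulr1 (bcirc0 : bf 0 1 1 = 0) addr0. Qed.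

Definition bspace : @pointed_space R :=
  @PointedSpace R bilin_fun bxi bcirc (fun F => bf F 1 1) bcirc0 bcirc_lin bdecomp bdirect.

Lemma bl_hom (S : set A) : unital_hom S (fun x => bl x : {linear bspace -> bspace}).
Proof.
split=> [F|c x y _ _ F|x y _ _ F]; apply: bf_ext => a b; rewrite ?bfP /bf /= -?/(bf _ _ _).
- by rewrite mulr1.
- by rewrite mulrDr -scalerAr bf_l.
- by rewrite mulrA.
Qed.

Lemma br_hom (S : set A) : unital_hom S (fun x => br x : {linear bspace -> bspace}).
Proof.
split=> [F|c x y _ _ F|x y _ _ F]; apply: bf_ext => a b; rewrite ?bfP /bf /= -?/(bf _ _ _).
- by rewrite mulr1.
- by rewrite mulrDr -scalerAr bf_r.
- by rewrite mulrA.
Qed.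

Lemma bl_br_comm x y F : bl x (br y F) = br y (bl x F).
Proof. exact: bf_ext. Qed.

End BilinearSpace.

(** * Bi-freeness as the vanishing of centred moments *)

Section Freeness.
Local Set Implicit Arguments.
Local Unset Strict Implicit.
Import Order.TTheory GRing.Theory Num.Theory.
Import numFieldNormedType.Exports.
Local Open Scope classical_set_scope.
Local Open Scope ring_scope.
Local Open Scope complex_scope.

Section Swap.
Context {L : Type} (isr : L -> bool) {V : Type} (g : seq L -> V).
Hypothesis g_swap : forall u v x y, ~~ isr x -> isr y ->
  g (u ++ x :: y :: v) = g (u ++ y :: x :: v).

Lemma swap_right u s v y : isr y -> ~~ has isr s ->
  g (u ++ y :: s ++ v) = g (u ++ s ++ y :: v).
Proof.
move=> yr; elim: s u => //= x s IH u; rewrite negb_or => /andP[xl sl].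
by rewrite -g_swap // -cat_rcons IH // cat_rcons.
Qed.

Lemma swap_sort w : g w = g ([seq x <- w | ~~ isr x] ++ [seq x <- w | isr x]).
Proof.
rewrite -[w in LHS]cat0s -[_ ++ _ in RHS]cat0s; elim: w [::] => //= x w IH u.
rewrite -cat_rcons IH cat_rcons; case xr : (isr x) => //=.
by rewrite swap_right // has_filterN.
Qed.
End Swap.

Context {R : realType} {A : cstar_algebra R} (phi : {scalar A}).
Context {ell : nat} {n m : 'I_ell -> nat}.
Context (X : forall k, 'I_(n k) -> A) (Y : forall k, 'I_(m k) -> A).

Definition lttr : Type := (indices n + indices m)%type.
Definition lcol (z : lttr) : 'I_ell := match z with inl i => tag i | inr j => tag j end.
Definition lright (z : lttr) : bool := if z is inr _ then true else false.
Definition lvar (z : lttr) : A :=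
  match z with inl i => all_vars X i | inr j => all_vars Y j end.

(* Right letters come in the reversed order, as in the microstates. *)
Definition phimom (w : seq lttr) : R[i] := phi (\prod_(z <- lr lright w) lvar z).

Definition free_moments := forall bs, (1 < size bs)%N -> wf_blocks lcol bs ->
  valid lright (flat bs) -> cent phimom [::] bs = 0.

Lemma cent_ext {L : Type} {K : eqType} {C : numFieldType} (f g : seq L -> C)
  acc (bs : seq (K * seq L)) : f =1 g -> cent f acc bs = cent g acc bs.
Proof. by move=> fg; elim: bs acc => //= b bs IH acc; rewrite !IH fg. Qed.

Lemma alg_gen_sub (S : set A) a : S a -> alg_gen S a.
Proof. by move=> Sa B [_]; apply. Qed.

Lemma bifree_free_moments :
  bifree phi (fun k => alg_gen (range (@X k))) (fun k => alg_gen (range (@Y k))) ->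
  free_moments.
Proof.
move=> [P [V [tensor [l [r [lambda [rho [fp hom lamP rhoP words]]]]]]]].
pose t (z : lttr) k : {linear P k -> P k} :=
  if z is inl _ then l k (lvar z) else r k (lvar z).
move=> bs sbs wbs vbs.
have := @bifree_cent _ _ P V tensor fp lambda rho lamP rhoP _ lcol lright t bs.
move=> /(_ _ wbs vbs) <-; last by case: (bs) sbs.
apply: cent_ext => w; rewrite /phimom /mom.
pose f (z : lttr) := ((if z is inl _ then inl (lcol z) else inr (lcol z)), lvar z).
have -> : \prod_(z <- lr lright w) lvar z = \prod_(z <- map f (lr lright w)) z.2.
  by rewrite big_map.
rewrite words.
  congr ps_coef; elim: (lr _ _) => //= z s ->.
  by case: z => z; rewrite /theta /t /=.
move=> z /mapP[y _ ->]; case: y => [[k i]|[k i]] /=; apply: alg_gen_sub.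
  by exists i.
by exists i.
Qed.

Hypothesis phi1 : phi 1 = 1.
Hypothesis XY : tracially_bipartite phi (all_vars X) (all_vars Y).

Lemma phi_swap u v x y : ~~ lright x -> lright y ->
  phi (\prod_(z <- u ++ x :: y :: v) lvar z) = phi (\prod_(z <- u ++ y :: x :: v) lvar z).
Proof.
case: XY => _ comm _ _; case: x => // i _; case: y => // j _.
by have := comm i j u v; rewrite !big_cat !big_cons /= !mulrA.
Qed.

Lemma lr_sort {L : Type} (isr : L -> bool) (w : seq L) :
  lr isr ([seq x <- w | ~~ isr x] ++ rev [seq x <- w | isr x]) =
  [seq x <- w | ~~ isr x] ++ [seq x <- w | isr x].
Proof.
rewrite /lr !filter_cat !filter_rev -!filter_predI.
have -> : [seq x <- w | predI (fun x => ~~ isr x) (fun x => ~~ isr x) x] =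
   [seq x <- w | ~~ isr x] by apply: eq_filter => x /=; rewrite andbb.
have -> : [seq x <- w | predI isr isr x] = [seq x <- w | isr x].
  by apply: eq_filter => x /=; rewrite andbb.
have -> : [seq x <- w | predI (fun x => ~~ isr x) isr x] = [::].
  by rewrite -[RHS](filter_pred0 w); apply: eq_filter => x /=; case: isr.
have -> : [seq x <- w | predI isr (fun x => ~~ isr x) x] = [::].
  by rewrite -[RHS](filter_pred0 w); apply: eq_filter => x /=; case: isr.
by rewrite cats0 cat0s revK.
Qed.

Lemma prod_lr_sorted w : phi (\prod_(z <- w) lvar z) =
  phimom ([seq x <- w | ~~ lright x] ++ rev [seq x <- w | lright x]).
Proof.
rewrite (@swap_sort _ lright _ (fun w => phi (\prod_(z <- w) lvar z)) phi_swap).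
by rewrite /phimom lr_sort.
Qed.

Lemma valid_lr_rev (w : seq lttr) :
  valid lright ([seq x <- w | ~~ lright x] ++ rev [seq x <- w | lright x]).
Proof.
apply: valid_cat_left; first exact: has_filterN.
by apply: valid_right; rewrite all_rev; exact: filter_all.
Qed.

Section Model.
Let Q := bspace phi1.
Let P := fun _ : 'I_ell => Q.
Let V := @fprod_space R _ P.
Let tensor : seq (letter P) -> V := @ftensor R _ P.
Let fp : is_free_product tensor := @fprod_free R _ P.
Let lambda (k : 'I_ell) (T : {linear Q -> Q}) : {linear V -> V} :=
  projT1 (cid (lambda_exists fp k T)).
Let rho (k : 'I_ell) (T : {linear Q -> Q}) : {linear V -> V} :=
  projT1 (cid (rho_exists fp k T)).
Let lambdaP k T : @is_lambda R _ P V tensor k T (lambda k T).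
Proof. exact: (projT2 (cid (lambda_exists fp k T))). Qed.
Let rhoP k T : @is_rho R _ P V tensor k T (rho k T).
Proof. exact: (projT2 (cid (rho_exists fp k T))). Qed.
Let l (x : A) : {linear Q -> Q} := bl x.
Let r (x : A) : {linear Q -> Q} := br x.
Let t (z : lttr) (k : 'I_ell) : {linear Q -> Q} :=
  if z is inl _ then l (lvar z) else r (lvar z).

Lemma model_left k w F a b : ~~ has lright w ->
  bf (@act1 _ _ P _ t k w F) a b = bf F (a * \prod_(z <- w) lvar z) b.
Proof.
elim: w a b => [|z w IH] a b /=; first by rewrite big_nil mulr1.
rewrite big_cons negb_or; case: z => // z /= /IH h; rewrite mulrA; exact: h.
Qed.

Lemma model_right k w F a b : all lright w ->
  bf (@act1 _ _ P _ t k w F) a b = bf F a (b * \prod_(z <- w) lvar z).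
Proof.
elim: w a b => [|z w IH] a b /=; first by rewrite big_nil mulr1.
rewrite big_cons; case: z => // z /= /IH h; rewrite mulrA; exact: h.
Qed.

(** The free product of copies of the bilinear model has the same single-colour moments as [phi],
    and its centred products vanish by bi-freeness. Those of [phi] vanish by hypothesis, so all
    valid moments agree. *)
Lemma model_mom w : free_moments -> valid lright w ->
  @mom _ _ P V lambda rho _ lcol lright t w = phimom w.
Proof.
move=> hfree vw; pose psi (_ : unit) := @mom _ _ P V lambda rho _ lcol lright t.
have pure k u : mono lcol k u -> psi tt u = phimom u.
  move=> mu; rewrite /psi (mom_mono fp lambdaP rhoP lright t mu) /=.
  rewrite /lr /act1 foldr_cat.
  have -> := @model_left k _ (foldr (fun z => t z k) (bxi phi)
    (rev [seq x <- u | lright x])) 1 1 (has_filterN lright u).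
  rewrite (@model_right k) ?all_rev ?filter_all //.
  by rewrite !mul1r /bf /= /phimom /lr big_cat.
(* On a one-point type with the filter of the full set, convergence is equality. *)
have : cv (globally [set: unit]) (psi^~ w) (phimom w).
  apply: (@moments_cv _ _ lcol lright) => //.
  - move=> k u _ mu; rewrite (_ : psi^~ u = fun=> phimom u); first exact: cvg_cst.
    by apply/funext => -[]; exact: pure mu.
  - move=> bs sbs wbs vbs; rewrite (_ : (fun s => _) = fun=> 0); first exact: cvg_cst.
    apply/funext => s; apply: (bifree_cent fp lambdaP rhoP) => //.
    by case: (bs) sbs.
  rewrite (_ : psi^~ [::] = fun=> phimom [::]); first exact: cvg_cst.
  apply/funext => s; rewrite /psi /phimom /mom /lr /= big_nil phi1; exact: fcoef_xi.
move=> /cvP h; apply/eqP; rewrite -subr_eq0; apply/negP => /negP h0.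
have := h `|psi tt w - phimom w|; rewrite normr_gt0 => /(_ h0 tt I).
by rewrite /= ltxx.
Qed.

Let wt (u : seq lttr) (v : V) : V := @act _ _ P V lambda rho _ lcol lright t u v.

(** Both sides may be sorted into a valid word: [phi] allows adjacent exchanges in distribution,
    while in the model left and right operators commute exactly. *)
Lemma model_word u : free_moments ->
  phi (\prod_(z <- u) lvar z) = ps_coef (wt u (ps_xi V)).
Proof.
move=> hfree; rewrite prod_lr_sorted -model_mom ?valid_lr_rev //.
rewrite /mom lr_sort.
rewrite -(@swap_sort _ lright _ (fun w => ps_coef (wt w (ps_xi V)))) //.
move=> s s' x y xl yr; congr ps_coef.
rewrite /wt !act_cat; congr act => /=.
rewrite /theta yr (negbTE xl); apply: (lambda_rho_comm fp lambdaP rhoP) => _ F.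
case: x xl => // i _; case: y yr => // j _; exact: bl_br_comm.
Qed.

(* [op true k a] is rho_k(r(a)) and [op false k a] is lambda_k(l(a)). *)
Let op (side : bool) (k : 'I_ell) (a : A) : {linear V -> V} :=
  if side then rho k (r a) else lambda k (l a).

(** Bi-freeness concerns words in the generated algebras, not in the variables alone. An element and
    a vector are related when all products of variables in front of them have equal expectations;
    this is linear in the pair, so the elements whose operators preserve the relation form a unital
    subalgebra. *)
Let rel (c : A) (v : V) : Prop :=
  forall u : seq lttr, phi (\prod_(z <- u) lvar z * c) = ps_coef (wt u v).

Let good side k (a : A) : Prop := forall c v, rel c v -> rel (a * c) (op side k a v).

Lemma wt_lin u c v v' : wt u (c *: v + v') = c *: wt u v + wt u v'.
Proof. exact: act_lin. Qed.

Lemma good_subalgebra side k : unital_subalgebra (good side k : set A).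
Proof.
split=> [c v h|c x y gx gy a v h u|x y gx gy a v h u].
- have -> : op side k 1 v = v.
    have [h1 _ _] := bl_hom phi1 setT; have [h2 _ _] := br_hom phi1 setT.
    by rewrite /op; case: side; [apply: (rho_id fp rhoP)|apply: (lambda_id fp lambdaP)].
  by rewrite mul1r.
- have -> : op side k (c *: x + y) v = c *: op side k x v + op side k y v.
    have [_ h1 _] := bl_hom phi1 setT; have [_ h2 _] := br_hom phi1 setT.
    rewrite /op; case: side {gx gy}.
      by apply: (rho_lin fp rhoP) => F; apply: h2.
    by apply: (lambda_lin fp lambdaP) => F; apply: h1.
  rewrite wt_lin ps_coef_lin -(gx _ _ h) -(gy _ _ h).
  by rewrite mulrDl mulrDr -scalerAl -scalerAr linearP.
have -> : op side k (x * y) v = op side k x (op side k y v).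
  have [_ _ h1] := bl_hom phi1 setT; have [_ _ h2] := br_hom phi1 setT.
  rewrite /op; case: side {gx gy}.
    by apply: (rho_comp fp rhoP) => F; apply: h2.
  by apply: (lambda_comp fp lambdaP) => F; apply: h1.
rewrite -mulrA; exact: gx (gy _ _ h) u.
Qed.

Lemma good_letter z : good (lright z) (lcol z) (lvar z).
Proof.
move=> c v h u; have := h (rcons u z).
rewrite -cats1 big_cat big_seq1 -mulrA => ->.
by rewrite /wt act_cat; case: z.
Qed.

Lemma free_moments_bifree : free_moments ->
  bifree phi (fun k => alg_gen (range (@X k))) (fun k => alg_gen (range (@Y k))).
Proof.
move=> hfree.
exists P, V, tensor, (fun _ => l), (fun _ => r), lambda, rho; split=> //.
  by move=> k; split; [exact: bl_hom | exact: br_hom].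
move=> w hw.
suff h : rel (\prod_(z <- w) z.2) (foldr (fun z v => match z.1 with
     | inl k => lambda k (l z.2) v | inr k => rho k (r z.2) v end) (ps_xi V) w).
  by have := h [::]; rewrite big_nil mul1r.
elim: w hw => [|z w IH] hw /=.
  by move=> u; rewrite big_nil mulr1 model_word.
rewrite big_cons; have {}IH := IH (fun y yw => hw y (@mem_behead _ (z :: w) y yw)).
have := hw z (mem_head _ _); case: z {hw} => -[k|k] a /= ha.
  suff g : good false k a by exact: g _ _ IH.
  apply: ha; split; first exact: good_subalgebra.
  by move=> _ [i _ <-]; exact: (good_letter (inl (Tagged (fun k => 'I_(n k)) i))).
suff g : good true k a by exact: g _ _ IH.
apply: ha; split; first exact: good_subalgebra.
by move=> _ [i _ <-]; exact: (good_letter (inr (Tagged (fun k => 'I_(m k)) i))).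
Qed.
End Model.
End Freeness.
(** * Matrix norms, truncation and direct sums *)

Section MatrixBounds.
Local Set Implicit Arguments.
Local Unset Strict Implicit.
Import Order.TTheory GRing.Theory Num.Theory.
Local Open Scope ring_scope.
Local Open Scope complex_scope.
Local Open Scope sesquilinear_scope.
Context {R : realType}.
Local Notation C := R[i].

Lemma realcM (x y : R) : (x * y)%:C = x%:C * y%:C. Proof. exact: (rmorphM (real_complex R)). Qed.
Lemma realcD (x y : R) : (x + y)%:C = x%:C + y%:C. Proof. exact: (rmorphD (real_complex R)). Qed.
Lemma realcV (x : R) : (x^-1)%:C = x%:C^-1. Proof. exact: (fmorphV (real_complex R)). Qed.
Lemma realc_nat n : (n%:R : R)%:C = n%:R. Proof. exact: (rmorph_nat (real_complex R)). Qed.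
Lemma realcX (x : R) n : (x ^+ n)%:C = x%:C ^+ n. Proof. exact: (rmorphXn (real_complex R)). Qed.
Lemma realc_sum (I : Type) (r : seq I) (P : pred I) (F : I -> R) :
  (\sum_(i <- r | P i) F i)%:C = \sum_(i <- r | P i) (F i)%:C.
Proof. exact: (rmorph_sum (real_complex R)). Qed.

(* The norm of the libraries on [R[i]] takes its values in [R[i]]. *)
Definition cabs (z : C) : R := Num.sqrt (complex.Re z ^+ 2 + complex.Im z ^+ 2).

Lemma cabsE (z : C) : `|z| = (cabs z)%:C.
Proof. exact: normc_def. Qed.

Lemma cabs_ge0 z : 0 <= cabs z. Proof. exact: sqrtr_ge0. Qed.
#[local] Hint Resolve cabs_ge0 : core.

Lemma cabsM x y : cabs (x * y) = cabs x * cabs y.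
Proof. by apply: complexI; rewrite realcM -!cabsE normrM. Qed.

Lemma cabsD x y : cabs (x + y) <= cabs x + cabs y.
Proof. by rewrite -lecR realcD -!cabsE ler_normD. Qed.

Lemma cabsN x : cabs (- x) = cabs x.
Proof. by apply: complexI; rewrite -!cabsE normrN. Qed.

Lemma cabsB x y : cabs (x - y) <= cabs x + cabs y.
Proof. by rewrite -(cabsN y) cabsD. Qed.

Lemma cabs_distC x y : cabs (x - y) = cabs (y - x).
Proof. by rewrite -opprB cabsN. Qed.

Lemma cabs0 : cabs 0 = 0.
Proof. by rewrite /cabs /= expr0n /= addr0 sqrtr0. Qed.

Lemma cabs1 : cabs 1 = 1.
Proof. by apply: complexI; rewrite -cabsE normr1. Qed.

Lemma cabs_conj (z : C) : cabs (z^*)%C = cabs z.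
Proof. by apply: complexI; rewrite -!cabsE normcJ. Qed.

Lemma cabsX x n : cabs (x ^+ n) = cabs x ^+ n.
Proof. by elim: n => [|n IH]; rewrite ?expr0 ?cabs1 // !exprS cabsM IH. Qed.

Lemma cabs_real (x : R) : cabs x%:C = `|x|.
Proof. by rewrite /cabs /= expr0n addr0 sqrtr_sqr. Qed.

Lemma cabs_sum (I : Type) (r : seq I) (P : pred I) (F : I -> C) :
  cabs (\sum_(i <- r | P i) F i) <= \sum_(i <- r | P i) cabs (F i).
Proof.
elim/big_rec2: _ => [|i y z _ h]; first by rewrite cabs0.
by apply: le_trans (cabsD _ _) _; rewrite lerD2l.
Qed.

Lemma cabs_eq0 x : cabs x = 0 -> x = 0.
Proof. by move=> h; apply/eqP; rewrite -normr_eq0 cabsE h. Qed.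

Lemma cabs_inv x : cabs x^-1 = (cabs x)^-1.
Proof. by apply: complexI; rewrite realcV -!cabsE normfV. Qed.

Lemma cabs_nat n : cabs n%:R = n%:R.
Proof. by apply: complexI; rewrite -cabsE normr_nat realc_nat. Qed.

Lemma cabs_sq z : cabs z ^+ 2 = complex.Re z ^+ 2 + complex.Im z ^+ 2.
Proof. by rewrite sqr_sqrtr // addr_ge0 ?sqr_ge0 //. Qed.

Lemma cabs_sqE (z : C) : z * (z^*)%C = (cabs z ^+ 2)%:C.
Proof. by rewrite -sqr_normc cabsE realcX. Qed.

Lemma Re_le_cabs z : `|complex.Re z| <= cabs z.
Proof. by rewrite -lecR -cabsE; exact: normc_ge_Re. Qed.

Lemma Im_le_cabs z : `|complex.Im z| <= cabs z.
Proof.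
rewrite -sqrtr_sqr ler_wsqrtr // lerDr; exact: sqr_ge0.
Qed.

Section Fixed.
Context {d : nat}.
Implicit Types (M N U : 'M[C]_d) (v : 'cV[C]_d).

Definition l2sq v : R := \sum_i cabs (v i 0) ^+ 2.

Lemma l2sq_ge0 v : 0 <= l2sq v.
Proof. by apply: sumr_ge0 => i _; exact: sqr_ge0. Qed.
#[local] Hint Resolve l2sq_ge0 : core.

Lemma l2normE v : l2norm v = Num.sqrt (l2sq v).
Proof. by rewrite /l2norm; congr Num.sqrt; apply: eq_bigr => i _; rewrite cabs_sq. Qed.

Lemma l2sqZ (c : C) v : l2sq (c *: v) = cabs c ^+ 2 * l2sq v.
Proof. by rewrite /l2sq mulr_sumr; apply: eq_bigr => i _; rewrite mxE cabsM exprMn. Qed.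

Lemma l2sqD u v : l2sq (u + v) <= 2 * l2sq u + 2 * l2sq v.
Proof.
rewrite /l2sq !mulr_sumr -big_split; apply: ler_sum => i _ /=; rewrite mxE.
apply: le_trans (_ : (cabs (u i 0) + cabs (v i 0)) ^+ 2 <= _).
  by rewrite lerXn2r ?nnegrE ?addr_ge0 // cabsD.
have := sqr_ge0 (cabs (u i 0) - cabs (v i 0)).
rewrite !expr2; nra.
Qed.

Lemma l2sqE v : (v^t* *m v) 0 0 = (l2sq v)%:C.
Proof.
rewrite mxE /l2sq realc_sum; apply: eq_bigr => i _.
by rewrite !mxE mulrC cabs_sqE.
Qed.

(** The operator norm bound without a supremum and without square roots. Only [K ^+ 2] enters, hence
    the separate hypotheses [0 <= K] later. *)
Definition bdd (K : R) M := forall v, l2sq (M *m v) <= K ^+ 2 * l2sq v.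

Lemma bdd_le K L M : 0 <= K -> K <= L -> bdd K M -> bdd L M.
Proof.
move=> K0 KL h v; apply: le_trans (h v) _; rewrite ler_wpM2r //.
by rewrite lerXn2r ?nnegrE // (le_trans K0).
Qed.

Lemma bddM K L M N : bdd K M -> bdd L N -> bdd (K * L) (M *m N).
Proof.
move=> hM hN v; rewrite -mulmxA; apply: le_trans (hM _) _.
by rewrite exprMn -[leRHS]mulrA ler_wpM2l ?sqr_ge0 ?hN.
Qed.

(** The factor 2 comes from bounding the squared norm of a sum by twice the sum of squares instead
    of by the triangle inequality; constants are immaterial. *)
Lemma bddD K L M N : 0 <= K -> 0 <= L -> bdd K M -> bdd L N -> bdd (2 * (K + L)) (M + N).
Proof.
move=> K0 L0 hM hN v; rewrite mulmxDl; apply: le_trans (l2sqD _ _) _.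
have h1 := hM v; have h2 := hN v; have := l2sq_ge0 v.
move: (l2sq v) (l2sq (M *m v)) (l2sq (N *m v)) h1 h2 => x y z h1 h2 x0.
apply: le_trans (_ : 2 * (K ^+ 2 * x) + 2 * (L ^+ 2 * x) <= _); first by lra.
rewrite !mulrA -mulrDl ler_wpM2r // exprMn sqrrD; nra.
Qed.

Lemma bddZ K (c : C) M : bdd K M -> bdd (cabs c * K) (c *: M).
Proof.
by move=> h v; rewrite -scalemxAl l2sqZ exprMn -[leRHS]mulrA ler_wpM2l ?sqr_ge0 ?h.
Qed.

Lemma bddN K M : bdd K M -> bdd K (- M).
Proof. by move=> h; rewrite -scaleN1r -[K]mul1r -cabs1 -(cabsN 1); exact: bddZ. Qed.

Lemma bdd1 : bdd 1 1%:M.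
Proof. by move=> v; rewrite mul1mx expr1n mul1r. Qed.

Lemma l2sq0 : l2sq 0 = 0.
Proof. by rewrite /l2sq big1 // => i _; rewrite mxE cabs0 expr0n. Qed.

Lemma bdd0 K : bdd K 0.
Proof. by move=> v; rewrite mul0mx l2sq0 mulr_ge0 ?sqr_ge0. Qed.

Lemma bdd_col K M j : bdd K M -> \sum_i cabs (M i j) ^+ 2 <= K ^+ 2.
Proof.
move=> /(_ (delta_mx j 0)); rewrite -colE => h.
have -> : \sum_i cabs (M i j) ^+ 2 = l2sq (col j M).
  by apply: eq_bigr => i _; rewrite mxE.
apply: le_trans h _; rewrite /l2sq (bigD1 j) //= big1 => [|i ij].
  by rewrite mxE !eqxx cabs1 expr1n addr0 mulr1.
by rewrite mxE (negbTE ij) cabs0 expr0n.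
Qed.

Lemma bdd_entry K M i j : 0 <= K -> bdd K M -> cabs (M i j) <= K.
Proof.
move=> K0 /(@bdd_col _ _ j) h; rewrite -(@ler_pXn2r _ 2) ?nnegrE //.
by apply: le_trans h; rewrite (bigD1 i) //= lerDl sumr_ge0 // => k _; exact: sqr_ge0.
Qed.

Lemma cabs_ntr K (M : 'M[C]_d) : 0 <= K -> (forall i, cabs (M i i) <= K) -> cabs (ntr M) <= K.
Proof.
move=> K0 h; rewrite /ntr cabsM cabs_inv cabs_nat.
(* In dimension 0 the inverse of 0 is 0, so the normalized trace is 0. *)
have [d0|d0] := posnP d; first by have e : (d%:R : R) = 0 by [rewrite d0]; rewrite e invr0 mulr0.
rewrite ler_pdivrMr ?ltr0n //; apply: le_trans (cabs_sum _ _ _) _.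
apply: le_trans (ler_sum _ (fun i _ => h i)) _.
by rewrite sumr_const card_ord mulr_natr.
Qed.

Lemma bdd_ntr K M : 0 <= K -> bdd K M -> cabs (ntr M) <= K.
Proof. by move=> K0 h; apply: cabs_ntr => // i; exact: bdd_entry. Qed.

(* A bound with the adjoint that avoids the Cauchy-Schwarz inequality. *)
Lemma bdd_ntr_adj K L M N : bdd K M -> bdd L N ->
  cabs (ntr (M *m N^t*)) <= K ^+ 2 + L ^+ 2.
Proof.
move=> hM hN; have KL0 : 0 <= K ^+ 2 + L ^+ 2 by rewrite addr_ge0 ?sqr_ge0 //.
rewrite /ntr cabsM cabs_inv cabs_nat.
have [d0|d0] := posnP d; first by have e : (d%:R : R) = 0 by [rewrite d0]; rewrite e invr0 mulr0.
rewrite ler_pdivrMr ?ltr0n // /mxtrace.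
apply: le_trans (cabs_sum _ _ _) _.
apply: le_trans (_ : \sum_i \sum_j (cabs (M i j) ^+ 2 + cabs (N i j) ^+ 2) <= _).
  apply: ler_sum => i _; rewrite mxE; apply: le_trans (cabs_sum _ _ _) _.
  apply: ler_sum => j _; rewrite !mxE cabsM -[Num.conj _]/(_^*)%C cabs_conj.
  have := sqr_ge0 (cabs (M i j) - cabs (N i j)).
  have := cabs_ge0 (M i j); have := cabs_ge0 (N i j); rewrite !expr2; nra.
rewrite exchange_big /=.
apply: le_trans (_ : \sum_(j < d) (K ^+ 2 + L ^+ 2) <= _).
  by apply: ler_sum => j _; rewrite big_split /= lerD // bdd_col.
by rewrite sumr_const card_ord mulr_natr.
Qed.

Lemma unitarymx_mul1 U : U \is unitarymx -> U^t* *m U = 1%:M.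
Proof. by rewrite -trmxC_unitary => /unitarymxP; rewrite trmxCK. Qed.

Lemma l2sq_unitary U v : U \is unitarymx -> l2sq (U *m v) = l2sq v.
Proof.
move=> hU; apply: complexI; rewrite -!l2sqE trmx_mul map_mxM mulmxA.
by rewrite -[_ *m U]mulmxA -/(U^t*) unitarymx_mul1 // mulmx1.
Qed.

Lemma bdd_unitary U : U \is unitarymx -> bdd 1 U.
Proof. by move=> hU v; rewrite l2sq_unitary // expr1n mul1r. Qed.

Lemma bdd_conj K U M : U \is unitarymx -> bdd K M -> bdd K (U^t* *m M *m U).
Proof.
move=> hU hM; rewrite -[K]mulr1 -[K]mul1r; apply: bddM; last exact: bdd_unitary.
by apply: bddM => //; apply: bdd_unitary; rewrite trmxC_unitary.
Qed.

Lemma l2sq_eq0 v : l2sq v = 0 -> v = 0.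
Proof.
move=> /eqP; rewrite psumr_eq0 => [/allP h|i _]; last exact: sqr_ge0.
apply/matrixP => i j; rewrite ord1 mxE; apply: cabs_eq0.
by have := h i (mem_index_enum i); rewrite /= expf_eq0 => /eqP.
Qed.

Lemma has_sup_opnorm M : has_sup [set l2norm (M *m v) | v in [set v | l2norm v <= 1]]%classic.
Proof.
split.
  exists (l2norm (M *m 0)); exists 0 => //=.
  by rewrite l2normE l2sq0 sqrtr0.
exists (Num.sqrt (\sum_i (\sum_j cabs (M i j)) ^+ 2)) => _ [v /= hv <-].
rewrite l2normE ler_wsqrtr //; apply: ler_sum => i _.
rewrite lerXn2r ?nnegrE ?sumr_ge0 // mxE; apply: le_trans (cabs_sum _ _ _) _.
apply: ler_sum => j _; rewrite cabsM -[leRHS]mulr1 ler_wpM2l //.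
apply: le_trans hv; rewrite l2normE -[cabs _]ger0_norm // -sqrtr_sqr ler_wsqrtr //.
by rewrite /l2sq (bigD1 j) //= lerDl sumr_ge0 // => k _; exact: sqr_ge0.
Qed.

Lemma opnorm_bdd K M : 0 <= K -> (opnorm M <= K <-> bdd K M).
Proof.
move=> K0; split=> [h v|h].
  have [v0|v0] := eqVneq (l2sq v) 0.
    by rewrite v0 (l2sq_eq0 v0) mulmx0 mulr0 -v0 (l2sq_eq0 v0).
  have vp : 0 < l2sq v by rewrite lt_neqAle eq_sym v0 l2sq_ge0.
  pose c := (Num.sqrt (l2sq v))^-1.
  have c0 : 0 <= c by rewrite invr_ge0 sqrtr_ge0.
  have c2 : c ^+ 2 * l2sq v = 1 by rewrite exprVn sqr_sqrtr // mulVf.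
  have cabsc : cabs c%:C ^+ 2 = c ^+ 2 by rewrite cabs_real ger0_norm.
  have : l2norm (M *m (c%:C *: v)) <= K.
    apply: le_trans h; apply: sup_upper_bound; first exact: has_sup_opnorm.
    by exists (c%:C *: v) => //=; rewrite l2normE l2sqZ cabsc c2 sqrtr1.
  rewrite -scalemxAr l2normE l2sqZ cabsc => hK.
  have : c ^+ 2 * l2sq (M *m v) <= K ^+ 2.
    rewrite -[leLHS]sqr_sqrtr ?mulr_ge0 ?sqr_ge0 //.
    by rewrite lerXn2r ?nnegrE ?sqrtr_ge0.
  move=> /(ler_wpM2r (l2sq_ge0 v)); rewrite mulrAC c2 mul1r; exact.
apply: sup_le_ub; first by case: (has_sup_opnorm M).
move=> _ [v /= hv <-]; rewrite l2normE -[K]ger0_norm // -sqrtr_sqr ler_wsqrtr //.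
apply: le_trans (h v) _; rewrite -[leRHS]mulr1 ler_wpM2l ?sqr_ge0 //.
rewrite -[leLHS]sqr_sqrtr // -l2normE -(expr1n _ 2) lerXn2r ?nnegrE //.
by rewrite l2normE sqrtr_ge0.
Qed.

Lemma bdd_diag K (r : 'rV[C]_d) : (forall i, cabs (r 0 i) <= K) -> bdd K (diag_mx r).
Proof.
move=> h v; rewrite /l2sq mulr_sumr; apply: ler_sum => i _.
rewrite mul_diag_mx mxE cabsM exprMn ler_wpM2r ?sqr_ge0 //.
by rewrite lerXn2r ?nnegrE // (le_trans (cabs_ge0 _) (h i)).
Qed.

Lemma ntr_mulC M N : ntr (M *m N) = ntr (N *m M).
Proof. by rewrite /ntr mxtrace_mulC. Qed.

Lemma ntrD M N : ntr (M + N) = ntr M + ntr N.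
Proof. by rewrite /ntr mxtraceD mulrDl. Qed.

Lemma ntrZ c M : ntr (c *: M) = c * ntr M.
Proof. by rewrite /ntr mxtraceZ mulrA. Qed.

Lemma ntrB M N : ntr (M - N) = ntr M - ntr N.
Proof. by rewrite -scaleN1r ntrD ntrZ mulN1r. Qed.

Lemma ntr_conj U M : U \is unitarymx -> ntr (U^t* *m M *m U) = ntr M.
Proof. by move=> hU; rewrite ntr_mulC mulmxA (unitarymxP hU) mul1mx. Qed.

Lemma hermP M : reflect (M^t* = M) (M \is hermsymmx).
Proof.
by apply: (iffP (is_hermitianmxP _ _ _)); rewrite expr0 scale1r => e; exact: esym e.
Qed.
End Fixed.

End MatrixBounds.

(** * Clipping of spectra and direct sums of copies *)

Section Truncation.
Local Set Implicit Arguments.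
Local Unset Strict Implicit.
Import Order.TTheory GRing.Theory Num.Theory.
Local Open Scope ring_scope.
Local Open Scope complex_scope.
Local Open Scope sesquilinear_scope.
Context {R : realType}.
Local Notation C := R[i].
#[local] Hint Resolve cabs_ge0 : core.

Section Fixed.
Context {d : nat}.
Implicit Types (a b M U P : 'M[C]_d).

(** The error is tested in the trace against arbitrary bounded [P], so that it can be used inside
    words. It is governed by even moments of [a], with a single [b] for all [m] and no dependence on
    dimension. *)
Definition trunc_close (r : R) a b : Prop :=
  [/\ b \is hermsymmx, bdd r b &
   forall m L P, (0 < m)%N -> 0 <= L -> bdd L P ->
     cabs (ntr (P *m (a - b))) <= L * (r / r ^+ (2 * m) * complex.Re (ntr (a ^+ (2 * m))))].

Lemma expr_conj U M n : U \is unitarymx ->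
  (U^t* *m M *m U) ^+ n = U^t* *m (M ^+ n) *m U.
Proof.
move=> hU; elim: n => [|n IH].
  by rewrite !expr0 -[1]/1%:M mulmx1 unitarymx_mul1.
rewrite !exprS IH -!mulmxE !mulmxA; congr (_ *m _ *m _).
by rewrite -mulmxA (unitarymxP hU) mulmx1.
Qed.

Lemma diag_expr (r : 'rV[C]_d) n : (diag_mx r) ^+ n = diag_mx (\row_j (r 0 j) ^+ n).
Proof.
elim: n => [|n IH].
  rewrite expr0 -[1]/1%:M -diag_const_mx; congr diag_mx.
  by apply/rowP => j; rewrite !mxE.
rewrite exprS IH -mulmxE mulmx_diag; congr diag_mx.
by apply/rowP => j; rewrite !mxE exprS.
Qed.

Definition clip (r x : R) : R := Num.max (- r) (Num.min r x).

Lemma clip_le r x : 0 <= r -> `|clip r x| <= r.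
Proof.
move=> r0; rewrite /clip ler_norml le_max lexx /= ge_max ge_min lexx /= andbT.
by rewrite (le_trans _ r0) // oppr_le0.
Qed.

(** There is no error for |x| <= r. Beyond it the error is at most |x| = r (|x| / r), and raising
    the ratio, which is at least 1, to the power 2m only increases it. *)
Lemma clip_dist r x m : 0 < r -> (0 < m)%N ->
  `|x - clip r x| <= r / r ^+ (2 * m) * x ^+ (2 * m).
Proof.
move=> r0 m0; have hx : 0 <= x ^+ (2 * m) by rewrite exprM exprn_ge0 // sqr_ge0.
have rm : 0 < r ^+ (2 * m) by rewrite exprn_gt0.
have rhs0 : 0 <= r / r ^+ (2 * m) * x ^+ (2 * m).
  by rewrite mulr_ge0 // divr_ge0 // ltW.
have [xr|xr] := leP `|x| r.
  suff -> : clip r x = x by rewrite subrr normr0.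
  move: xr; rewrite ler_norml => /andP[h1 h2].
  by rewrite /clip (min_idPr h2) (max_idPr h1).
apply: le_trans (_ : `|x| <= _).
  rewrite /clip; case: (leP 0 x) => x0.
    rewrite ger0_norm // in xr *; rewrite (min_idPl (ltW xr)) (max_idPr _) ?ger0_norm; lra.
  rewrite (ltr0_norm x0) in xr *; rewrite (min_idPr _) ?(max_idPl _); last by lra.
    by rewrite opprK ltr0_norm; lra.
  by lra.
have -> : x ^+ (2 * m) = `|x| ^+ (2 * m) by rewrite !exprM real_normK ?num_real.
rewrite -mulrA [_^-1 * _]mulrC -expr_div_n -[leLHS]mulr1.
have h1 : 1 <= `|x| / r by rewrite ler_pdivlMr // mul1r ltW.
apply: le_trans (_ : r * (`|x| / r) <= _).
  by rewrite mulr1 mulrCA divff ?mulr1 // gt_eqF.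
apply: ler_wpM2l; first exact: ltW.
by rewrite -[leLHS]expr1 ler_weXn2l // muln_gt0.
Qed.

Lemma bdd_conjV L U P : U \is unitarymx -> bdd L P -> bdd L (U *m P *m U^t*).
Proof.
move=> hU hP; rewrite -[L]mulr1 -[L]mul1r; apply: bddM.
  by apply: bddM => //; exact: bdd_unitary.
by apply: bdd_unitary; rewrite trmxC_unitary.
Qed.

Lemma exists_trunc r a : 0 < r -> a \is hermsymmx -> exists b, trunc_close r a b.
Proof.
move=> r0 ha; have /hermitian_normalmx /orthomx_spectralP aE := ha.
have /mxOverP realsp := hermitian_spectral_diag_real ha.
have hU := spectral_unitarymx a; rewrite invmx_unitary // in aE.
set U := spectralmx a in aE hU; set sp := spectral_diag a in aE realsp.
pose x i := complex.Re (sp 0 i).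
have spE i : sp 0 i = (x i)%:C by rewrite /x RRe_real // realsp.
pose D' : 'rV[C]_d := \row_i (clip r (x i))%:C.
exists (U^t* *m diag_mx D' *m U); split.
- apply: herm_conj; apply/hermP; rewrite tr_diag_mx map_diag_mx; congr diag_mx.
  by apply/rowP => i; rewrite !mxE; exact: conjc_real.
- apply: bdd_conj => //; apply: bdd_diag => i; rewrite mxE cabs_real.
  by apply: clip_le; exact: ltW.
move=> m L P m0 L0 hP.
have -> : ntr (P *m (a - U^t* *m diag_mx D' *m U)) =
    ntr ((U *m P *m U^t*) *m diag_mx (sp - D')).
  by rewrite [in LHS]aE -mulmxBl -mulmxBr -raddfB /= mulmxA ntr_mulC !mulmxA.
have -> : ntr (a ^+ (2 * m)) = (d%:R^-1 * \sum_i x i ^+ (2 * m))%:C.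
  rewrite aE expr_conj // ntr_conj // diag_expr /ntr mxtrace_diag mulrC realcM realcV realc_nat.
  congr (_ * _); rewrite realc_sum; apply: eq_bigr => i _.
  by rewrite mxE spE realcX.
have hQ : bdd L (U *m P *m U^t*).
  exact: bdd_conjV.
move: (U *m P *m U^t*) hQ => Q hQ; rewrite /ntr cabsM cabs_inv cabs_nat mulrC.
rewrite [leRHS](_ : _ = d%:R^-1 * (L * (r / r ^+ (2 * m) * \sum_i x i ^+ (2 * m)))); last first.
  by rewrite [complex.Re _]/= !(mulrCA _ d%:R^-1).
apply: ler_wpM2l; first by rewrite invr_ge0.
apply: le_trans (cabs_sum _ _ _) _; rewrite !mulr_sumr; apply: ler_sum => i _.
rewrite mul_mx_diag mxE cabsM !mxE spE.
have -> : (x i)%:C - (clip r (x i))%:C = (x i - clip r (x i))%:C.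
  by rewrite -[RHS]/(real_complex R _) rmorphB.
rewrite cabs_real ler_pM ?cabs_ge0 ?clip_dist //; exact: bdd_entry.
Qed.

(** The rotation is moved onto the test matrix by cyclicity. So truncating fixed matrices truncates
    all their rotations at once, without changing the set of rotations. *)
Lemma trunc_close_conj r a b U : U \is unitarymx -> trunc_close r a b ->
  trunc_close r (U^t* *m a *m U) (U^t* *m b *m U).
Proof.
move=> hU [hb bb H]; split; [exact: herm_conj | exact: bdd_conj |].
move=> m L P m0 L0 hP; rewrite expr_conj // ntr_conj // -mulmxBl -mulmxBr.
rewrite mulmxA ntr_mulC !mulmxA; apply: H => //.
exact: bdd_conjV.
Qed.

Lemma bdd_prod (Z : Type) (f : Z -> 'M[C]_d) K (w : seq Z) :
  (forall z, bdd K (f z)) -> bdd (K ^+ size w) (\prod_(z <- w) f z).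
Proof.
move=> h; elim: w => [|z w IH]; first by rewrite big_nil expr0; exact: bdd1.
by rewrite big_cons /= exprS; apply: bddM.
Qed.

(** Letters are exchanged one at a time; cyclicity of the trace brings the exchanged letter to the
    end, against a bounded test matrix. *)
Lemma word_dist (Z : Type) (f g : Z -> 'M[C]_d) K (delta : R) : 1 <= K -> 0 <= delta ->
  (forall z, bdd K (f z)) -> (forall z, bdd K (g z)) ->
  (forall z L P, 0 <= L -> bdd L P -> cabs (ntr (P *m (f z - g z))) <= L * delta) ->
  forall w L P, 0 <= L -> bdd L P ->
  cabs (ntr (P *m \prod_(z <- w) f z) - ntr (P *m \prod_(z <- w) g z)) <=
    (size w)%:R * (L * K ^+ size w * delta).
Proof.
move=> K1 d0 hf hg hfg; have K0 : 0 <= K by exact: le_trans K1.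
elim=> [|z w IH] L P L0 hP; first by rewrite !big_nil subrr cabs0 mul0r.
rewrite !big_cons /= -!mulmxE.
have -> : ntr (P *m (f z *m \prod_(j <- w) f j)) - ntr (P *m (g z *m \prod_(j <- w) g j)) =
  ntr ((\prod_(j <- w) f j *m P) *m (f z - g z)) +
  (ntr ((P *m g z) *m \prod_(j <- w) f j) - ntr ((P *m g z) *m \prod_(j <- w) g j)).
  have e h : ntr (\prod_(j <- w) f j *m P *m h) = ntr (P *m (h *m \prod_(j <- w) f j)).
    by rewrite -mulmxA ntr_mulC mulmxA.
  by rewrite mulmxBr ntrB !e -!mulmxA addrA subrK.
apply: le_trans (cabsD _ _) _; rewrite -addn1 natrD mulrDl addrC mul1r; apply: lerD.
  apply: le_trans (IH (L * K) _ _ _) _; first by rewrite mulr_ge0.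
    exact: bddM.
  by rewrite addn1 exprS !mulrA.
apply: le_trans (hfg _ (K ^+ size w * L) _ _ _) _; first by rewrite mulr_ge0 ?exprn_ge0.
  by apply: bddM => //; exact: bdd_prod.
rewrite ler_wpM2r // mulrC ler_wpM2l // ler_weXn2l // addn1 //.
Qed.
End Fixed.

Section DirectSum.
Context {Z : Type} {d0 : nat} (a : Z -> 'M[C]_d0) (K : R).
Hypothesis K0 : 0 <= K.
Hypothesis ha : forall z, a z \is hermsymmx.
Hypothesis ba : forall z, bdd K (a z).

(** Traces are not normalized, so that a zero block of any size can be added as padding. It
    contributes nothing to nonempty words, and the empty word is excluded because its trace counts
    the padding. *)
Definition copies q D (b : Z -> 'M[C]_D) : Prop :=
  [/\ forall z, b z \is hermsymmx, forall z, bdd K (b z) &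
      forall w, ~~ nilp w -> \tr (\prod_(z <- w) b z) = q%:R * \tr (\prod_(z <- w) a z)].

Lemma copies0 D : @copies 0 D (fun=> 0).
Proof.
split=> [z|z|w]; [exact: herm0 | exact: bdd0 |].
by case: w => // z w _; rewrite big_cons mul0r linear0 mul0r.
Qed.

Lemma copies1 : copies 1 a.
Proof. by split=> // w _; rewrite mul1r. Qed.

Lemma l2sq_col m n (u : 'cV[C]_m) (v : 'cV[C]_n) : l2sq (col_mx u v) = l2sq u + l2sq v.
Proof.
rewrite /l2sq big_split_ord; congr (_ + _); apply: eq_bigr => i _.
  by rewrite col_mxEu.
by rewrite col_mxEd.
Qed.

Lemma copiesD q D (b : Z -> 'M[C]_D) q' D' (b' : Z -> 'M[C]_D') :
  copies q b -> copies q' b' ->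
  copies (q + q') (fun z => block_mx (b z) 0 0 (b' z)).
Proof.
move=> [hb bb tb] [hb' bb' tb']; split=> [z|z v|w w0].
- apply/hermP; rewrite tr_block_mx map_block_mx !trmx0 !map_mx0.
  by rewrite (hermP _ (hb z)) (hermP _ (hb' z)).
- rewrite -[v]vsubmxK mul_block_col !mul0mx addr0 add0r !l2sq_col mulrDr.
  by apply: lerD; [exact: bb | exact: bb'].
have -> : \prod_(z <- w) block_mx (b z) 0 0 (b' z) =
    block_mx (\prod_(z <- w) b z) 0 0 (\prod_(z <- w) b' z).
  elim: w {w0} => [|z w IH]; first by rewrite !big_nil -scalar_mx_block.
  by rewrite !big_cons IH -!mulmxE mulmx_block !mulmx0 !mul0mx !addr0 add0r.
by rewrite mxtrace_block tb // tb' // natrD mulrDl.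
Qed.

Lemma exists_copies q r : exists b, @copies q (q * d0 + r) b.
Proof.
elim: q => [|q [b hb]]; first by exists (fun=> 0); exact: copies0.
rewrite mulSn -addnA -add1n; eexists; apply: copiesD hb; exact: copies1.
Qed.

End DirectSum.

End Truncation.

(** * Norm bounds for states *)

Section StateBound.
Local Set Implicit Arguments.
Local Unset Strict Implicit.
Import Order.TTheory GRing.Theory Num.Theory.
Local Open Scope ring_scope.
Local Open Scope complex_scope.
Local Open Scope classical_set_scope.
Import numFieldNormedType.Exports.
Context {R : realType} {A : cstar_algebra R} (phi : {scalar A}).
Implicit Types a b x y : A.
Local Notation nrm := (@cnorm R A).
Local Notation st := (@star R A).

Lemma expr_small (q e : R) : 0 <= q -> q < 1 -> 0 < e ->
  exists N, forall n, (N <= n)%N -> q ^+ n < e.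
Proof.
move=> q0 q1 e0; have := @cvg_expr R q; rewrite ger0_norm // => /(_ q1).
move=> /cvgrPdist_lt /(_ e e0) [N _ h]; exists N => n Nn.
by have := h n Nn; rewrite /= sub0r normrN ger0_norm // exprn_ge0.
Qed.

Lemma cnormZr (c : R[i]) x : nrm (c *: x) = cabs c * nrm x.
Proof. by apply: complexI; rewrite cnormZ realcM cabsE. Qed.

Lemma cnorm0 : nrm 0 = 0.
Proof. by rewrite -(scale0r 0) cnormZr cabs0 mul0r. Qed.

Lemma cnormN x : nrm (- x) = nrm x.
Proof. by rewrite -scaleN1r cnormZr cabsN cabs1 mul1r. Qed.

Lemma cnormB x y : nrm (x - y) <= nrm x + nrm y.
Proof. by rewrite -(cnormN y) cnormD. Qed.

Lemma cnorm_ge0 x : 0 <= nrm x.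
Proof.
have := cnormB x x; rewrite subrr cnorm0; lra.
Qed.

Lemma cnorm_distC x y : nrm (x - y) = nrm (y - x).
Proof. by rewrite -opprB cnormN. Qed.

Lemma star_norm x : nrm (st x) = nrm x.
Proof.
suff h y : nrm y <= nrm (st y) by apply/le_anti; rewrite h -{2}[x](@starK _ A) h.
have [->|y0] := eqVneq (nrm y) 0; first exact: cnorm_ge0.
have yp : 0 < nrm y by rewrite lt_neqAle eq_sym y0 cnorm_ge0.
by rewrite -(ler_pM2r yp) -expr2 -cnorm_star cnormM.
Qed.

Lemma starD x y : st (x + y) = st x + st y.
Proof. by have := star_antilinear 1 x y; rewrite conjC1 !scale1r. Qed.

Lemma starZ (c : R[i]) x : st (c *: x) = (c^*)%C *: st x.
Proof.
have := star_antilinear c x 0; rewrite addr0.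
have -> : st 0 = 0 by apply: cnorm_eq0; rewrite star_norm cnorm0.
by rewrite addr0.
Qed.

Lemma starN x : st (- x) = - st x.
Proof. by rewrite -scaleN1r starZ rmorphN1 scaleN1r. Qed.

Lemma star1 : st 1 = 1.
Proof. by rewrite -[LHS]mulr1 -[X in _ * X](@starK _ A) -starM mulr1 starK. Qed.

(* The square root of [1 - a] is [1 - b], with [b] the fixed point of
   [b |-> (a + b^2) / 2], a contraction of the ball of radius 1/2. *)
Lemma sqrt_one_sub a : selfadjoint a -> nrm a <= 3 / 4 ->
  exists b, selfadjoint b /\ b * b = 1 - a.
Proof.
move=> sa na; pose h : R[i] := (2^-1 : R)%:C.
have ch : cabs h = 2^-1 by rewrite cabs_real ger0_norm.
pose F b := h *: (a + b * b).
pose u n := iter n F 0.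
(* The bound 3/4 on [a] is what keeps this ball invariant: (3/4 + 1/4) / 2 = 1/2. *)
have un n : nrm (u n) <= 2^-1.
  elim: n => [|n IH]; first by rewrite cnorm0.
  rewrite /u iterS -/(u n) /F cnormZr ch.
  have : nrm (a + u n * u n) <= 1.
    apply: le_trans (cnormD _ _) _; have := cnormM (u n) (u n).
    have : nrm (u n) * nrm (u n) <= 2^-1 * 2^-1 by rewrite ler_pM ?cnorm_ge0.
    lra.
  lra.
have Fd x y : nrm x <= 2^-1 -> nrm y <= 2^-1 -> nrm (F x - F y) <= 2^-1 * nrm (x - y).
  move=> hx hy; rewrite /F -scalerBr cnormZr ch ler_wpM2l //.
  have -> : a + x * x - (a + y * y) = x * (x - y) + (x - y) * y.
    by rewrite mulrBr mulrBl addrA subrK opprD addrACA subrr add0r.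
  apply: le_trans (cnormD _ _) _.
  have h1 := cnormM x (x - y); have h2 := cnormM (x - y) y.
  have := cnorm_ge0 (x - y); nra.
have du n k : nrm (u (n + k)%N - u n) <= 2^-1 ^+ n.
  elim: n => [|n IH]; first by rewrite add0n subr0 expr0; apply: le_trans (un _) _; lra.
  rewrite addSn /u !iterS -/(u _) -/(u n) exprS.
  by apply: le_trans (Fd _ _ (un _) (un _)) _; rewrite ler_wpM2l.
have [e e0|b hb] := @cnorm_complete _ A u.
  have half0 : 0 <= 2^-1 :> R by lra.
  have half1 : 2^-1 < 1 :> R by lra.
  have e20 : 0 < e / 2 by lra.
  have [N /(_ N (leqnn N)) hN] := expr_small half0 half1 e20.
  exists N => p q Np Nq; rewrite -(subnKC Np) -(subnKC Nq).
  have h1 := du N (p - N)%N; have := du N (q - N)%N; rewrite cnorm_distC => h2.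
  apply: le_lt_trans (_ : nrm (u (N + (p - N))%N - u N) + nrm (u N - u (N + (q - N))%N) < _).
    by rewrite (le_trans _ (cnormD _ _)) // addrA subrK.
  lra.
have b2 : nrm b <= 2^-1.
  apply/ler_addgt0Pr => e e0; have [N /(_ N (leqnn N)) hN] := hb e e0.
  rewrite -[b](subrK (u N)); apply: le_trans (cnormD _ _) _.
  by rewrite cnorm_distC; have := un N; lra.
have small x : (forall e, 0 < e -> nrm x <= e) -> x = 0.
  move=> hx; apply: cnorm_eq0; apply/le_anti; rewrite cnorm_ge0 andbT.
  by apply/ler_addgt0Pr => e /hx; rewrite add0r.
have Fb : F b - b = 0.
  apply: small => e e0; have [|N hN] := hb (e / 2); first lra.
  have h1 := hN N (leqnn N); have h2 := hN N.+1 (leqnSn N).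
  have h3 := Fd b (u N) b2 (un N).
  have := cnormD (F b - F (u N)) (u N.+1 - b); rewrite {2}/u iterS -/(u N) addrA subrK.
  by move: h1; rewrite cnorm_distC; have := cnorm_ge0 (b - u N); lra.
have su n : st (u n) = u n.
  elim: n => [|n IH]; first by apply: cnorm_eq0; rewrite star_norm cnorm0.
  by rewrite /u iterS -/(u n) /F starZ starD starM IH sa; congr (_ *: _); exact: conjc_real.
have sb : st b = b.
  apply/eqP; rewrite -subr_eq0; apply/eqP; apply: small => e e0.
  have [|N hN] := hb (e / 2); first lra.
  have h1 := hN N (leqnn N).
  have := cnormD (st b - u N) (u N - b); rewrite addrA subrK.
  rewrite -{1}(su N) -starN -starD star_norm (cnorm_distC b); lra.
exists (1 - b); split; first by rewrite /selfadjoint starD starN star1 sb.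
have e : a + b * b = b + b.
  have : 2%:R *: F b = 2%:R *: b by move/eqP: Fb; rewrite subr_eq0 => /eqP ->.
  rewrite /F scalerA (_ : 2%:R * h = 1) ?scale1r ?scaler_nat //.
  by rewrite /h realcV realc_nat mulfV // pnatr_eq0.
rewrite mulrBl mul1r mulrBr mulr1 -addrA; congr (_ + _).
apply/eqP; rewrite -subr_eq0 opprK opprB; apply/eqP.
have -> : b * b - b = b - a by apply/eqP; rewrite subr_eq addrAC -e addrC addKr.
by rewrite addrA addNr sub0r addNr.
Qed.

Hypothesis phi_state : is_state phi.

(** Both 1 - a and 1 + a are of the form star b * b, so [phi] is nonnegative on them. In the order
    of the complex numbers this also makes [phi a] real. *)
Lemma state_le1 a : selfadjoint a -> nrm a <= 3 / 4 -> cabs (phi a) <= 1.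
Proof.
case: phi_state => pos phi1 sa na.
have h x : selfadjoint x -> nrm x <= 3 / 4 -> 0 <= 1 - phi x.
  move=> sx nx; have [b [sb bb]] := sqrt_one_sub sx nx.
  by rewrite -phi1 -raddfB /= -bb -{1}sb; exact: pos.
have h1 := h a sa na.
have h2 : 0 <= 1 - phi (- a) by apply: h; rewrite ?cnormN // /selfadjoint starN sa.
rewrite raddfN /= opprK in h2.
have re1 : complex.Re (1 - phi a) = 1 - complex.Re (phi a) by case: (phi a).
have re2 : complex.Re (1 + phi a) = 1 + complex.Re (phi a) by case: (phi a).
have re0 : complex.Re (0 : R[i]) = 0 by [].
have im2 : complex.Im (1 + phi a) = complex.Im (phi a).
  by case: (phi a) => x y /=; rewrite add0r.
move: h1 h2; rewrite !lecE re0 re1 re2 im2 => /andP[_ r1] /andP[/eqP i0 r2].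
rewrite /cabs i0 expr0n addr0 sqrtr_sqr ler_norml.
by apply/andP; split; [rewrite -subr_ge0 opprK addrC | rewrite -subr_ge0].
Qed.

(** Scaling to norm 3/4 costs the factor 4/3. It is harmless, since the bound is applied to high
    powers and only their exponential growth rate counts. *)
Lemma state_bound a : selfadjoint a -> cabs (phi a) <= 4 / 3 * nrm a.
Proof.
move=> sa; have [/cnorm_eq0 ->|a0] := eqVneq (nrm a) 0.
  by rewrite raddf0 cabs0; apply: mulr_ge0; [lra | exact: cnorm_ge0].
have ap : 0 < nrm a by rewrite lt_neqAle eq_sym a0 cnorm_ge0.
pose c := 3 / 4 / nrm a.
have c0 : 0 < c by rewrite !divr_gt0.
have : cabs (phi (c%:C *: a)) <= 1.
  apply: state_le1.
    by rewrite /selfadjoint starZ sa; congr (_ *: _); exact: conjc_real.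
  by rewrite cnormZr cabs_real gtr0_norm // /c divfK // gt_eqF.
rewrite linearZ /= cabsM cabs_real gtr0_norm // -ler_pdivlMl // mulr1.
by move=> /le_trans; apply; rewrite /c [leLHS](_ : _ = 4 / 3 * cnorm a) //; field.
Qed.

Lemma state_expr_bound a n : selfadjoint a -> (0 < n)%N ->
  cabs (phi (a ^+ n)) <= 4 / 3 * nrm a ^+ n.
Proof.
move=> sa; case: n => // n _; have san : selfadjoint (a ^+ n.+1).
  elim: n => [|n IH] //; by rewrite /selfadjoint exprS starM IH sa -exprSr.
apply: le_trans (state_bound san) _; rewrite ler_wpM2l //.
elim: n {san} => [|n IH]; first by rewrite !expr1.
rewrite exprS [leRHS]exprS; apply: le_trans (cnormM _ _) _.
by rewrite ler_wpM2l ?cnorm_ge0.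
Qed.
End StateBound.
(** * Integration over powers of the unitary group *)

Section Measurability.
Local Set Implicit Arguments.
Local Unset Strict Implicit.
Import Order.TTheory GRing.Theory Num.Theory.
Import numFieldNormedType.Exports.
Local Open Scope classical_set_scope.
Local Open Scope ring_scope.
Local Open Scope complex_scope.
Local Open Scope sesquilinear_scope.
Context {R : realType}.
Local Notation C := R[i].

Lemma borel_continuous_measurable (T : ptopologicalType) (f : T -> R) :
  continuous f -> measurable_fun [set: borel T] (f : borel T -> R).
Proof.
move=> /continuousP cf; apply: (measurability _ (measurable_realfun.RGenOpens.measurableE R)).
move=> _ [_ [a [b ->] <-]]; rewrite setTI; apply: sub_sigma_algebra.
exact/cf/interval_open.
Qed.

Lemma continuous_complex_part (T : topologicalType) (g : R[i] -> R) (f : T -> R[i]) :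
  (forall x y, `|g x - g y| <= cabs (x - y)) -> continuous f -> continuous (g \o f).
Proof.
move=> hg cf x; apply/cvgrPdist_lt => e e0.
have e0' : 0 < e%:C by rewrite ltcR.
have hb : nbhs (f x) [set y | `|f x - y| < e%:C] by rewrite -nbhs_ballE; exists e%:C.
have hn : nbhs x (f @^-1` [set y | `|f x - y| < e%:C]) := cf x _ hb.
by apply: filterS hn => y /=; rewrite cabsE ltcR; apply: le_lt_trans.
Qed.

Lemma Re_dist (x y : R[i]) : `|complex.Re x - complex.Re y| <= cabs (x - y).
Proof. by apply: le_trans (Re_le_cabs _); case: x y => [a b] [c d]. Qed.

Lemma Im_dist (x y : R[i]) : `|complex.Im x - complex.Im y| <= cabs (x - y).
Proof. by apply: le_trans (Im_le_cabs _); case: x y => [a b] [c d]. Qed.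

Section ComplexMeasurable.
Context {dT : measure_display} {T : measurableType dT}.
Implicit Types f g : T -> C.

Definition cmeas f := measurable_fun setT (fun x => complex.Re (f x)) /\
                      measurable_fun setT (fun x => complex.Im (f x)).

Lemma cmeas_cst c : cmeas (fun=> c).
Proof. by split; exact: measurable_cst. Qed.

Lemma cmeas_ext f g : f =1 g -> cmeas f -> cmeas g.
Proof. by move=> /funext ->. Qed.

Lemma cmeasD f g : cmeas f -> cmeas g -> cmeas (fun x => f x + g x).
Proof.
move=> [rf jf] [rg jg]; split.
  rewrite (_ : (fun x => _) = (fun x => complex.Re (f x)) \+ (fun x => complex.Re (g x))).
    exact: measurable_funD.
  by apply/funext => x /=; case: (f x); case: (g x).
rewrite (_ : (fun x => _) = (fun x => complex.Im (f x)) \+ (fun x => complex.Im (g x))).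
  exact: measurable_funD.
by apply/funext => x /=; case: (f x); case: (g x).
Qed.

Lemma cmeasM f g : cmeas f -> cmeas g -> cmeas (fun x => f x * g x).
Proof.
move=> [rf jf] [rg jg]; split.
  rewrite (_ : (fun x => _) = (fun x => complex.Re (f x)) \* (fun x => complex.Re (g x)) \-
     (fun x => complex.Im (f x)) \* (fun x => complex.Im (g x))).
    by apply: measurable_funB; apply: measurable_funM.
  by apply/funext => x /=; case: (f x); case: (g x).
rewrite (_ : (fun x => _) = (fun x => complex.Re (f x)) \* (fun x => complex.Im (g x)) \+
     (fun x => complex.Im (f x)) \* (fun x => complex.Re (g x))).
  by apply: measurable_funD; apply: measurable_funM.
by apply/funext => x /=; case: (f x); case: (g x).
Qed.

Lemma cmeas_conj f : cmeas f -> cmeas (fun x => (f x)^*%C).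
Proof.
move=> [rf jf]; split.
  by rewrite (_ : (fun x => _) = (fun x => complex.Re (f x))) //; apply/funext => x; case: (f x).
rewrite (_ : (fun x => _) = \- (fun x => complex.Im (f x))).
  exact: measurableT_comp.
by apply/funext => x /=; case: (f x).
Qed.

Lemma cmeasZ c f : cmeas f -> cmeas (fun x => c * f x).
Proof. by apply: cmeasM; exact: cmeas_cst. Qed.

Lemma cmeasN f : cmeas f -> cmeas (fun x => - f x).
Proof. by move=> /(cmeasZ (-1)); apply: cmeas_ext => x; rewrite mulN1r. Qed.

Lemma cmeasB f g : cmeas f -> cmeas g -> cmeas (fun x => f x - g x).
Proof. by move=> hf hg; apply: cmeasD => //; exact: cmeasN. Qed.

Lemma cmeas_sum (I : Type) (r : seq I) (F : I -> T -> C) :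
  (forall i, cmeas (F i)) -> cmeas (fun x => \sum_(i <- r) F i x).
Proof.
move=> h; elim: r => [|i r IH].
  by apply: (@cmeas_ext (fun=> 0)) (cmeas_cst 0) => x; rewrite big_nil.
by apply: cmeas_ext (cmeasD (h i) IH) => x; rewrite big_cons.
Qed.

Lemma measurable_cabs_sq f : cmeas f -> measurable_fun setT (fun x => cabs (f x) ^+ 2).
Proof.
move=> [rf jf]; rewrite (_ : (fun x => _) = (fun x => complex.Re (f x)) \* (fun x => complex.Re (f x))
   \+ (fun x => complex.Im (f x)) \* (fun x => complex.Im (f x))).
  by apply: measurable_funD; apply: measurable_funM.
by apply/funext => x; rewrite cabs_sq !expr2.
Qed.

Lemma measurable_cabs_lt f (e : R) : cmeas f -> measurable [set x | cabs (f x) < e].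
Proof.
move=> hf; have [e0|e0] := ltP 0 e; last first.
  rewrite (_ : [set x | _] = set0) //; apply/seteqP; split=> x //=.
  by move=> /lt_le_trans /(_ e0); rewrite ltNge cabs_ge0.
rewrite (_ : [set x | _] = (fun x => cabs (f x) ^+ 2) @^-1` `]-oo, e ^+ 2[).
  rewrite -[X in measurable X]setTI.
  exact: (measurable_cabs_sq hf measurableT (measurable_itv _)).
by apply/seteqP; split=> x /=; rewrite in_itv /= ltr_pXn2r ?nnegrE ?cabs_ge0 ?(ltW e0).
Qed.

Section MatrixMeasurable.
Context {m n p : nat}.

Definition mmeas {m n} (F : T -> 'M[C]_(m, n)) := forall i j, cmeas (fun x => F x i j).

Lemma mmeasM (F : T -> 'M[C]_(m, n)) (G : T -> 'M[C]_(n, p)) :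
  mmeas F -> mmeas G -> mmeas (fun x => F x *m G x).
Proof.
move=> hF hG i j.
have h : cmeas (fun x => \sum_k F x i k * G x k j).
  by apply: cmeas_sum => k; exact: cmeasM.
by apply: cmeas_ext h => x; rewrite mxE.
Qed.

Lemma mmeas_adj (F : T -> 'M[C]_(m, n)) : mmeas F -> mmeas (fun x => (F x)^t*).
Proof. by move=> hF i j; apply: cmeas_ext (cmeas_conj (hF j i)) => x; rewrite !mxE. Qed.
End MatrixMeasurable.

Lemma mmeas_prod (Z : Type) m (F : Z -> T -> 'M[C]_m) (w : seq Z) :
  (forall z, mmeas (F z)) -> mmeas (fun x => \prod_(z <- w) F z x).
Proof.
move=> h; elim: w => [|z w IH] i j.
  by apply: (@cmeas_ext (fun=> (1%:M : 'M[C]_m) i j)) (cmeas_cst _) => x; rewrite big_nil.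
by apply: cmeas_ext (mmeasM (h z) IH i j) => x; rewrite big_cons.
Qed.

Lemma cmeas_ntr m (F : T -> 'M[C]_m) : mmeas F -> cmeas (fun x => ntr (F x)).
Proof.
move=> h; have h' : cmeas (fun x => m%:R^-1 * \sum_i F x i i).
  by apply: cmeasZ; apply: (@cmeas_sum _ _ (fun i x => F x i i)) => i; exact: h.
by apply: cmeas_ext h' => x; rewrite /ntr mulrC.
Qed.

End ComplexMeasurable.

Lemma cmeas_comp d1 d2 (T1 : measurableType d1) (T2 : measurableType d2)
  (g : T1 -> T2) (f : T2 -> C) : measurable_fun setT g -> cmeas f -> cmeas (f \o g).
Proof. by move=> mg [rf jf]; split; [exact: measurableT_comp rf mg | exact: measurableT_comp jf mg]. Qed.

Lemma cmeas_continuous (T : ptopologicalType) (f : T -> C) :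
  continuous f -> cmeas (f : borel T -> C).
Proof.
move=> cf; split; apply: borel_continuous_measurable.
  exact: (continuous_complex_part Re_dist cf).
exact: (continuous_complex_part Im_dist cf).
Qed.

Lemma mx_entry_continuous m n (i : 'I_m) (j : 'I_n) :
  continuous (fun M : 'M[C]_(m, n) => M i j).
Proof.
move=> M U hU; exists (fun i' j' => if (i', j') == (i, j) then U else setT) => [i' j'|N hN].
  by case: eqP => [[-> ->] //|_]; exact: filterT.
by have := hN i j; rewrite eqxx.
Qed.

Lemma continuous_mx (T : topologicalType) m n (f : T -> 'M[C]_(m, n)) :
  (forall i j, continuous (fun x => f x i j)) -> continuous f.
Proof.
move=> h x U [P hP PU]; rewrite /nbhs /= /nbhs /=.
have : \forall y \near x, forall i j, P i j (f y i j).
  apply: filter_forall => i; apply: filter_forall => j.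
  exact: (h i j x _ (hP i j)).
by apply: filterS => y hy; apply: PU.
Qed.

Lemma continuous_csum (T : topologicalType) (I : Type) (r : seq I) (F : I -> T -> C) :
  (forall i, continuous (F i)) -> continuous (fun x => \sum_(i <- r) F i x).
Proof.
move=> h; elim: r => [|i r IH] x.
  rewrite (_ : (fun x => _) = fun=> 0); first exact: cvg_cst.
  by apply/funext => y; rewrite big_nil.
rewrite (_ : (fun x => _) = fun x => F i x + \sum_(j <- r) F j x).
  exact: (@cvgD R[i] (R[i] : numFieldType)^o T (nbhs x) _ (F i) _ (F i x) _ (h i x) (IH x)).
by apply/funext => y; rewrite big_cons.
Qed.

Section Group.
Context {d : nat}.
Local Notation G := (borel (@unitary_group R d)).

Lemma unitary_val_continuous : continuous (fun U : @unitary_group R d => set_val U : 'M[C]_d).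
Proof. exact: initial_continuous. Qed.

Lemma herm_val_continuous : continuous (fun M : @herm_mx R d => set_val M : 'M[C]_d).
Proof. exact: initial_continuous. Qed.

Lemma mmeas_unitary : mmeas (fun U : G => set_val (U : unitary_group d) : 'M[C]_d).
Proof.
move=> i j; apply: cmeas_continuous => U.
apply: (@continuous_comp _ _ _ (fun U : @unitary_group R d => set_val U : 'M[C]_d)
  (fun M : 'M[C]_d => M i j)); first exact: unitary_val_continuous.
exact: mx_entry_continuous.
Qed.

Lemma mul_continuous (V : @unitary_group R d) :
  continuous (fun W : @unitary_group R d => unitary_mul W V).
Proof.
apply: (@continuous_comp_initial _ _ _ (set_val : _ -> 'M[C]_d)).
apply: continuous_mx => i j.
have -> : (fun x : unitary_group d => (set_val \o (fun W => unitary_mul W V)) x i j) =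
   (fun x : unitary_group d => \sum_k (set_val x : 'M[C]_d) i k * (set_val V : 'M[C]_d) k j).
  by apply/funext => x; rewrite /= mxE.
apply: continuous_csum => k W; refine (@cvgM R[i] (@unitary_group R d) (nbhs W) _ _ _ _ _ _ (cvg_cst _)).
apply: (@continuous_comp _ _ _ (fun U : @unitary_group R d => set_val U : 'M[C]_d)
  (fun M : 'M[C]_d => M i k)); first exact: unitary_val_continuous.
exact: mx_entry_continuous.
Qed.

End Group.
End Measurability.

(** * Expectations of bounded real and complex functions *)

Section Expectation.
Local Set Implicit Arguments.
Local Unset Strict Implicit.
Import Order.TTheory GRing.Theory Num.Theory.
Import numFieldNormedType.Exports.
Local Open Scope classical_set_scope.
Local Open Scope ring_scope.
Local Open Scope complex_scope.
Context {R : realType} {dT : measure_display} {T : measurableType dT}.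
Context (mu : probability T R).
Local Notation C := R[i].
Implicit Types (f g : T -> R) (h k : T -> C).

Definition bm f := measurable_fun setT f /\ exists K, forall x, `|f x| <= K.

Definition expect f : R := Rintegral mu setT f.

Lemma bm_int f : bm f -> mu.-integrable setT (EFin \o f).
Proof.
move=> [mf [K hK]]; apply: measurable_bounded_integrable => //.
  by rewrite (le_lt_trans (probability_le1 mu measurableT)) // ltry.
exists K; split; first exact: num_real.
by move=> x Kx y _; apply: le_trans (hK y) _; exact: ltW.
Qed.

Lemma bmD f g : bm f -> bm g -> bm (fun x => f x + g x).
Proof.
move=> [mf [K hK]] [mg [L hL]]; split; first exact: measurable_funD.
by exists (K + L) => x; apply: le_trans (ler_normD _ _) _; exact: lerD.
Qed.

Lemma bmM f g : bm f -> bm g -> bm (fun x => f x * g x).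
Proof.
move=> [mf [K hK]] [mg [L hL]]; split; first exact: measurable_funM.
by exists (K * L) => x; rewrite normrM ler_pM.
Qed.

Lemma bm_cst c : bm (fun=> c).
Proof. by split; [exact: measurable_cst | exists `|c|]. Qed.

Lemma bmX f n : bm f -> bm (fun x => f x ^+ n).
Proof.
move=> hf; elim: n => [|n IH]; first by apply: (bm_cst 1).
rewrite (_ : (fun x => _) = fun x => f x * f x ^+ n); first exact: bmM.
by apply/funext => x; rewrite exprS.
Qed.

Lemma bm_sum (I : Type) (r : seq I) (F : I -> T -> R) :
  (forall i, bm (F i)) -> bm (fun x => \sum_(i <- r) F i x).
Proof.
move=> hF; elim: r => [|i r IH].
  rewrite (_ : (fun x => _) = fun=> 0); first exact: bm_cst.
  by apply/funext => y; rewrite big_nil.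
rewrite (_ : (fun x => _) = fun x => F i x + \sum_(j <- r) F j x); first exact: bmD.
by apply/funext => y; rewrite big_cons.
Qed.

Lemma expectD f g : bm f -> bm g -> expect (fun x => f x + g x) = expect f + expect g.
Proof. by move=> hf hg; rewrite /expect RintegralD //; exact: bm_int. Qed.

Lemma expectZ c f : bm f -> expect (fun x => c * f x) = c * expect f.
Proof. by move=> hf; rewrite /expect RintegralZl //; exact: bm_int. Qed.

Lemma expect_cst c : expect (fun=> c) = c.
Proof.
rewrite /expect Rintegral_cst // -[RHS]mulr1; congr (_ * _).
exact: (congr1 fine (probability_setT mu)).
Qed.

Lemma expect_le f g : bm f -> bm g -> (forall x, f x <= g x) -> expect f <= expect g.
Proof. by move=> hf hg fg; apply: le_Rintegral => //; exact: bm_int. Qed.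

Lemma expect_sum (I : Type) (r : seq I) (F : I -> T -> R) :
  (forall i, bm (F i)) -> expect (fun x => \sum_(i <- r) F i x) = \sum_(i <- r) expect (F i).
Proof.
move=> hF; elim: r => [|i r IH].
  rewrite big_nil (_ : (fun x => _) = fun=> 0); first exact: expect_cst.
  by apply/funext => y; rewrite big_nil.
rewrite big_cons -IH -expectD //; last exact: bm_sum.
by congr expect; apply/funext => y; rewrite big_cons.
Qed.

Lemma expect_norm f K : bm f -> (forall x, `|f x| <= K) -> `|expect f| <= K.
Proof.
move=> hf hK; rewrite ler_norml -[- K]expect_cst -[X in _ && (_ <= X)]expect_cst.
apply/andP; split; apply: expect_le => //; try exact: bm_cst.
  by move=> x; have := hK x; rewrite ler_norml => /andP[].
by move=> x; have := hK x; rewrite ler_norml => /andP[].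
Qed.

Lemma expect_markov f (t : R) : bm f -> (forall x, 0 <= f x) -> 0 < t ->
  (mu [set x | t <= f x]%R <= (expect f / t)%:E)%E.
Proof.
move=> hf f0 t0; have mA : measurable [set x | t <= f x]%R.
  rewrite (_ : [set x | _] = f @^-1` `[t, +oo[).
    by rewrite -[X in measurable X]setTI; exact: (hf.1 measurableT _ (measurable_itv _)).
  by apply/seteqP; split=> x /=; rewrite in_itv /= andbT.
have hI : bm (\1_[set x | t <= f x] : T -> R).
  split; first exact: measurable_indic.
  by exists 1 => x; rewrite indicE; case: (_ \in _); rewrite ?normr1 ?normr0.
have eI : expect (\1_[set x | t <= f x] : T -> R) = fine (mu [set x | t <= f x]%R).
  by rewrite /expect /Rintegral integral_indic // setIT.
have : t * expect (\1_[set x | t <= f x] : T -> R) <= expect f.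
  rewrite -expectZ //; apply: expect_le => //; first by apply: bmM => //; exact: bm_cst.
  move=> x; rewrite indicE; case: (boolP (x \in _)) => hx; last by rewrite mulr0.
  by move: hx; rewrite inE /= mulr1.
rewrite eI mulrC -ler_pdivlMr // -lee_fin fineK //; exact: fin_num_measure.
Qed.

Definition bmc h := cmeas h /\ exists K, forall x, cabs (h x) <= K.

Lemma bmc_Re h : bmc h -> bm (fun x => complex.Re (h x)).
Proof.
by move=> [[rf _] [K hK]]; split=> //; exists K => x; apply: le_trans (Re_le_cabs _) _.
Qed.

Lemma bmc_Im h : bmc h -> bm (fun x => complex.Im (h x)).
Proof.
by move=> [[_ jf] [K hK]]; split=> //; exists K => x; apply: le_trans (Im_le_cabs _) _.
Qed.

Lemma bmc_cst c : bmc (fun=> c).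
Proof. by split; [exact: cmeas_cst | exists (cabs c)]. Qed.

Lemma bmcD h k : bmc h -> bmc k -> bmc (fun x => h x + k x).
Proof.
move=> [mf [K hK]] [mg [L hL]]; split; first exact: cmeasD.
by exists (K + L) => x; apply: le_trans (cabsD _ _) _; exact: lerD.
Qed.

Lemma bmcM h k : bmc h -> bmc k -> bmc (fun x => h x * k x).
Proof.
move=> [mf [K hK]] [mg [L hL]]; split; first exact: cmeasM.
by exists (K * L) => x; rewrite cabsM ler_pM ?cabs_ge0.
Qed.

Lemma bmcZ c h : bmc h -> bmc (fun x => c * h x).
Proof. by apply: bmcM; exact: bmc_cst. Qed.

Lemma bmc_conj h : bmc h -> bmc (fun x => (h x)^*%C).
Proof.
by move=> [mf [K hK]]; split; [exact: cmeas_conj | exists K => x; rewrite cabs_conj].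
Qed.

Lemma bmc_sum (I : Type) (r : seq I) (F : I -> T -> C) :
  (forall i, bmc (F i)) -> bmc (fun x => \sum_(i <- r) F i x).
Proof.
move=> hF; elim: r => [|i r IH].
  rewrite (_ : (fun x => _) = fun=> 0); first exact: bmc_cst.
  by apply/funext => y; rewrite big_nil.
rewrite (_ : (fun x => _) = fun x => F i x + \sum_(j <- r) F j x); first exact: bmcD.
by apply/funext => y; rewrite big_cons.
Qed.

Lemma bmcX h n : bmc h -> bmc (fun x => h x ^+ n).
Proof.
move=> hf; elim: n => [|n IH]; first by apply: (bmc_cst 1).
rewrite (_ : (fun x => _) = fun x => h x * h x ^+ n); first exact: bmcM.
by apply/funext => x; rewrite exprS.
Qed.

Lemma bmc_abs_sq h : bmc h -> bm (fun x => cabs (h x) ^+ 2).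
Proof.
move=> [mf [K hK]]; split; first exact: measurable_cabs_sq.
by exists (K ^+ 2) => x; rewrite ger0_norm ?sqr_ge0 // lerXn2r ?nnegrE ?cabs_ge0 //
  (le_trans (cabs_ge0 (h x))).
Qed.

Definition cexpect h : C :=
  (expect (fun x => complex.Re (h x))) +i* (expect (fun x => complex.Im (h x))).

Lemma cexpectD h k : bmc h -> bmc k -> cexpect (fun x => h x + k x) = cexpect h + cexpect k.
Proof.
move=> hh hk; rewrite /cexpect.
rewrite (_ : (fun x => complex.Re _) = fun x => complex.Re (h x) + complex.Re (k x)); last first.
  by apply/funext => x; case: (h x); case: (k x).
rewrite (_ : (fun x => complex.Im _) = fun x => complex.Im (h x) + complex.Im (k x)); last first.
  by apply/funext => x; case: (h x); case: (k x).
by rewrite !expectD //; try exact: bmc_Re; exact: bmc_Im.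
Qed.

Lemma cexpectZ c h : bmc h -> cexpect (fun x => c * h x) = c * cexpect h.
Proof.
move=> hh; have [hr hi] := (bmc_Re hh, bmc_Im hh); rewrite /cexpect; case: c => a b.
rewrite (_ : (fun x => complex.Re _) = fun x => a * complex.Re (h x) + (- b) * complex.Im (h x)); last first.
  by apply/funext => x; case: (h x) => u v /=; rewrite mulNr.
rewrite (_ : (fun x => complex.Im _) = fun x => a * complex.Im (h x) + b * complex.Re (h x)); last first.
  by apply/funext => x; case: (h x) => u v /=.
rewrite !expectD ?expectZ // ?mulNr //; apply: bmM => //; exact: bm_cst.
Qed.

Lemma cexpect_sum (I : Type) (r : seq I) (F : I -> T -> C) :
  (forall i, bmc (F i)) -> cexpect (fun x => \sum_(i <- r) F i x) = \sum_(i <- r) cexpect (F i).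
Proof.
move=> hF; elim: r => [|i r IH].
  rewrite big_nil (_ : (fun x => _) = fun=> 0).
    by rewrite /cexpect !expect_cst.
  by apply/funext => y; rewrite big_nil.
rewrite big_cons -IH -cexpectD //; last exact: bmc_sum.
by congr cexpect; apply/funext => y; rewrite big_cons.
Qed.

Lemma cabs_le_ReIm (z : C) : cabs z <= `|complex.Re z| + `|complex.Im z|.
Proof.
rewrite {1}(complexE z); apply: le_trans (cabsD _ _) _; rewrite cabsM !cabs_real.
have -> : cabs ('i%C : C) = 1 by rewrite /cabs /= expr0n add0r expr1n sqrtr1.
by rewrite mul1r.
Qed.

Lemma cexpect_abs h K : bmc h -> (forall x, cabs (h x) <= K) -> cabs (cexpect h) <= 2 * K.
Proof.
move=> hh hK; apply: le_trans (cabs_le_ReIm _) _.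
rewrite /cexpect /= mulr_natl mulr2n; apply: lerD; apply: expect_norm.
- exact: bmc_Re.
- by move=> x; apply: le_trans (Re_le_cabs _) _.
- exact: bmc_Im.
- by move=> x; apply: le_trans (Im_le_cabs _) _.
Qed.

End Expectation.

(** * Invariance of the product measure under translation of one coordinate *)

Section Invariance.
Local Set Implicit Arguments.
Local Unset Strict Implicit.
Import Order.TTheory GRing.Theory Num.Theory.
Import numFieldNormedType.Exports.
Local Open Scope classical_set_scope.
Local Open Scope ring_scope.
Local Open Scope complex_scope.
Local Open Scope sesquilinear_scope.
Context {R : realType} {d : nat}.
Local Notation G := (borel (@unitary_group R d)).
Context (gamma : probability G R).
Hypothesis haar : is_haar gamma.

Definition gmul (V : @unitary_group R d) (W : G) : G := unitary_mul W V.

Lemma measurable_gmul V : measurable_fun setT (gmul V).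
Proof.
apply: (@measurability _ _ G G setT (gmul V) (@open (@unitary_group R d)) erefl).
move=> _ [U oU <-]; rewrite setTI; apply: sub_sigma_algebra.
by move/continuousP : (@mul_continuous R d V); exact.
Qed.

(** [is_haar] speaks of images: the preimage of [B] under translation by [V] is its image under
    translation by the adjoint of [V]. *)
Lemma gamma_gmul V (B : set G) : measurable B -> gamma (gmul V @^-1` B) = gamma B.
Proof.
move=> mB; have hV : (set_val V : 'M[R[i]]_d)^t* \is unitarymx.
  by rewrite trmxC_unitary; exact: (set_valP V).
have [_ <-] := haar (mk_unitary hV) mB; congr (gamma _).
have e1 (W : G) : unitary_mul (gmul V W) (mk_unitary hV) = W :> unitary_group d.
  by apply: val_inj; exact: (mulmxtVK _ (set_valP V)).
have e2 (W : G) : gmul V (unitary_mul W (mk_unitary hV)) = W :> unitary_group d.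
  by apply: val_inj; exact: (mulmxKtV (n:=d) _ (set_valP V)).
apply/seteqP; split=> [W /= BW|_ [W BW <-]] /=; last by rewrite e2.
by exists (gmul V W).
Qed.

HB.instance Definition _ V :=
  isMeasurableFun.Build _ _ _ _ (gmul V) (@measurable_gmul V).

Lemma integral_gmul V (f : G -> \bar R) : measurable_fun setT f ->
  (forall x, (0 <= f x)%E) ->
  (\int[gamma]_x f (gmul V x) = \int[gamma]_x f x)%E.
Proof.
move=> mf f0; have <- := @ge0_integral_distribution _ _ G G R gamma (gmul V) f mf f0.
by apply: eq_measure_integral => A mA _; exact: gamma_gmul.
Qed.

Definition shift n (k : 'I_n) (V : @unitary_group R d) (u : n.-tuple G) : n.-tuple G :=
  [tuple (if j == k then gmul V (tnth u j) else tnth u j) | j < n].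

Lemma tnth_shift n (k : 'I_n) V u j :
  tnth (shift k V u) j = if j == k then gmul V (tnth u j) else tnth u j.
Proof. by rewrite tnth_mktuple. Qed.

Lemma measurable_shift n (k : 'I_n) V : measurable_fun setT (@shift n k V).
Proof.
apply/measurable_fun_tnthP => i /=; rewrite (_ : _ \o _ =
  fun u => if i == k then gmul V (tnth u i) else tnth u i); last first.
  by apply/funext => u; rewrite /= tnth_shift.
case: eqP => _; last exact: measurable_tnth.
apply: (@measurableT_comp _ _ _ _ _ _ (gmul V) _ (fun u : n.-tuple G => tnth u i)).
  exact: measurable_gmul.
exact: measurable_tnth.
Qed.

Lemma integral_power_probS n (f : n.+1.-tuple G -> \bar R) : measurable_fun setT f ->
  (forall x, (0 <= f x)%E) ->
  (\int[power_prob gamma n.+1]_x f x =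
   \int[gamma]_x \int[power_prob gamma n]_y f (tcons (x, y)))%E.
Proof.
move=> mf f0.
have mfc : measurable_fun setT (f \o (@tcons _ _ n)).
  by apply: (measurableT_comp mf); exact: measurable_tcons.
have e1 := @ge0_integral_distribution _ _ _ _ R (gamma \x power_prob gamma n)%E
  (@tcons _ G n : {mfun _ >-> _}) f mf f0.
have e2 := @fubini_tonelli1 _ _ _ _ R gamma (power_prob gamma n) (f \o (@tcons _ _ n)) mfc
  (fun x => f0 (tcons x)).
exact: etrans e1 e2.
Qed.

Lemma shift_tcons0 n V (x : G) (y : n.-tuple G) :
  shift ord0 V (tcons (x, y)) = tcons (gmul V x, y).
Proof.
apply: eq_from_tnth => i; rewrite tnth_shift.
by case: (unliftP ord0 i) => [j ->|->]; rewrite /tcons ?tnth0 ?tnthS.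
Qed.

Lemma shift_tconsS n (j : 'I_n) V (x : G) (y : n.-tuple G) :
  shift (lift ord0 j) V (tcons (x, y)) = tcons (x, shift j V y).
Proof.
apply: eq_from_tnth => i; rewrite tnth_shift.
case: (unliftP ord0 i) => [i' ->|->]; rewrite /tcons ?tnthS ?tnth0 //.
by rewrite tnth_shift (inj_eq lift_inj).
Qed.

Lemma integral_shift n (k : 'I_n) V (f : n.-tuple G -> \bar R) : measurable_fun setT f ->
  (forall x, (0 <= f x)%E) ->
  (\int[power_prob gamma n]_x f (shift k V x) = \int[power_prob gamma n]_x f x)%E.
Proof.
elim: n k f => [[]//|n IH] k f mf f0.
have mfs : measurable_fun setT (fun x => f (shift k V x)).
  by apply: (measurableT_comp mf); exact: measurable_shift.
have mfc : measurable_fun setT (f \o (@tcons _ _ n)).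
  by apply: (measurableT_comp mf); exact: measurable_tcons.
rewrite (integral_power_probS mfs (fun x => f0 _)) (integral_power_probS mf f0).
have [k0|[j kj]] : k = ord0 \/ exists j, k = lift ord0 j.
  by case: (unliftP ord0 k) => [j|]; [right; exists j | left].
  pose F x := (\int[power_prob gamma n]_y f (tcons (x, y)))%E.
  have mF : measurable_fun setT F.
    exact: (@measurable_fun_fubini_tonelli_F _ _ _ _ R (power_prob gamma n) _ mfc (fun x => f0 _)).
  have F0 x : (0 <= F x)%E by apply: integral_ge0 => y _; exact: f0.
  apply: (etrans _ (integral_gmul V mF F0)).
  apply: eq_integral => x _; apply: eq_integral => y _.
  by rewrite k0 shift_tcons0.
apply: eq_integral => x _.
have mfx : measurable_fun setT (fun y => f (tcons (x, y))).
  exact: (measurableT_comp mfc (pair1_measurable x)).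
apply: (etrans _ (IH j _ mfx (fun y => f0 _))).
by apply: eq_integral => y _; rewrite kj shift_tconsS.
Qed.

Lemma expect_shift n (k : 'I_n) V (f : n.-tuple G -> R) : bm f ->
  expect (power_prob gamma n) (fun x => f (shift k V x)) = expect (power_prob gamma n) f.
Proof.
move=> hf; have [mf [K hK]] := hf.
have hfs : bm (fun x => f (shift k V x)).
  by split; [apply: (measurableT_comp mf); exact: measurable_shift | exists K].
(* Adding the bound makes the integrand nonnegative, so that the invariance proved through Tonelli's
   theorem applies. *)
have hfK : bm (fun x => K + f x) by apply: bmD => //; exact: bm_cst.
have hfsK : bm (fun x => K + f (shift k V x)) by apply: bmD => //; exact: bm_cst.
suff : expect (power_prob gamma n) (fun x => K + f (shift k V x)) =
       expect (power_prob gamma n) (fun x => K + f x).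
  rewrite expectD ?expectD //; try exact: bm_cst.
  exact: addrI.
rewrite /expect /Rintegral; congr fine.
apply: (integral_shift k V (f := fun x => (K + f x)%:E)).
  by apply/measurable_EFinP; exact: (hfK.1).
by move=> x; rewrite lee_fin; have := hK x; rewrite ler_norml => /andP[]; lra.
Qed.

Lemma cexpect_shift n (k : 'I_n) V (f : n.-tuple G -> R[i]) : bmc f ->
  cexpect (power_prob gamma n) (fun x => f (shift k V x)) = cexpect (power_prob gamma n) f.
Proof.
move=> hf; rewrite /cexpect.
rewrite (expect_shift k V (f := fun x => complex.Re (f x)) (bmc_Re hf)).
by rewrite (expect_shift k V (f := fun x => complex.Im (f x)) (bmc_Im hf)).
Qed.

Lemma bmc_shift n (k : 'I_n) V (f : n.-tuple G -> R[i]) : bmc f ->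
  bmc (fun x => f (shift k V x)).
Proof.
move=> [mf [K hK]]; split; last by exists K.
exact: (cmeas_comp (@measurable_shift n k V) mf).
Qed.

End Invariance.
(** * Moments of alternating centred words *)

Section WordDerivations.
Local Set Implicit Arguments.
Local Unset Strict Implicit.
Import Order.TTheory GRing.Theory Num.Theory.
Local Open Scope ring_scope.
Local Open Scope complex_scope.
Local Open Scope sesquilinear_scope.
Context {R : realType} {d : nat}.
Local Notation C := R[i].
Local Notation M_ := 'M[C]_d.
Implicit Types (l : seq (bool * M_)) (B M : M_).

Definition pw l : M_ := \prod_(p <- l) p.2.

Lemma pw_cons p l : pw (p :: l) = p.2 *m pw l.
Proof. by rewrite /pw big_cons. Qed.

Lemma mul_pw_nil B : B *m pw [::] = B.
Proof. by rewrite /pw big_nil; exact: mulmx1. Qed.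

(* The derivation [a |-> [a, M]] on the marked letters. *)
Fixpoint dword M l : M_ :=
  if l is p :: l' then
    (if p.1 then p.2 *m M - M *m p.2 else 0) *m pw l' + p.2 *m dword M l'
  else 0.

Lemma dword_lin l (c : C) M N : dword (c *: M + N) l = c *: dword M l + dword N l.
Proof.
elim: l => [|[b a] l IH] /=; first by rewrite scaler0 addr0.
rewrite IH; case: b; last by rewrite !mul0mx !add0r mulmxDr -scalemxAr.
have -> : a *m (c *: M + N) - (c *: M + N) *m a =
    c *: (a *m M - M *m a) + (a *m N - N *m a).
  by rewrite mulmxDr mulmxDl -scalemxAr -scalemxAl opprD addrACA scalerBr.
by rewrite [in LHS]mulmxDl [in LHS]mulmxDr -[in LHS]scalemxAl -[in LHS]scalemxAr [in RHS]scalerDr addrACA.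
Qed.

(* The contraction, over matrix units [e_ab], of the derivative of the word in
   the direction [e_ab]; it splits the word into products of two traces. *)
Definition tword B l : C := \sum_a \sum_b (B *m dword (delta_mx a b) l) a b.

(** Each summand is the product of a diagonal entry of [A] and one of [B]. This is the mechanism by
    which a trace splits into two. *)
Lemma sum_delta (A B : M_) : \sum_a \sum_b (A *m delta_mx a b *m B) a b = \tr A * \tr B.
Proof.
rewrite /mxtrace big_distrl /=; apply: eq_bigr => a _; rewrite big_distrr /=.
apply: eq_bigr => b _; rewrite -(mul_delta_mx (0 : 'I_1)) mulmxA -mulmxA.
by rewrite -colE -rowE mxE big_ord1 !mxE.
Qed.

Lemma tword_cons B b a l : tword B ((b, a) :: l) =
  (if b then \tr (B *m a) * \tr (pw l) - \tr B * \tr (a *m pw l) else 0) + tword (B *m a) l.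
Proof.
rewrite /tword; case: b => /=; last first.
  rewrite add0r; apply: eq_bigr => i _; apply: eq_bigr => j _.
  by rewrite mul0mx add0r mulmxA.
rewrite -!sum_delta -sumrB -big_split /=; apply: eq_bigr => i _.
rewrite -sumrB -big_split /=; apply: eq_bigr => j _.
by rewrite mulmxDr mulmxBl mulmxBr !mulmxA !mxE.
Qed.

(* The gradient of [M |-> \tr (B *m dword M l)]. *)
Fixpoint yword B l : M_ :=
  if l is p :: l' then
    (if p.1 then pw l' *m B *m p.2 - p.2 *m pw l' *m B else 0) + yword (B *m p.2) l'
  else 0.

Lemma yword_tr B M l : \tr (B *m dword M l) = \tr (yword B l *m M).
Proof.
elim: l B => [|[b a] l IH] B /=; first by rewrite mulmx0 mul0mx.
rewrite mulmxDr mulmxDl !mxtraceD [B *m (a *m _)]mulmxA IH; congr (_ + _).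
case: b; last by rewrite !mul0mx mulmx0.
rewrite mulmxBl mulmxBr mulmxBl !raddfB /=; congr (_ - _).
  by rewrite !mulmxA mxtrace_mulC !mulmxA.
by rewrite !mulmxA -mulmxA mxtrace_mulC !mulmxA.
Qed.

(** Of the two traces in each term of [tword], only that of the initial segment is kept; the other
    one will be bounded by a power of [K]. *)
Fixpoint gword B l : R :=
  if l is p :: l' then
    (if p.1 then cabs (ntr (B *m p.2)) + cabs (ntr B) else 0) + gword (B *m p.2) l'
  else 0.

(** An initial segment occurs at most twice, once for the letter ending it and once for the letter
    following it. The full word could occur only for its last letter, which is unmarked. The added
    trace of [B] makes the induction close. *)
Lemma gword_le B l : ~~ nilp l -> ~~ (last (true, 0) l).1 ->
  gword B l + cabs (ntr B) <= 2 * \sum_(m < size l) cabs (ntr (B *m pw (take m l))).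
Proof.
elim: l B => [|[b a] l IH] B // _; case: l IH => [_|p l IH] hl.
  rewrite /= in hl; rewrite /= (negbTE hl) big_ord1 take0 mul_pw_nil.
  by have := cabs_ge0 (ntr B); rewrite !add0r; lra.
rewrite big_ord_recl take0 mul_pw_nil.
have := IH (B *m a) isT hl.
have -> : \sum_(m < size (p :: l)) cabs (ntr (B *m a *m pw (take m (p :: l)))) =
  \sum_(i < size (p :: l)) cabs (ntr (B *m pw (take (lift ord0 i) ((b, a) :: p :: l)))).
  by apply: eq_bigr => i _; rewrite lift0 [take _ ((b, a) :: _)]/= pw_cons mulmxA.
rewrite -[gword B _]/((if b then cabs (ntr (B *m a)) + cabs (ntr B) else 0) + gword (B *m a) (p :: l)).
move: (\sum_(i < _) _) (gword _ _) => S G.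
have := cabs_ge0 (ntr B); have := cabs_ge0 (ntr (B *m a)).
by clear hl; case: b; lra.
Qed.

Section Bounds.
Variables (K : R) (N : nat).
Hypothesis K1 : 1 <= K.
Let K0 : 0 <= K. Proof. exact: le_trans ler01 K1. Qed.

Lemma bdd_pw l : (forall p, p \in l -> bdd K p.2) -> bdd (K ^+ size l) (pw l).
Proof.
elim: l => [|p l IH] h; first by rewrite /pw big_nil expr0; exact: bdd1.
rewrite pw_cons /= exprS; apply: bddM; first by apply: h; rewrite mem_head.
by apply: IH => q ql; apply: h; rewrite in_cons ql orbT.
Qed.

Lemma tr_ntr (A : M_) : \tr A = d%:R * ntr A.
Proof.
have [d0|d0] := posnP d; last by rewrite /ntr mulrC divfK // pnatr_eq0 -lt0n.
have -> : (d%:R : C) = 0 by rewrite d0.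
rewrite mul0r /mxtrace big1 // => i _; exfalso; by have := leq_trans (ltn_ord i) (eq_leq d0); rewrite ltn0.
Qed.

Lemma tword_le B l m : (m + size l <= N)%N -> bdd (K ^+ m) B ->
  (forall p, p \in l -> bdd K p.2) ->
  cabs (tword B l) <= d%:R ^+ 2 * (K ^+ N * gword B l).
Proof.
elim: l B m => [|[b a] l IH] B m hN hB hl.
  rewrite /tword big1 ?cabs0 => [|i _]; last by rewrite big1 // => j _; rewrite mulmx0 mxE.
  by rewrite mulr0 mulr0.
have ha : bdd K a by apply: (hl (b, a)); rewrite mem_head.
have hl' p : p \in l -> bdd K p.2 by move=> pl; apply: hl; rewrite in_cons pl orbT.
have hBa : bdd (K ^+ m.+1) (B *m a) by rewrite exprSr; apply: bddM.
rewrite /= in hN; have := IH _ m.+1 _ hBa hl'; rewrite addSn -addnS => /(_ hN) IHl.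
rewrite tword_cons /=; apply: le_trans (cabsD _ _) _.
rewrite mulrDr mulrDr; apply: lerD => //; case: b {hl}; last by rewrite cabs0 !mulr0.
have h1 : cabs (ntr (pw l)) <= K ^+ N.
  apply: le_trans (bdd_ntr _ (bdd_pw hl')) _; first exact: exprn_ge0.
  by rewrite ler_weXn2l //; apply: leq_trans hN; rewrite addnS leqW // leq_addl.
have h2 : cabs (ntr (a *m pw l)) <= K ^+ N.
  apply: le_trans (bdd_ntr _ (bddM ha (bdd_pw hl'))) _; first by rewrite mulr_ge0 ?exprn_ge0.
  by rewrite -exprS ler_weXn2l //; apply: leq_trans hN; rewrite leq_addl.
have trM (A A' : M_) : cabs (\tr A * \tr A') = d%:R ^+ 2 * (cabs (ntr A) * cabs (ntr A')).
  by rewrite (tr_ntr A) (tr_ntr A') !cabsM cabs_nat mulrACA -expr2.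
apply: le_trans (cabsB _ _) _; rewrite 2!trM -mulrDr.
apply: ler_wpM2l; first exact: sqr_ge0.
rewrite mulrDr ![K ^+ N * _]mulrC.
by apply: lerD; apply: ler_pM; rewrite ?cabs_ge0.
Qed.

Fixpoint ybound n : R := if n is n'.+1 then 2 * (2 * (K ^+ N + K ^+ N) + ybound n') else 0.

Lemma ybound_ge0 n : 0 <= ybound n.
Proof.
elim: n => //= n IH; apply: mulr_ge0 => //; apply: addr_ge0 => //.
by apply: mulr_ge0 => //; apply: addr_ge0; exact: exprn_ge0.
Qed.

Lemma yword_bdd B l m : (m + size l <= N)%N -> bdd (K ^+ m) B ->
  (forall p, p \in l -> bdd K p.2) -> bdd (ybound (size l)) (yword B l).
Proof.
elim: l B m => [|[b a] l IH] B m hN hB hl; first exact: bdd0.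
have ha : bdd K a by apply: (hl (b, a)); rewrite mem_head.
have hl' p : p \in l -> bdd K p.2 by move=> pl; apply: hl; rewrite in_cons pl orbT.
have hBa : bdd (K ^+ m.+1) (B *m a) by rewrite exprSr; apply: bddM.
have KN : 0 <= K ^+ N by exact: exprn_ge0.
rewrite /= in hN *; apply: bddD; [| exact: ybound_ge0 | |].
- by apply: mulr_ge0 => //; apply: addr_ge0.
- case: b {hl}; last exact: bdd0.
  have hp := bdd_pw hl'.
  apply: bddD => //; last apply: bddN.
    apply: (@bdd_le _ _ (K ^+ size l * K ^+ m * K)); first by rewrite !mulr_ge0 ?exprn_ge0.
      by rewrite -exprD -exprSr ler_weXn2l // -addnS addnC addSn -addnS.
    by apply: bddM => //; apply: bddM.
  apply: (@bdd_le _ _ (K * K ^+ size l * K ^+ m)); first by rewrite !mulr_ge0 ?exprn_ge0.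
    by rewrite -exprS -exprD ler_weXn2l // addnC.
  by apply: bddM => //; apply: bddM.
by apply: (IH _ m.+1) => //; rewrite addSn -addnS.
Qed.
End Bounds.

End WordDerivations.

(** * Polarization of matrix units *)

Section ProjectionSpan.
Local Set Implicit Arguments.
Local Unset Strict Implicit.
Import Order.TTheory GRing.Theory Num.Theory.
Local Open Scope ring_scope.
Local Open Scope complex_scope.
Local Open Scope sesquilinear_scope.
Context {R : realType} {d : nat}.
Local Notation C := R[i].
Local Notation M_ := 'M[C]_d.

(* Matrix units are combinations of rank-one projections. *)
Definition projection (P : M_) := P^t* = P /\ P *m P = P.

Lemma projection_delta a : projection (delta_mx a a).
Proof.
split; last by rewrite mul_delta_mx.
by rewrite trmx_delta map_delta_mx.
Qed.

(** With P_w the projection onto e_a + w e_b for |w| = 1, one has e_ab = P_1 + i P_i - (1 + i)/2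
    (e_aa + e_bb). Projections are preferred as directions because they generate explicit unitaries,
    without a matrix exponential. *)
Lemma delta_span (Q : M_ -> Prop) :
  (forall c M N, Q M -> Q N -> Q (c *: M + N)) -> (forall P, projection P -> Q P) ->
  forall a b, Q (delta_mx a b).
Proof.
move=> Qlin Qproj a b; have [->|ab] := eqVneq a b.
  exact: Qproj (projection_delta b).
pose v (w : C) : 'cV[C]_d := delta_mx a 0 + w *: delta_mx b 0.
pose P w := 2^-1 *: (v w *m (v w)^t*).
have vadj w : (v w)^t* = delta_mx 0 a + (w^*)%C *: delta_mx 0 b.
  apply/matrixP => i j; rewrite !mxE rmorphD rmorphM /=.
  by congr (_ + _ * _); rewrite rmorph_nat andbC.
have pP w : w * (w^*)%C = 1 -> projection (P w).
  move=> ww; split.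
    rewrite /P linearZ /= map_mxZ trmx_mul map_mxM trmxCK; congr (_ *: _).
    by rewrite fmorphV rmorph_nat.
  rewrite /P -scalemxAl -scalemxAr scalerA !mulmxA -[v w *m _ *m v w]mulmxA.
  have -> : (v w)^t* *m v w = 2%:M.
    apply/matrixP => i j; rewrite !ord1 vadj mulmxDl !mulmxDr -!scalemxAl -!scalemxAr.
    rewrite !mul_delta_mx !mul_delta_mx_0 // 1?eq_sym // !scaler0 addr0 add0r.
    by rewrite scalerA [_ * w]mulrC ww scale1r !mxE eqxx.
  rewrite mul_mx_scalar -scalemxAl scalerA -mulrA mulVf ?mulr1 ?pnatr_eq0 //.
have PE w : w * (w^*)%C = 1 -> P w = 2^-1 *: (delta_mx a a + (w^*)%C *: delta_mx a b +
   (w *: delta_mx b a + delta_mx b b)).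
  move=> ww; rewrite /P vadj; congr (_ *: _).
  rewrite mulmxDl !mulmxDr -!scalemxAl -!scalemxAr !mul_delta_mx.
  by rewrite scalerA ww scale1r.
have w1 : (1 : C) * (1^*)%C = 1 by rewrite conjc1 mulr1.
have ci : ('i%C^*)%C = - 'i%C :> C by rewrite /=; simpc.
have ii : 'i%C * 'i%C = -1 :> C by rewrite -expr2 sqr_i.
have wi : ('i%C : C) * ('i%C^*)%C = 1 by rewrite ci mulrN ii opprK.
have QZ c M : Q M -> Q (c *: M).
  move=> QM; have := Qlin (-1) M M QM QM; rewrite scaleN1r addNr => Q0.
  by rewrite -[c *: M]addr0; apply: Qlin.
have e : delta_mx a b = P 1 + ('i%C *: P 'i%C +
   (- (2^-1 * (1 + 'i%C)) *: delta_mx a a + - (2^-1 * (1 + 'i%C)) *: delta_mx b b)).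
  rewrite (PE _ w1) (PE _ wi) ci conjc1.
  have h2 : 2^-1 * 2%:R = 1 :> C by rewrite mulVf // pnatr_eq0.
  move: (2^-1 : C) h2 => h h2.
  move: (delta_mx a a) (delta_mx a b) (delta_mx b a) (delta_mx b b) => e1 e2 e3 e4.
  apply/matrixP => k l; rewrite !mxE.
  move: (e1 k l) (e2 k l) (e3 k l) (e4 k l) => {e1 e2 e3 e4} x1 x2 x3 x4.
  transitivity (h * (x2 + x3 - ('i%C * 'i%C) * x2 + ('i%C * 'i%C) * x3)); last by ring.
  rewrite ii (_ : x2 + _ - _ + _ = 2%:R * x2); last by ring.
  by rewrite mulrA h2 mul1r.
rewrite e -[P 1]scale1r; apply: (Qlin); first by apply: (Qproj); exact: pP.
apply: (Qlin); first by apply: (Qproj); exact: pP.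
apply: (Qlin); [|apply: QZ]; apply: (Qproj); exact: projection_delta.
Qed.

End ProjectionSpan.

(** * Integration by parts on powers of the unitary group *)

Section IntegrationByParts.
Local Set Implicit Arguments.
Local Unset Strict Implicit.
Import Order.TTheory GRing.Theory Num.Theory.
Import numFieldNormedType.Exports.
Local Open Scope classical_set_scope.
Local Open Scope ring_scope.
Local Open Scope complex_scope.
Local Open Scope sesquilinear_scope.
Context {R : realType} {d : nat}.
Local Notation C := R[i].
Local Notation M_ := 'M[C]_d.
Local Notation G := (borel (@unitary_group R d)).

Lemma bdd_exists (M : M_) : exists K, 0 <= K /\ bdd K M.
Proof.
exists (Num.max 0 (opnorm M)); have h0 : 0 <= Num.max 0 (opnorm M) by rewrite le_max lexx.
by split=> //; apply/opnorm_bdd => //; rewrite le_max lexx orbT.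
Qed.

(* A unit complex number equal to [1 + i s] up to [s^2]. *)
Definition zs (s : R) : C := (1 +i* (s / 2)) / (1 -i* (s / 2)).

Lemma zs_den (s : R) : (1 -i* (s / 2) : C) != 0.
Proof. by rewrite eq_complex /= oner_eq0. Qed.

Lemma zs_unit s : zs s * (zs s)^*%C = 1.
Proof.
rewrite /zs rmorphM fmorphV /= opprK mulrACA -invfM.
by rewrite [(1 -i* _) * _]mulrC divff // mulf_neq0 // ?zs_den // eq_complex /= oner_eq0.
Qed.

Lemma zs_den_ge1 (s : R) : 1 <= cabs (1 -i* (s / 2) : C).
Proof. by apply: le_trans (Re_le_cabs _); rewrite /= normr1. Qed.

Lemma zs_sub1 (s : R) : zs s - 1 = 'i%C * s%:C / (1 -i* (s / 2)).
Proof.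
apply: (mulIf (zs_den s)); rewrite mulrBl mul1r !divfK ?zs_den //.
by apply/eqP; rewrite eq_complex /=; apply/andP; split; apply/eqP; field.
Qed.

Lemma conj_add (x y : C) : ((x + y)^*)%C = (x^*)%C + (y^*)%C.
Proof. exact: (rmorphD (@conjc R)). Qed.

Lemma conj_sub (x y : C) : ((x - y)^*)%C = (x^*)%C - (y^*)%C.
Proof. exact: (rmorphB (@conjc R)). Qed.

Lemma conj_mul (x y : C) : ((x * y)^*)%C = (x^*)%C * (y^*)%C.
Proof. exact: (rmorphM (@conjc R)). Qed.

Lemma conj_is (s : R) : (('i%C * s%:C)^*)%C = - ('i%C * s%:C) :> C.
Proof.
by apply/eqP; rewrite eq_complex /=; apply/andP; split; apply/eqP; ring.
Qed.

Lemma cabs_i : cabs ('i%C : C) = 1.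
Proof. by rewrite /cabs /= expr0n add0r expr1n sqrtr1. Qed.

Lemma zs_sub1_le (s : R) : 0 <= s -> cabs (zs s - 1) <= s.
Proof.
move=> s0; rewrite zs_sub1 !cabsM cabs_i mul1r cabs_real ger0_norm // cabs_inv.
by rewrite ler_piMr // invf_le1 ?(lt_le_trans _ (zs_den_ge1 s)) // zs_den_ge1.
Qed.

Lemma zs_near (s : R) : 0 <= s -> cabs (zs s - 1 - 'i%C * s%:C) <= s ^+ 2.
Proof.
move=> s0; rewrite (_ : _ - _ = 'i%C * s%:C * ('i%C * (s / 2)%:C) / (1 -i* (s / 2))); last first.
  rewrite zs_sub1; move: ('i%C * s%:C) => e.
  apply: (mulIf (zs_den s)); rewrite mulrBl !divfK ?zs_den //.
  rewrite -{1}[e]mulr1 -mulrBr; congr (_ * _).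
  by apply/eqP; rewrite eq_complex /=; apply/andP; split; apply/eqP; field.
rewrite !cabsM cabs_i !mul1r !cabs_real !ger0_norm ?divr_ge0 // cabs_inv.
apply: le_trans (_ : s * (s / 2) <= _).
  by rewrite ler_piMr ?mulr_ge0 ?divr_ge0 // invf_le1 ?(lt_le_trans _ (zs_den_ge1 s)) // zs_den_ge1.
by rewrite expr2 ler_wpM2l //; lra.
Qed.

(** This matrix is multiplication by [zs s] on the range of [P] and the identity on its kernel, a
    substitute for exp(i s P). *)
Lemma Vmx_unitary (P : M_) s : projection P -> 1%:M + (zs s - 1) *: P \is unitarymx.
Proof.
move=> [Pa PP]; apply/unitarymxP; rewrite linearD linearZ /= map_mxD map_mxZ trmx1 map_mx1 Pa.
have ww : zs s * Num.conj (zs s) = 1 := zs_unit s.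
have e0 : Num.conj (zs s - 1) + (zs s - 1 + (zs s - 1) * Num.conj (zs s - 1)) = 0.
  have -> : Num.conj (zs s - 1) = Num.conj (zs s) - 1 by rewrite rmorphB rmorph1.
  transitivity (zs s * Num.conj (zs s) - 1); first by ring.
  by rewrite ww subrr.
rewrite mulmxDl !mulmxDr !mul1mx mulmx1 -scalemxAl -scalemxAr PP scalerA.
by rewrite -addrA -!scalerDl e0 scale0r addr0.
Qed.

Lemma conj_mulmx (U V a : M_) :
  (U *m V)^t* *m a *m (U *m V) = V^t* *m (U^t* *m a *m U) *m V.
Proof. by rewrite trmx_mul map_mxM /= !mulmxA. Qed.

Lemma adj_Vmx (P : M_) (z : C) : P^t* = P ->
  (1%:M + z *: P)^t* = 1%:M + (z^*)%C *: P.
Proof. by move=> hP; rewrite linearD linearZ /= map_mxD map_mxZ trmx1 map_mx1 hP. Qed.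

Lemma conj_expand (a P : M_) (z z' e : C) i j :
  ((1%:M + z' *: P) *m a *m (1%:M + z *: P)) i j - a i j - e * (a *m P - P *m a) i j =
  (z - e) * (a *m P) i j + (z' + e) * (P *m a) i j + z' * z * (P *m a *m P) i j.
Proof.
have -> : (1%:M + z' *: P) *m a *m (1%:M + z *: P) =
    a + z *: (a *m P) + (z' *: (P *m a) + (z' * z) *: (P *m a *m P)).
  rewrite mulmxDl mul1mx mulmxDr mulmx1 -!scalemxAl -!scalemxAr mulmxDl -scalemxAl.
  by rewrite scalerDr scalerA [z * z']mulrC addrACA.
by move: (P *m a) (a *m P) (P *m a *m P) => a1 a2 a3; rewrite !mxE; ring.
Qed.

Definition Vu (P : M_) (hP : projection P) s : @unitary_group R d := mk_unitary (Vmx_unitary s hP).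

Context (gamma : probability G R).
Hypothesis haar : is_haar gamma.
Context {n : nat}.
Local Notation T := (n.-tuple G).
Local Notation mu := (power_prob gamma n).

Definition bmcm (F : T -> M_) := forall i j, bmc (fun u => F u i j).

Lemma bmcm_cst (A : M_) : bmcm (fun=> A).
Proof. by move=> i j; exact: bmc_cst. Qed.

Lemma bmcm_ext (F F' : T -> M_) : F =1 F' -> bmcm F -> bmcm F'.
Proof. by move=> /funext ->. Qed.

Lemma bmc_ext (f f' : T -> C) : f =1 f' -> bmc f -> bmc f'.
Proof. by move=> /funext ->. Qed.

Lemma bmcmM F F' : bmcm F -> bmcm F' -> bmcm (fun u => F u *m F' u).
Proof.
move=> hF hF' i j; apply: (@bmc_ext (fun u => \sum_k F u i k * F' u k j)).
  by move=> u; rewrite mxE.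
by apply: (@bmc_sum _ _ _ _ _ (fun k u => F u i k * F' u k j)) => k; apply: bmcM.
Qed.

Lemma bmcmD F F' : bmcm F -> bmcm F' -> bmcm (fun u => F u + F' u).
Proof.
move=> hF hF' i j; apply: (@bmc_ext (fun u => F u i j + F' u i j)); last exact: bmcD.
by move=> u; rewrite mxE.
Qed.

Lemma bmcmB F F' : bmcm F -> bmcm F' -> bmcm (fun u => F u - F' u).
Proof.
move=> hF hF' i j; apply: (@bmc_ext (fun u => F u i j + (-1) * F' u i j)).
  by move=> u; rewrite !mxE mulN1r.
by apply: bmcD => //; exact: bmcZ.
Qed.

Lemma bmcm_adj F : bmcm F -> bmcm (fun u => (F u)^t*).
Proof.
move=> hF i j; apply: (@bmc_ext (fun u => (F u j i)^*%C)); last exact: bmc_conj.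
by move=> u; rewrite !mxE.
Qed.

Lemma bmc_tr F : bmcm F -> bmc (fun u => \tr (F u)).
Proof. by move=> hF; apply: (@bmc_sum _ _ _ _ _ (fun k u => F u k k)) => k; exact: hF. Qed.

Lemma bmc_ntr F : bmcm F -> bmc (fun u => ntr (F u)).
Proof.
move=> hF; apply: (@bmc_ext (fun u => d%:R^-1 * \tr (F u))); last exact: bmcZ (bmc_tr hF).
by move=> u; rewrite /ntr mulrC.
Qed.

Definition uval (u : T) (k : 'I_n) : M_ := set_val (tnth u k : @unitary_group R d).

Lemma uval_unitary u k : uval u k \is unitarymx.
Proof. exact: (set_valP (tnth u k : unitary_group d)). Qed.

Definition letm (p : 'I_n * M_) (u : T) : M_ := (uval u p.1)^t* *m p.2 *m uval u p.1.

Lemma bmcm_uval k : bmcm (fun u => uval u k).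
Proof.
move=> i j; split.
  have := @cmeas_comp R _ _ _ _ (fun u : T => tnth u k) (fun U : G => set_val (U : unitary_group d) i j).
  by apply; [exact: measurable_tnth | exact: mmeas_unitary].
by exists 1 => u; apply: bdd_entry => //; apply: bdd_unitary; exact: uval_unitary.
Qed.

Lemma bmcm_letm p : bmcm (letm p).
Proof.
apply: bmcmM; last exact: bmcm_uval.
by apply: bmcmM; [apply: bmcm_adj; exact: bmcm_uval | exact: bmcm_cst].
Qed.

Section Derivative.
Variables (k : 'I_n).

Definition lw (w : seq ('I_n * M_)) (u : T) : seq (bool * M_) :=
  [seq (p.1 == k, letm p u) | p <- w].

Lemma bmcm_pw w : bmcm (fun u => pw (lw w u)).
Proof.
elim: w => [|p w IH].
  by apply: bmcm_ext (bmcm_cst 1%:M) => u; rewrite /pw big_nil.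
by apply: (bmcm_ext _ (bmcmM (bmcm_letm p) IH)) => u; rewrite pw_cons.
Qed.

Lemma bmcm_dword w M : bmcm (fun u => dword M (lw w u)).
Proof.
elim: w => [|p w IH]; first exact: bmcm_cst.
apply: bmcmD; last by apply: bmcmM => //; exact: bmcm_letm.
apply: bmcmM; last exact: bmcm_pw.
rewrite /=; case: (p.1 == k); last exact: bmcm_cst.
by apply: bmcmB; apply: bmcmM; try exact: bmcm_cst; exact: bmcm_letm.
Qed.

Lemma bmcm_yword w B : bmcm B -> bmcm (fun u => yword (B u) (lw w u)).
Proof.
elim: w B => [|p w IH] B hB; first exact: bmcm_cst.
apply: bmcmD; last by apply: (IH (fun u => B u *m letm p u)); apply: bmcmM => //; exact: bmcm_letm.
rewrite /=; case: (p.1 == k); last exact: bmcm_cst.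
apply: bmcmB.
  by apply: bmcmM; [apply: bmcmM => //; exact: bmcm_pw | exact: bmcm_letm].
by apply: bmcmM => //; apply: bmcmM; [exact: bmcm_letm | exact: bmcm_pw].
Qed.

Variables (P : M_) (hP : projection P).
Local Notation sh s u := (shift k (Vu hP s) u).

(** A first-order expansion along right translation of the [k]-th unitary, uniform in [u]. The
    factor i is taken out, so that the derivative of a rotated letter is its commutator with [P];
    complex conjugation then changes the sign of the derivative. *)
Definition has_der (g g' : T -> C) : Prop :=
  [/\ bmc g, bmc g' & exists K, 0 <= K /\ forall s, 0 < s -> s <= 1 -> forall u,
    cabs (g (sh s u) - g u - 'i%C * s%:C * g' u) <= K * s ^+ 2].

Lemma has_der_ext g1 g1' g2 g2' : g1 =1 g2 -> g1' =1 g2' -> has_der g1 g1' -> has_der g2 g2'.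
Proof. by move=> /funext -> /funext ->. Qed.

Lemma has_der_cst c : has_der (fun=> c) (fun=> 0).
Proof.
split; [exact: bmc_cst | exact: bmc_cst |]; exists 0; split=> // s _ _ u.
by rewrite subrr sub0r mulr0 oppr0 cabs0 mul0r.
Qed.

Lemma has_derD g g' h h' : has_der g g' -> has_der h h' ->
  has_der (fun u => g u + h u) (fun u => g' u + h' u).
Proof.
move=> [bg bg' [K [K0 hK]]] [bh bh' [L [L0 hL]]]; split; [exact: bmcD | exact: bmcD |].
exists (K + L); split=> [|s s0 s1 u]; first exact: addr_ge0.
rewrite mulrDl; apply: le_trans (lerD (hK s s0 s1 u) (hL s s0 s1 u)).
apply: le_trans (cabsD _ _); rewrite le_eqVlt; apply/orP; left; apply/eqP; congr cabs; ring.
Qed.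

Lemma has_derM g g' h h' : has_der g g' -> has_der h h' ->
  has_der (fun u => g u * h u) (fun u => g' u * h u + g u * h' u).
Proof.
move=> [bg bg' [K [K0 hK]]] [bh bh' [L [L0 hL]]]; split; first exact: bmcM.
  by apply: bmcD; exact: bmcM.
have [[_ [g1 hg1]] [_ [g2 hg2]]] := (bg, bg').
have [[_ [h1 hh1]] [_ [h2 hh2]]] := (bh, bh').
have bnd (f : T -> C) b : (forall x, cabs (f x) <= b) -> forall x, cabs (f x) <= `|b|.
  by move=> hf x; apply: le_trans (hf x) (ler_norm b).
exists (K * `|h1| + (`|g1| + `|g2|) * L + `|g2| * `|h2|).
split=> [|s s0 s1 u]; first by rewrite !addr_ge0 ?mulr_ge0 ?addr_ge0.
set e := 'i%C * s%:C.
have ce : cabs e = s by rewrite cabsM cabs_i mul1r cabs_real gtr0_norm.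
have -> : g (sh s u) * h (sh s u) - g u * h u - e * (g' u * h u + g u * h' u) =
  (g (sh s u) - g u - e * g' u) * h (sh s u) + (g u + e * g' u) * (h (sh s u) - h u - e * h' u)
  + e * e * (g' u * h' u) by ring.
rewrite [leRHS]mulrDl; apply: le_trans (cabsD _ _) _; apply: lerD.
  rewrite [leRHS]mulrDl; apply: le_trans (cabsD _ _) _; rewrite 2!cabsM; apply: lerD.
    by rewrite [leRHS]mulrAC ler_pM ?cabs_ge0 ?hK ?(bnd _ _ hh1).
  rewrite -[leRHS]mulrA ler_pM ?cabs_ge0 ?hL //.
  apply: le_trans (cabsD _ _) _; rewrite cabsM ce; apply: lerD; first exact: (bnd _ _ hg1).
  by rewrite -[leRHS]mul1r ler_pM ?cabs_ge0 ?(ltW s0) ?(bnd _ _ hg2).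
rewrite (cabsM (e * e)) (cabsM e) (cabsM (g' u)) ce mulrC expr2 ler_pM ?mulr_ge0 ?cabs_ge0 ?(ltW s0) //.
by apply: ler_pM; rewrite ?cabs_ge0 ?(bnd _ _ hg2) ?(bnd _ _ hh2).
Qed.

Lemma has_derZ c g g' : has_der g g' -> has_der (fun u => c * g u) (fun u => c * g' u).
Proof.
by move=> /(has_derM (has_der_cst c)); apply: has_der_ext => u //; rewrite mul0r add0r.
Qed.

Lemma has_der_sum (I : Type) (r : seq I) (g g' : I -> T -> C) :
  (forall i, has_der (g i) (g' i)) ->
  has_der (fun u => \sum_(i <- r) g i u) (fun u => \sum_(i <- r) g' i u).
Proof.
move=> h; elim: r => [|i r IH].
  by apply: has_der_ext (has_der_cst 0) => u; rewrite big_nil.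
by apply: has_der_ext (has_derD (h i) IH) => u; rewrite big_cons.
Qed.

Lemma has_der_conj g g' : has_der g g' -> has_der (fun u => (g u)^*%C) (fun u => - (g' u)^*%C).
Proof.
move=> [bg bg' [K [K0 hK]]]; split; first exact: bmc_conj.
  by apply: (bmc_ext _ (bmcZ (-1) (bmc_conj bg'))) => u; rewrite mulN1r.
exists K; split=> // s s0 s1 u; apply: le_trans (hK s s0 s1 u).
rewrite -[leRHS]cabs_conj (_ : (_ - _ - _)^*%C = (g (sh s u))^*%C - (g u)^*%C -
  ('i%C * s%:C) * - (g' u)^*%C) //.
by rewrite !conj_sub conj_mul conj_is mulNr mulrN.
Qed.

Lemma has_derX g g' q : has_der g g' ->
  has_der (fun u => g u ^+ q) (fun u => q%:R * g u ^+ q.-1 * g' u).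
Proof.
move=> h; elim: q => [|q IH].
  by apply: has_der_ext (has_der_cst 1) => u; rewrite ?expr0 ?mul0r.
apply: has_der_ext (has_derM h IH) => u; first by rewrite exprS.
rewrite /= mulrC; case: q {IH} => [|q]; first by rewrite !mul0r mulr0 addr0 !expr0 mulr1 mulrC.
by rewrite /= exprS -[q.+2%:R]natr1; ring.
Qed.

Definition mder (F F' : T -> M_) := forall i j, has_der (fun u => F u i j) (fun u => F' u i j).

Lemma mderM F F' H H' : mder F F' -> mder H H' ->
  mder (fun u => F u *m H u) (fun u => F' u *m H u + F u *m H' u).
Proof.
move=> hF hH i j.
have := @has_der_sum _ (index_enum 'I_d) (fun l u => F u i l * H u l j)
  (fun l u => F' u i l * H u l j + F u i l * H' u l j).
move=> /(_ (fun l => has_derM (hF i l) (hH l j))).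
by apply: has_der_ext => u; rewrite !mxE // big_split.
Qed.

Lemma mder_letm p :
  mder (letm p) (fun u => if p.1 == k then letm p u *m P - P *m letm p u else 0).
Proof.
move=> i j; split; first exact: bmcm_letm.
  have : bmcm (fun u => if p.1 == k then letm p u *m P - P *m letm p u else 0).
    case: (p.1 == k); last exact: bmcm_cst.
    by apply: bmcmB; apply: bmcmM; try exact: bmcm_cst; exact: bmcm_letm.
  exact.
have [A [A0 hA]] := bdd_exists p.2; have [B [B0 hB]] := bdd_exists P.
exists (A * B + B * A + B * A * B); split=> [|s s0 s1 u]; first by rewrite !addr_ge0 ?mulr_ge0.
have s0' := ltW s0.
rewrite /letm /uval tnth_shift; case: (p.1 == k); last first.
  by rewrite subrr sub0r mxE mulr0 oppr0 cabs0 mulr_ge0 ?sqr_ge0 ?addr_ge0 ?mulr_ge0.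
set U : M_ := set_val (tnth u p.1 : unitary_group d).
have hU : U \is unitarymx by exact: (set_valP (tnth u p.1 : unitary_group d)).
set z := zs s - 1; set e := 'i%C * s%:C.
have ha : bdd A (U^t* *m p.2 *m U) by apply: bdd_conj.
have -> : (set_val (gmul (Vu hP s) (tnth u p.1) : unitary_group d))^t* *m p.2 *m
   (set_val (gmul (Vu hP s) (tnth u p.1) : unitary_group d)) =
  (1%:M + (z^*)%C *: P) *m (U^t* *m p.2 *m U) *m (1%:M + z *: P).
  by rewrite -(adj_Vmx z (proj1 hP)); exact: conj_mulmx.
move: (U^t* *m p.2 *m U) ha => a ha; rewrite conj_expand.
have hz : cabs (z - e) <= s ^+ 2 by exact: zs_near.
have hz' : cabs ((z^*)%C + e) <= s ^+ 2.
  rewrite -cabs_conj (_ : (_ + _)^*%C = z - e) //.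
  by rewrite conj_add conj_is conjcK.
have hzz : cabs ((z^*)%C * z) <= s ^+ 2.
  by rewrite cabsM cabs_conj expr2 ler_pM ?cabs_ge0 ?zs_sub1_le.
rewrite [leRHS]mulrDl [X in _ <= X + _]mulrDl.
apply: le_trans (cabsD _ _) _; apply: lerD.
  apply: le_trans (cabsD _ _) _; apply: lerD; rewrite cabsM mulrC ler_pM ?cabs_ge0 //.
    by apply: bdd_entry; [exact: mulr_ge0 | exact: bddM].
  by apply: bdd_entry; [exact: mulr_ge0 | exact: bddM].
rewrite cabsM mulrC ler_pM ?cabs_ge0 //.
by apply: bdd_entry; [rewrite !mulr_ge0 | apply: bddM => //; exact: bddM].
Qed.

Lemma mder_pw w : mder (fun u => pw (lw w u)) (fun u => dword P (lw w u)).
Proof.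
elim: w => [|p w IH] i j.
  apply: has_der_ext (has_der_cst ((1%:M : M_) i j)) => u; first by rewrite /pw big_nil.
  by rewrite mxE.
apply: has_der_ext (mderM (mder_letm p) IH i j) => u //=.
by rewrite pw_cons.
Qed.

Lemma has_der_ntr F F' : mder F F' -> has_der (fun u => ntr (F u)) (fun u => ntr (F' u)).
Proof.
move=> h; apply: has_der_ext (has_derZ d%:R^-1 (has_der_sum (index_enum 'I_d) (fun i => h i i))) => u;
by rewrite /ntr mulrC.
Qed.

(** By invariance the expectations of [g] and of its translate cancel, so s times the expectation of
    [g'] is of order s^2. *)
Lemma integration_by_parts g g' : has_der g g' -> cexpect mu g' = 0.
Proof.
move=> [bg bg' [K [K0 hK]]]; apply: cabs_eq0; apply/eqP; apply: contraT => e0.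
set e := cabs _ in e0; have {}e0 : 0 < e by rewrite lt_neqAle eq_sym e0 cabs_ge0.
have key s : 0 < s -> s <= 1 -> e <= 2 * K * s.
  move=> s0 s1; pose r u := g (sh s u) + (-1) * g u + (- ('i%C * s%:C)) * g' u.
  have br : bmc r.
    by apply: bmcD; [apply: bmcD; [exact: bmc_shift | exact: bmcZ] | exact: bmcZ].
  have : cexpect mu r = - ('i%C * s%:C) * cexpect mu g'.
    rewrite /r !cexpectD ?cexpectZ //; try exact: bmcZ; try exact: bmc_shift.
      by rewrite cexpect_shift // mulN1r subrr add0r.
    by apply: bmcD; [exact: bmc_shift | exact: bmcZ].
  move=> /(congr1 cabs); rewrite cabsM cabsN cabsM cabs_i mul1r cabs_real gtr0_norm // -/e => h.
  have : cabs (cexpect mu r) <= 2 * (K * s ^+ 2).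
    by apply: cexpect_abs => // u; rewrite /r mulN1r mulNr; exact: hK.
  by rewrite h mulrA expr2 mulrA [s * e]mulrC ler_pM2r.
(* At s = e / (4K + e + 1), which is at most 1, the bound e <= 2 K s would give e < e. *)
have D0 : 0 < 4 * K + e + 1 by lra.
have := key (e / (4 * K + e + 1)) (divr_gt0 e0 D0) _.
rewrite ler_pdivrMr // mul1r => /(_ _)/wrap[|h]; first by lra.
exfalso; move: h; rewrite mulrA ler_pdivlMr //; nra.
Qed.

End Derivative.
End IntegrationByParts.

(** * The Schwinger-Dyson equation *)

Section MomentBound.
Local Set Implicit Arguments.
Local Unset Strict Implicit.
Import Order.TTheory GRing.Theory Num.Theory.
Local Open Scope classical_set_scope.
Local Open Scope ring_scope.
Local Open Scope complex_scope.
Local Open Scope sesquilinear_scope.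
Context {R : realType}.
Local Notation C := R[i].

Section SchwingerDyson.
Context {d : nat}.
Local Notation M_ := 'M[C]_d.
Local Notation G := (borel (@unitary_group R d)).
Context (gamma : probability G R).
Hypothesis haar : is_haar gamma.
Context {n : nat}.
Local Notation T := (n.-tuple G).
Local Notation mu := (power_prob gamma n).
Variables (k : 'I_n) (w : seq ('I_n * M_)) (q : nat).

Let l (u : T) := lw k w u.
Let f (u : T) : C := ntr (pw (l u)).
Let y (u : T) : M_ := yword 1%:M (l u).

Lemma conj_ntr (M : M_) : (ntr M)^*%C = ntr (M^t*).
Proof.
rewrite /ntr conj_mul; congr (_ * _).
  by rewrite -[LHS]/(Num.conj (\tr M)) -map_trmx mxtrace_tr [RHS]trace_map_mx.
by rewrite -[LHS]/(Num.conj _) fmorphV rmorph_nat.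
Qed.

Lemma ntr_dword M u : ntr (dword M (l u)) = ntr (y u *m M).
Proof. by rewrite /ntr -yword_tr mul1mx. Qed.

(** For hermitian [M] this is the derivative of an entry of the word times f^q conj(f)^(q+1). The
    conjugate of ntr (y M) is written as ntr (y^* M), which makes the expression complex linear in
    [M] and lets it extend from projections to matrix units. *)
Definition sd_term a b (M : M_) (u : T) : C :=
  dword M (l u) a b * (f u ^+ q * (f u)^*%C ^+ q.+1) +
  pw (l u) a b * (q%:R * f u ^+ q.-1 * ntr (y u *m M) * (f u)^*%C ^+ q.+1 -
                  q.+1%:R * (f u ^+ q * (f u)^*%C ^+ q) * ntr ((y u)^t* *m M)).

Let bf : bmc f. Proof. by apply: bmc_ntr; exact: bmcm_pw. Qed.
Let bfc : bmc (fun u => (f u)^*%C). Proof. exact: bmc_conj. Qed.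
Let by_ : bmcm y. Proof. by apply: bmcm_yword; exact: bmcm_cst. Qed.

Lemma bmc_sd_term a b M : bmc (sd_term a b M).
Proof.
apply: bmcD.
  apply: bmcM; first exact: bmcm_dword.
  by apply: bmcM; exact: bmcX.
apply: bmcM; first exact: bmcm_pw.
apply: (@bmc_ext _ _ _ (fun u => q%:R * f u ^+ q.-1 * ntr (y u *m M) * (f u)^*%C ^+ q.+1 +
   (-1) * (q.+1%:R * (f u ^+ q * (f u)^*%C ^+ q) * ntr ((y u)^t* *m M)))).
  by move=> u; rewrite mulN1r.
apply: bmcD.
  apply: bmcM; last exact: bmcX.
  apply: bmcM; first by apply: bmcZ; exact: bmcX.
  by apply: bmc_ntr; apply: bmcmM => //; exact: bmcm_cst.
apply: bmcZ; apply: bmcM; first by apply: bmcZ; apply: bmcM; exact: bmcX.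
by apply: bmc_ntr; apply: bmcmM; [exact: bmcm_adj | exact: bmcm_cst].
Qed.

Lemma sd_projection a b P : projection P -> cexpect mu (sd_term a b P) = 0.
Proof.
move=> hP; have df : has_der k hP f (fun u => ntr (y u *m P)).
  apply: has_der_ext (has_der_ntr (mder_pw k hP w)) => u //.
  by rewrite -ntr_dword.
have h := has_derM (mder_pw k hP w a b) (has_derM (has_derX q df) (has_derX q.+1 (has_der_conj df))).
have := integration_by_parts haar h.
apply: etrans; congr cexpect; apply/funext => u; rewrite /sd_term; congr (_ + _ * _).
have -> : (ntr (y u *m P))^*%C = ntr ((y u)^t* *m P).
  by rewrite conj_ntr trmx_mul map_mxM ntr_mulC (proj1 hP).
by rewrite /= mulrN mulrN -!mulrA; congr (_ - _); ring.
Qed.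

Lemma sd_term_lin a b c M N u :
  sd_term a b (c *: M + N) u = c * sd_term a b M u + sd_term a b N u.
Proof.
have e1 : dword (c *: M + N) (l u) a b = c * dword M (l u) a b + dword N (l u) a b.
  by rewrite dword_lin 2!mxE.
have e2 (B : M_) : ntr (B *m (c *: M + N)) = c * ntr (B *m M) + ntr (B *m N).
  by rewrite mulmxDr -scalemxAr ntrD ntrZ.
rewrite /sd_term e1 (e2 (y u)) (e2 ((y u)^t*)).
move: (dword M _ _ _) (dword N _ _ _) (pw _ _ _) (ntr (y u *m M)) (ntr (y u *m N)).
move: (ntr ((y u)^t* *m M)) (ntr ((y u)^t* *m N)) (f u ^+ q) (f u ^+ q.-1).
move: ((f u)^*%C ^+ q.+1) ((f u)^*%C ^+ q) (q%:R) (q.+1%:R) => *; ring.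
Qed.

Lemma sd_delta a b a' b' : cexpect mu (sd_term a b (delta_mx a' b')) = 0.
Proof.
apply: (@delta_span R d (fun M => cexpect mu (sd_term a b M) = 0)) => [c M N hM hN|P hP].
  rewrite (_ : sd_term a b _ = fun u => c * sd_term a b M u + sd_term a b N u).
    rewrite cexpectD ?cexpectZ ?hM ?hN ?mulr0 ?addr0 //; try exact: bmc_sd_term.
    by apply: bmcZ; exact: bmc_sd_term.
  by apply/funext => u; exact: sd_term_lin.
exact: sd_projection.
Qed.

Lemma sum_ntr_delta (A B : M_) :
  \sum_a \sum_b A a b * ntr (B *m delta_mx a b) = ntr (A *m B).
Proof.
have tr_d a b : ntr (B *m delta_mx a b) = d%:R^-1 * B b a.
  rewrite /ntr mulrC; congr (_ * _); rewrite /mxtrace (bigD1 b) //= big1 ?addr0.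
    rewrite mxE (bigD1 a) //= big1 ?addr0; first by rewrite mxE !eqxx mulr1.
    by move=> i ia; rewrite mxE (negbTE ia) mulr0.
  move=> j jb; rewrite mxE big1 // => i _; rewrite mxE (negbTE jb) andbF mulr0 //.
rewrite [RHS]/ntr mulrC mulr_sumr; apply: eq_bigr => a _; rewrite mxE mulr_sumr.
by apply: eq_bigr => b _; rewrite tr_d mulrCA.
Qed.

(** The entry (a, b) is differentiated in the direction e_ab and everything is summed.
    Differentiating the word gives products of two unnormalized traces, of order d^2;
    differentiating the powers of f contracts to one normalized trace, of order 1. This discrepancy
    is the gain of 1 / d^2. *)
Lemma schwinger_dyson : cexpect mu (fun u => tword 1%:M (l u) * (f u ^+ q * (f u)^*%C ^+ q.+1) +
   (q%:R * f u ^+ q.-1 * (f u)^*%C ^+ q.+1 * ntr (pw (l u) *m y u) -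
    q.+1%:R * (f u ^+ q * (f u)^*%C ^+ q) * ntr (pw (l u) *m (y u)^t*))) = 0.
Proof.
have : cexpect mu (fun u => \sum_a \sum_b sd_term a b (delta_mx a b) u) = 0.
  rewrite (@cexpect_sum _ _ _ mu _ _ (fun a u => \sum_b sd_term a b (delta_mx a b) u)).
    rewrite big1 // => a _; rewrite (@cexpect_sum _ _ _ mu _ _ (fun b u => sd_term a b (delta_mx a b) u)).
      by rewrite big1 // => b _; exact: sd_delta.
    by move=> b; exact: bmc_sd_term.
  move=> a; apply: (@bmc_sum _ _ _ _ _ (fun b u => sd_term a b (delta_mx a b) u)) => b.
  exact: bmc_sd_term.
apply: etrans; congr cexpect; apply/funext => u; rewrite /sd_term.
under [RHS]eq_bigr do rewrite big_split /=.
rewrite big_split /= /tword mulr_suml; congr (_ + _).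
  apply: eq_bigr => a _; rewrite mulr_suml; apply: eq_bigr => b _.
  by rewrite mul1mx.
rewrite -!sum_ntr_delta !mulr_sumr -sumrB; apply: eq_bigr => a _.
rewrite !mulr_sumr -sumrB; apply: eq_bigr => b _; ring.
Qed.

End SchwingerDyson.
End MomentBound.

(** * Elementary inequalities *)

Section RealInequalities.
Local Set Implicit Arguments.
Local Unset Strict Implicit.
Import Order.TTheory GRing.Theory Num.Theory.
Local Open Scope ring_scope.
Context {R : realFieldType}.
Implicit Types x y : R.

(** The cases y <= 4x and x < y/4 each give one term. The weight 1/4 is chosen so that two
    applications still leave half of the absorbed power. *)
Lemma young_power x y n : 0 <= x -> 0 <= y -> x * y ^+ n <= 4 ^+ n * x ^+ n.+1 + 4^-1 * y ^+ n.+1.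
Proof.
move=> x0 y0; have [yx|xy] := leP y (4 * x).
  apply: le_trans (_ : x * (4 * x) ^+ n <= _).
    by apply: ler_wpM2l => //; apply: lerXn2r; rewrite ?nnegrE // mulr_ge0.
  by rewrite exprMn mulrCA -exprS lerDl mulr_ge0 ?exprn_ge0 // invr_ge0.
apply: le_trans (_ : 4^-1 * y * y ^+ n <= _).
  by apply: ler_wpM2r; [exact: exprn_ge0 | lra].
by rewrite -mulrA -exprS lerDr mulr_ge0 ?exprn_ge0.
Qed.

Lemma exprD_le x y p : 0 <= x -> 0 <= y -> (x + y) ^+ p <= 2 ^+ p * (x ^+ p + y ^+ p).
Proof.
move=> x0 y0; wlog xy : x y x0 y0 / x <= y => [h|].
  by case: (leP x y) => [/h|/ltW/h]; [apply | rewrite addrC [y ^+ p + _]addrC; apply].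
apply: le_trans (_ : (2 * y) ^+ p <= _).
  by apply: lerXn2r; rewrite ?nnegrE ?addr_ge0 ?mulr_ge0 //; lra.
by rewrite exprMn ler_wpM2l ?exprn_ge0 // lerDr exprn_ge0.
Qed.

(** The constant is far from optimal, but it is a [p]-th power of a quantity independent of [p],
    which is all that uniformity in [p] requires. *)
Lemma expr_sum_le N (F : 'I_N -> R) p : (forall i, 0 <= F i) -> (0 < p)%N ->
  (\sum_(i < N) F i) ^+ p <= (2 ^+ N) ^+ p * \sum_(i < N) F i ^+ p.
Proof.
move=> + p0; elim: N F => [|N IH] F F0; first by rewrite !big_ord0 expr0n gtn_eqF ?mulr0.
rewrite !big_ord_recl; apply: le_trans (exprD_le _ _ _) _ => //; first exact: sumr_ge0.
rewrite exprS exprMn -mulrA ler_wpM2l ?exprn_ge0 // mulrDr.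
apply: lerD; last by apply: IH.
by rewrite -[leLHS]mul1r ler_wpM2r ?exprn_ge0 // !exprn_ege1 // ler1n.
Qed.

Lemma addXn_le x y p : 0 <= x -> 0 <= y -> (0 < p)%N -> x ^+ p + y ^+ p <= (x + y) ^+ p.
Proof.
move=> x0 y0; case: p => // p _; elim: p => [|p IH]; first by rewrite !expr1.
rewrite [x ^+ _]exprS [y ^+ _]exprS [(x + y) ^+ _]exprS mulrDl.
apply: lerD; apply: ler_wpM2l => //; apply: lerXn2r; rewrite ?nnegrE ?addr_ge0 //.
  by rewrite lerDl.
by rewrite lerDr.
Qed.

End RealInequalities.

(** * Alternating words of rotated matrices *)

Section MomentInduction.
Local Set Implicit Arguments.
Local Unset Strict Implicit.
Import Order.TTheory GRing.Theory Num.Theory.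
Local Open Scope classical_set_scope.
Local Open Scope ring_scope.
Local Open Scope complex_scope.
Local Open Scope sesquilinear_scope.
Context {R : realType}.
Local Notation C := R[i].

Section Fixed.
Context {d : nat}.
Local Notation M_ := 'M[C]_d.
Local Notation G := (borel (@unitary_group R d)).
Context {n : nat}.
Local Notation T := (n.-tuple G).

Definition wntr (w : seq ('I_n * M_)) (u : T) : C := ntr (\prod_(p <- w) letm p u).

Definition alt_word (w : seq ('I_n * M_)) := sorted (fun p p' => p.1 != p'.1) w.

Definition centred (K : R) (w : seq ('I_n * M_)) :=
  forall p, p \in w -> bdd K p.2 /\ ntr p.2 = 0.

Lemma pw_lw (k : 'I_n) w (u : T) : pw (lw k w u) = \prod_(p <- w) letm p u.
Proof. by rewrite /pw /lw big_map. Qed.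

Lemma bmc_wntr w : bmc (wntr w).
Proof.
elim: w => [|p w _]; last first.
  by apply: (bmc_ext _ (bmc_ntr (bmcm_pw p.1 (p :: w)))) => u; rewrite pw_lw.
by apply: (bmc_ext _ (bmc_cst (ntr 1%:M))) => u; rewrite /wntr big_nil.
Qed.

Lemma letm_bdd K (p : 'I_n * M_) (u : T) : bdd K p.2 -> bdd K (letm p u).
Proof. by move=> h; apply: bdd_conj => //; exact: uval_unitary. Qed.

Lemma ntr_letm (p : 'I_n * M_) (u : T) : ntr (letm p u) = ntr p.2.
Proof. by apply: ntr_conj; exact: uval_unitary. Qed.

Lemma conj_mul2 (U A B : M_) : U \is unitarymx ->
  (U^t* *m A *m U) *m (U^t* *m B *m U) = U^t* *m (A *m B) *m U.
Proof. by move=> hU; rewrite !mulmxA mulmxtVK. Qed.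

Lemma letm_mul (k : 'I_n) (A B : M_) (u : T) :
  letm (k, A) u *m letm (k, B) u = letm (k, A *m B) u.
Proof. exact: conj_mul2 (uval_unitary u k). Qed.

Lemma letm_sub_scalar (k : 'I_n) (A : M_) c (u : T) : letm (k, A - c%:M) u = letm (k, A) u - c%:M.
Proof.
rewrite /letm /= mulmxBr mulmxBl mul_mx_scalar -scalemxAl.
by rewrite unitarymx_mul1 ?scalemx1 //; exact: uval_unitary.
Qed.

Lemma ntr1 : (0 < d)%N -> ntr (1%:M : M_) = 1.
Proof. by move=> d0; rewrite /ntr mxtrace1 divff // pnatr_eq0 -lt0n. Qed.

(** When the outer letters share a colour, cyclicity makes them adjacent and they merge into one
    letter. Recentring it leaves an alternating centred word shorter by one letter and a multiple of
    one shorter by two. *)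
Lemma wntr_wrap (k : 'I_n) (A B : M_) v u :
  wntr ((k, A) :: rcons v (k, B)) u =
  wntr ((k, B *m A - (ntr (B *m A))%:M) :: v) u + ntr (B *m A) * wntr v u.
Proof.
rewrite /wntr big_cons big_rcons /= -!mulmxE.
rewrite mulmxA ntr_mulC mulmxA letm_mul big_cons /= -?mulmxE letm_sub_scalar.
by rewrite mulmxBl ntrB mul_scalar_mx ntrZ subrK.
Qed.

Lemma alt_take w m : alt_word w -> alt_word (take m w).
Proof. by move=> h; have := h; rewrite -{1}(cat_take_drop m w) => /cat_sorted2[]. Qed.

Lemma centred_take K w m : centred K w -> centred K (take m w).
Proof. by move=> h p /mem_take; exact: h. Qed.

Lemma last_lw (k : 'I_n) (w : seq ('I_n * M_)) (u : T) : ~~ nilp w ->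
  forall p0, (last (true, 0) (lw k w u)).1 = ((last p0 w).1 == k).
Proof. by case: w => // p w _ p0; rewrite /lw /= (last_map (fun p => (p.1 == k, letm p u))). Qed.

Lemma ybound_le (K : R) N m m' : 1 <= K -> (m <= m')%N -> ybound K N m <= ybound K N m'.
Proof.
move=> K1; elim: m' => [|m' IH]; first by rewrite leqn0 => /eqP ->.
rewrite leq_eqVlt => /predU1P[->//|/IH /le_trans]; apply=> /=.
have KN : 0 <= K ^+ N by apply: exprn_ge0; exact: le_trans K1.
have := ybound_ge0 N K1 m'; lra.
Qed.

Lemma schwinger_dyson_bound (t x a b : C) (D L : R) p :
  cabs t <= D -> cabs a <= L -> cabs b <= L ->
  cabs (t * (x ^+ p * (x^*)%C ^+ p.+1) +
    (p%:R * x ^+ p.-1 * (x^*)%C ^+ p.+1 * a - p.+1%:R * (x ^+ p * (x^*)%C ^+ p) * b)) <=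
  D * cabs x ^+ (2 * p).+1 + 2 * p.+1%:R * L * (cabs x ^+ 2) ^+ p.
Proof.
move=> ht ha hb; have X0 := cabs_ge0 x; have L0 := le_trans (cabs_ge0 a) ha.
apply: le_trans (cabsD _ _) _; apply: lerD.
  rewrite !cabsM !cabsX cabs_conj -exprD addnS addnn -mul2n.
  by apply: ler_wpM2r => //; apply: exprn_ge0.
apply: le_trans (cabsB _ _) _; rewrite !cabsM !cabsX !cabs_conj !cabs_nat.
have -> : p%:R * cabs x ^+ p.-1 * cabs x ^+ p.+1 = p%:R * (cabs x ^+ 2) ^+ p.
  case: (p) => [|q]; first by rewrite !mul0r.
  by rewrite -mulrA -exprD /= -exprM mul2n -addnn addSnnS.
rewrite -exprMn -expr2; have : 0 <= (cabs x ^+ 2) ^+ p by apply/exprn_ge0/sqr_ge0.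
move: (_ ^+ p) => F F0; rewrite -!mulrA.
apply: le_trans (_ : p%:R * (F * L) + p.+1%:R * (F * L) <= _).
  by apply: lerD; apply: ler_wpM2l; rewrite ?ler0n //; apply: ler_wpM2l.
rewrite -mulrDl [leRHS]mulrA -natrM -natrD [L * F]mulrC; apply: ler_wpM2r; first exact: mulr_ge0.
by rewrite ler_nat mul2n -addnn leq_add2r leqnSn.
Qed.

(** As the last colour differs from the first, [gword_le] applies and only traces of proper initial
    segments appear; this is what makes an induction on length possible. The constant [L] covers
    both contractions with the gradient, the second of which involves its adjoint. *)
Lemma wntr_bound K N p0 (w : seq ('I_n * M_)) p u
    (f := wntr (p0 :: w)) (l := lw p0.1 (p0 :: w) u)
    (L := K ^+ N.+1 * ybound K N.+1 N.+1 + ((K ^+ N.+1) ^+ 2 + ybound K N.+1 N.+1 ^+ 2)) :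
  1 <= K -> (0 < d)%N -> (size w <= N)%N -> centred K (p0 :: w) -> ~~ nilp w ->
  (last p0 w).1 != p0.1 ->
  cabs (tword (letm p0 u) (lw p0.1 w u) * (f u ^+ p * (f u)^*%C ^+ p.+1) +
   (p%:R * f u ^+ p.-1 * (f u)^*%C ^+ p.+1 * ntr (pw l *m yword 1%:M l) -
    p.+1%:R * (f u ^+ p * (f u)^*%C ^+ p) * ntr (pw l *m (yword 1%:M l)^t*))) <=
  d%:R ^+ 2 * (2 * K ^+ N.+1 * \sum_(m < size w) cabs (wntr (take m.+1 (p0 :: w)) u)) *
      cabs (f u) ^+ (2 * p).+1 + 2 * p.+1%:R * L * (cabs (f u) ^+ 2) ^+ p.
Proof.
move=> K1 d0 sw hc w0 hl; have K0 : 0 <= K by exact: le_trans K1.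
have hp0 : bdd K p0.2 by case: (hc p0 (mem_head _ _)).
have hlw q : q \in lw p0.1 w u -> bdd K q.2.
  move=> /mapP[r rw ->]; apply: letm_bdd.
  by have [] := hc r; rewrite ?in_cons ?rw ?orbT.
have hll q : q \in l -> bdd K q.2.
  move=> /mapP[r rw ->]; apply: letm_bdd; by have [] := hc r.
have szl : size l = (size w).+1 by rewrite /l /lw size_map.
have hW : bdd (K ^+ N.+1) (pw l).
  apply: (bdd_le _ _ (bdd_pw hll)); first exact: exprn_ge0.
  by rewrite szl ler_weXn2l.
have Y0 := ybound_ge0 N.+1 K1 N.+1.
have hY : bdd (ybound K N.+1 N.+1) (yword 1%:M l).
  apply: (@bdd_le _ _ (ybound K N.+1 (size l))); first exact: ybound_ge0.
    by apply: ybound_le => //; rewrite szl.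
  apply: (@yword_bdd _ _ _ _ K1 _ _ 0) => //.
    by rewrite add0n szl.
  by rewrite expr0; exact: bdd1.
have KN0 : 0 <= K ^+ N.+1 by exact: exprn_ge0.
have h1 : cabs (ntr (pw l *m yword 1%:M l)) <= L.
  apply: le_trans (bdd_ntr _ (bddM hW hY)) _; first exact: mulr_ge0.
  by rewrite /L lerDl addr_ge0 ?sqr_ge0.
have h2 : cabs (ntr (pw l *m (yword 1%:M l)^t*)) <= L.
  by apply: le_trans (bdd_ntr_adj hW hY) _; rewrite /L lerDr mulr_ge0.
have L0 : 0 <= L by apply: le_trans h1; exact: cabs_ge0.
have ht : cabs (tword (letm p0 u) (lw p0.1 w u)) <=
    d%:R ^+ 2 * (2 * K ^+ N.+1 * \sum_(m < size w) cabs (wntr (take m.+1 (p0 :: w)) u)).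
  apply: le_trans (@tword_le _ _ K N.+1 K1 _ _ 1 _ _ hlw) _.
  - by rewrite /lw size_map add1n ltnS.
  - by rewrite expr1; exact: letm_bdd.
  apply: ler_wpM2l; first exact: sqr_ge0.
  rewrite [leRHS]mulrAC [leRHS]mulrC; apply: ler_wpM2l => //.
  have hg : gword (letm p0 u) (lw p0.1 w u) + cabs (ntr (letm p0 u)) <=
      2 * \sum_(m < size w) cabs (ntr (letm p0 u *m pw (take m (lw p0.1 w u)))).
    have := @gword_le R d (letm p0 u) (lw p0.1 w u).
    rewrite (last_lw p0.1 u w0 p0) /lw size_map; apply=> //.
    by rewrite /nilp size_map.
  have eg : \sum_(m < size w) cabs (ntr (letm p0 u *m pw (take m (lw p0.1 w u)))) =
      \sum_(m < size w) cabs (wntr (take m.+1 (p0 :: w)) u).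
    by apply: eq_bigr => m _; rewrite /lw -map_take pw_lw /wntr /= big_cons -mulmxE.
  rewrite eg in hg; apply: le_trans hg; rewrite lerDl; exact: cabs_ge0.
exact: schwinger_dyson_bound.
Qed.

End Fixed.
End MomentInduction.

(** * The moment bound, uniform in the dimension and the exponent *)

Section MomentBound.
Local Set Implicit Arguments.
Local Unset Strict Implicit.
Import Order.TTheory GRing.Theory Num.Theory.
Local Open Scope classical_set_scope.
Local Open Scope ring_scope.
Local Open Scope complex_scope.
Local Open Scope sesquilinear_scope.
Context {R : realType}.
Local Notation C := R[i].

Section Fixed.
Context {d : nat}.
Local Notation M_ := 'M[C]_d.
Local Notation G := (borel (@unitary_group R d)).
Context (gamma : probability G R).
Hypothesis haar : is_haar gamma.
Context {n : nat}.
Local Notation T := (n.-tuple G).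
Local Notation mu := (power_prob gamma n).
Implicit Types (w v : seq ('I_n * M_)).

Definition wmom w P : R := expect mu (fun u => (cabs (wntr w u) ^+ 2) ^+ P).

Lemma bm_wntr w P : bm (fun u : T => (cabs (wntr w u) ^+ 2) ^+ P).
Proof. apply: bmX; apply: bmc_abs_sq; exact: bmc_wntr. Qed.

Lemma wmom_single (p : 'I_n * M_) K P : centred K [:: p] -> (0 < P)%N -> wmom [:: p] P = 0.
Proof.
move=> hc P0; rewrite /wmom -[RHS](expect_cst mu 0); congr expect; apply/funext => u.
have [_ h] := hc p (mem_head _ _).
by rewrite /wntr big_seq1 ntr_letm h cabs0 !expr0n gtn_eqF.
Qed.

(** The factor 8 is 4 from squaring a sum of two terms, times 2 from raising a sum of two squares to
    the power [P]. *)
Lemma wmom_wrap K (k : 'I_n) (A B : M_) v P : 0 <= K -> bdd K A -> bdd K B ->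
  wmom ((k, A) :: rcons v (k, B)) P <=
  8 ^+ P * (wmom ((k, B *m A - (ntr (B *m A))%:M) :: v) P + ((K * K) ^+ 2) ^+ P * wmom v P).
Proof.
move=> K0 hA hB; set x := (k, _) :: v.
have bv : bm (fun u : T => ((K * K) ^+ 2) ^+ P * (cabs (wntr v u) ^+ 2) ^+ P).
  by apply: bmM; [exact: bm_cst | exact: bm_wntr].
have bxv := bmD (bm_wntr x P) bv.
rewrite /wmom -(expectZ mu _ (bm_wntr v P)) -(expectD mu (bm_wntr x P) bv) -(expectZ mu _ bxv).
apply: expect_le; [exact: bm_wntr | by apply: bmM; [exact: bm_cst | exact: bxv] |].
move=> u; rewrite wntr_wrap -/x.
have hc : cabs (ntr (B *m A)) <= K * K by apply: bdd_ntr (bddM hB hA); exact: mulr_ge0.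
have X0 := cabs_ge0 (wntr x u); have V0 := cabs_ge0 (wntr v u).
have K2 : 0 <= K * K by exact: mulr_ge0.
rewrite -exprMn -exprMn.
apply: le_trans (_ : (4 * (cabs (wntr x u) ^+ 2 + (K * K * cabs (wntr v u)) ^+ 2)) ^+ P <= _).
  apply: lerXn2r; rewrite ?nnegrE ?sqr_ge0 ?mulr_ge0 ?addr_ge0 ?sqr_ge0 //.
  apply: le_trans (_ : (cabs (wntr x u) + K * K * cabs (wntr v u)) ^+ 2 <= _).
    apply: lerXn2r; rewrite ?nnegrE ?cabs_ge0 ?addr_ge0 ?mulr_ge0 //.
    apply: le_trans (cabsD _ _) _; rewrite cabsM lerD2l; exact: ler_wpM2r.
  apply: le_trans (exprD_le _ _ _) _ => //; first exact: mulr_ge0.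
  by rewrite (_ : 2 ^+ 2 = 4 :> R) // -natrX.
rewrite [(4 * _) ^+ _]exprMn (_ : 8 ^+ P = 4 ^+ P * 2 ^+ P); last by rewrite -exprMn -natrM.
rewrite -[leRHS]mulrA; apply: ler_wpM2l; first exact: exprn_ge0.
apply: exprD_le; exact: sqr_ge0.
Qed.

Lemma bmc_tword (k : 'I_n) w (B : T -> M_) : bmcm B -> bmc (fun u => tword (B u) (lw k w u)).
Proof.
move=> hB; apply: (@bmc_sum _ _ _ _ _ (fun a u => \sum_b (B u *m dword (delta_mx a b) (lw k w u)) a b)) => a.
apply: (@bmc_sum _ _ _ _ _ (fun b u => (B u *m dword (delta_mx a b) (lw k w u)) a b)) => b.
by apply: bmcmM => //; exact: bmcm_dword.
Qed.

(* Young's inequality absorbs the powers of the longest word. *)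
Lemma wmom_step K N p0 w p
    (L := K ^+ N.+1 * ybound K N.+1 N.+1 + ((K ^+ N.+1) ^+ 2 + ybound K N.+1 N.+1 ^+ 2)) :
  1 <= K -> (0 < d)%N -> (size w <= N)%N -> centred K (p0 :: w) ->
  ~~ nilp w -> (last p0 w).1 != p0.1 ->
  wmom (p0 :: w) p.+1 <=
  2 * (4 ^+ (2 * p).+1 * ((2 * K ^+ N.+1) ^+ 2 * (2 ^+ N) ^+ 2) ^+ p.+1 *
         (\sum_(m < size w) wmom (take m.+1 (p0 :: w)) p.+1) +
       4 ^+ p * (2 * p.+1%:R * L / d%:R ^+ 2) ^+ p.+1).
Proof.
move=> K1 d0 sw hc w0 hl; have K0 : 0 <= K by exact: le_trans K1.
have D0 : 0 < d%:R ^+ 2 :> R by rewrite exprn_gt0 // ltr0n.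
pose f := wntr (p0 :: w); pose l (u : T) := lw p0.1 (p0 :: w) u.
pose g u : C := tword (letm p0 u) (lw p0.1 w u) * (f u ^+ p * (f u)^*%C ^+ p.+1) +
   (p%:R * f u ^+ p.-1 * (f u)^*%C ^+ p.+1 * ntr (pw (l u) *m yword 1%:M (l u)) -
    p.+1%:R * (f u ^+ p * (f u)^*%C ^+ p) * ntr (pw (l u) *m (yword 1%:M (l u))^t*)).
have SD : cexpect mu (fun u => (- (d%:R ^+ 2 * (cabs (f u) ^+ 2) ^+ p.+1))%:C + g u) = 0.
  rewrite -[RHS](schwinger_dyson haar p0.1 (p0 :: w) p); congr cexpect.
  apply/funext => u.
  have fE : ntr (pw (lw p0.1 (p0 :: w) u)) = f u by rewrite pw_lw.
  rewrite fE /g addrA; congr (_ + _).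
  (* The first letter is marked and contributes the product of its own trace with that of the rest,
     minus d times the trace of the word. It is centred, so exactly - d^2 f remains. *)
  have -> : tword 1%:M (lw p0.1 (p0 :: w) u) = - (d%:R ^+ 2 * f u) + tword (letm p0 u) (lw p0.1 w u).
    rewrite [lw _ _ _]/= tword_cons eqxx mul1mx -fE pw_cons /= (tr_ntr (letm p0 u)) ntr_letm.
    have [_ ->] := hc p0 (mem_head _ _).
    rewrite mulr0 mul0r sub0r (tr_ntr (_ *m _)) mxtrace1 mulrA -expr2.
    by congr (_ + _).
  rewrite [RHS]mulrDl; congr (_ + _).
  transitivity (- (d%:R ^+ 2 * (cabs (f u) ^+ 2) ^+ p.+1)%:C); first exact: (rmorphN (real_complex R)).
  rewrite mulNr; congr (- _).
  have -> : d%:R ^+ 2 * f u * (f u ^+ p * (f u)^*%C ^+ p.+1) = d%:R ^+ 2 * (f u * (f u)^*%C) ^+ p.+1.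
    by move: (f u) => x; rewrite exprMn [x ^+ p.+1]exprS -!mulrA.
  rewrite (cabs_sqE (f u)).
  by rewrite realcM !(realcX _ _) realc_nat.
pose S u : R := \sum_(m < size w) (cabs (wntr (take m.+1 (p0 :: w)) u) ^+ 2) ^+ p.+1.
pose c1 : R := 4 ^+ (2 * p).+1 * ((2 * K ^+ N.+1) ^+ 2 * (2 ^+ N) ^+ 2) ^+ p.+1.
pose c2 : R := 4 ^+ p * (2 * p.+1%:R * L / d%:R ^+ 2) ^+ p.+1.
have bS : bm S by apply: (@bm_sum _ _ _ _ _ (fun m u => _)) => m; exact: bm_wntr.
have bf : bmc f by exact: bmc_wntr.
have bfc : bmc (fun u => (f u)^*%C) by exact: bmc_conj.
have by1 : bmcm (fun u => yword 1%:M (l u)) by apply: bmcm_yword; exact: bmcm_cst.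
have bg : bmc g.
  apply: bmcD.
    apply: bmcM; last by apply: bmcM; exact: bmcX.
    apply: (bmc_tword p0.1 w (bmcm_letm p0)).
  apply: (@bmc_ext _ _ _ (fun u => p%:R * f u ^+ p.-1 * (f u)^*%C ^+ p.+1 * ntr (pw (l u) *m yword 1%:M (l u)) +
    (-1) * (p.+1%:R * (f u ^+ p * (f u)^*%C ^+ p) * ntr (pw (l u) *m (yword 1%:M (l u))^t*)))).
    by move=> u; rewrite mulN1r.
  apply: bmcD; last apply: bmcZ; apply: bmcM.
  - by apply: bmcM; [apply: bmcZ|]; exact: bmcX.
  - by apply: bmc_ntr; apply: bmcmM => //; exact: bmcm_pw.
  - by apply: bmcZ; apply: bmcM; exact: bmcX.
  - by apply: bmc_ntr; apply: bmcmM; [exact: bmcm_pw | exact: bmcm_adj].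
have by_ : bm (fun u => (cabs (f u) ^+ 2) ^+ p.+1) by exact: bm_wntr.
(* Young's inequality is applied once to the traces of initial segments and once to the term of
   order 1 / d^2. Each leaves a quarter of |f|^(2p+2), and the resulting half is moved to the other
   side. *)
have pt u : complex.Re (g u) <=
   d%:R ^+ 2 * (c1 * S u + c2 + 2^-1 * (cabs (f u) ^+ 2) ^+ p.+1).
  have L0 : 0 <= L.
    have Yb := ybound_ge0 N.+1 K1 N.+1; have KN : 0 <= K ^+ N.+1 by exact: exprn_ge0.
    by apply: addr_ge0; [exact: mulr_ge0 | apply: addr_ge0; exact: sqr_ge0].
  apply: le_trans (le_trans (ler_norm _) (Re_le_cabs _)) _.
  apply: le_trans (wntr_bound p u K1 d0 sw hc w0 hl) _; rewrite -/f -/L.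
  have f0 := cabs_ge0 (f u).
  set X := 2 * K ^+ N.+1 * _; set Z := 2 * p.+1%:R * L / d%:R ^+ 2.
  have X0 : 0 <= X.
    by rewrite !mulr_ge0 ?exprn_ge0 //; apply: sumr_ge0 => i _; exact: cabs_ge0.
  have Z0 : 0 <= Z by rewrite divr_ge0 ?mulr_ge0 ?ler0n // ltW.
  have -> : 2 * p.+1%:R * L = d%:R ^+ 2 * Z.
    by rewrite [RHS]mulrC /Z divfK // gt_eqF.
  rewrite -[_ * X * _]mulrA -[_ * Z * _]mulrA -mulrDr; apply: ler_wpM2l; first exact: ltW.
  have h1 := young_power (2 * p).+1 X0 f0.
  have h2 := young_power p Z0 (sqr_ge0 (cabs (f u))).
  have h3 : 4 ^+ (2 * p).+1 * X ^+ (2 * p).+2 <= c1 * S u.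
    rewrite /c1 -mulrA; apply: ler_wpM2l; first exact: exprn_ge0.
    rewrite (_ : (2 * p).+2 = (2 * p.+1)%N); last by rewrite mulnS.
    apply: le_trans (_ : ((2 * K ^+ N.+1) ^+ 2) ^+ p.+1 *
       ((\sum_(m < size w) cabs (wntr (take m.+1 (p0 :: w)) u)) ^+ 2) ^+ p.+1 <= _).
      by rewrite /X -exprMn -exprMn exprM.
    have -> : ((2 * K ^+ N.+1) ^+ 2 * (2 ^+ N) ^+ 2) ^+ p.+1 =
       ((2 * K ^+ N.+1) ^+ 2) ^+ p.+1 * ((2 ^+ N) ^+ 2) ^+ p.+1 :> R by exact: exprMn.
    rewrite -[leRHS]mulrA; apply: ler_wpM2l.
      by apply: exprn_ge0; exact: sqr_ge0.
    rewrite -!exprM; apply: le_trans (expr_sum_le _ _) _ => [i||]; [exact: cabs_ge0 | by [] |].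
    apply: ler_pM.
    - by rewrite exprn_ge0 ?exprn_ge0.
    - by apply: sumr_ge0 => i _; apply: exprn_ge0; exact: cabs_ge0.
    - by rewrite -?exprM -?mulnA ler_weXn2l ?ler1n // leq_mul2r sw orbT.
    - by apply: ler_sum => i _; rewrite -exprM.
  have h4 : cabs (f u) ^+ (2 * p).+2 = (cabs (f u) ^+ 2) ^+ p.+1.
    by rewrite -exprM mulnS.
  rewrite h4 in h1; rewrite -/Z /c2; lra.
have : expect mu (fun u => - (d%:R ^+ 2 * (cabs (f u) ^+ 2) ^+ p.+1) + complex.Re (g u)) = 0.
  by have [+ _] := SD; apply: etrans; congr expect; apply/funext => u; case: (g u).
have bDy : bm (fun u => d%:R ^+ 2 * (c1 * S u + c2 + - 2^-1 * (cabs (f u) ^+ 2) ^+ p.+1)).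
  apply: bmM; first exact: bm_cst.
  apply: bmD; last by apply: bmM; [exact: bm_cst | exact: by_].
  by apply: bmD; [apply: bmM; [exact: bm_cst | exact: bS] | exact: bm_cst].
move=> e0; have : 0 <= expect mu (fun u => d%:R ^+ 2 * (c1 * S u + c2 + - 2^-1 * (cabs (f u) ^+ 2) ^+ p.+1)).
  rewrite -e0; apply: expect_le => [|//|u].
    apply: bmD; last exact: bmc_Re.
    rewrite (_ : (fun u => _) = fun u => (- d%:R ^+ 2) * (cabs (f u) ^+ 2) ^+ p.+1).
      by apply: bmM; [exact: bm_cst | exact: by_].
    by apply/funext => u; rewrite mulNr.
  have := pt u; set y := _ ^+ p.+1; nra.
have bcS : bm (fun u => c1 * S u) by apply: bmM; [exact: bm_cst | exact: bS].
have bcy : bm (fun u => - 2^-1 * (cabs (f u) ^+ 2) ^+ p.+1).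
  by apply: bmM; [exact: bm_cst | exact: by_].
have bc2 : bm (fun _ : T => c2) by exact: bm_cst.
rewrite (expectZ mu _ (bmD (bmD bcS bc2) bcy)) (expectD mu (bmD bcS bc2) bcy).
rewrite (expectD mu bcS bc2) (expectZ mu _ bS) (expectZ mu _ by_) expect_cst.
have -> : expect mu S = \sum_(m < size w) wmom (take m.+1 (p0 :: w)) p.+1.
  exact: (@expect_sum _ _ _ mu _ _ (fun m : 'I_(size w) => _) (fun m => bm_wntr _ p.+1)).
rewrite (pmulr_rge0 _ D0) -/(wmom _ _) -/c1 -/c2 => h.
rewrite /wmom in h *; rewrite -/f in h *; lra.
Qed.
End Fixed.

Lemma wmom_ge0 (d n : nat) (gamma : probability (borel (@unitary_group R d)) R)
  (w : seq ('I_n * 'M[C]_d)) P : 0 <= wmom gamma w P.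
Proof.
rewrite /wmom -(expect_cst (power_prob gamma n) 0).
apply: expect_le; [exact: bm_cst | exact: bm_wntr | move=> u].
by apply: exprn_ge0; exact: sqr_ge0.
Qed.

(* Uniformity in [P] turns this into concentration at speed [d ^+ 2]. *)
Lemma moment_bound N K : 1 <= K -> exists2 c : R, 0 <= c &
  forall (d : nat) (gamma : probability (borel (@unitary_group R d)) R) n (w : seq ('I_n * 'M[C]_d)) P,
  is_haar gamma -> (0 < d)%N -> (0 < size w <= N)%N -> alt_word w -> centred K w -> (0 < P)%N ->
  wmom gamma w P <= (c * P%:R / d%:R ^+ 2) ^+ P.
Proof.
elim: N K => [|N IH] K K1.
  by exists 0 => // d gamma n w P _ _ /andP[w0]; rewrite leqn0 => /eqP w1; rewrite w1 in w0.
have K0 : 0 <= K by exact: le_trans K1.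
have KK1 : 1 <= 2 * (K * K + K * K).
  have : 1 <= K * K by rewrite -[1]mulr1 ler_pM.
  by lra.
(* Initial and inner segments keep the bound [K]; the merged and recentred letter needs the larger
   one. *)
have [C1 C10 h1] := IH K K1; have [C2 C20 h2] := IH _ KK1.
pose L := K ^+ N.+1 * ybound K N.+1 N.+1 + ((K ^+ N.+1) ^+ 2 + ybound K N.+1 N.+1 ^+ 2).
have L0 : 0 <= L.
  have Yb := ybound_ge0 N.+1 K1 N.+1; have KN : 0 <= K ^+ N.+1 by exact: exprn_ge0.
  by apply: addr_ge0; [exact: mulr_ge0 | apply: addr_ge0; exact: sqr_ge0].
pose c : R := (2 * K ^+ N.+1) ^+ 2 * (2 ^+ N) ^+ 2.
have c0 : 0 <= c by apply: mulr_ge0; exact: sqr_ge0.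
(* [A1] and [A2] come from the two terms of [wmom_step], [A3] and [A4] from the two terms of
   [wmom_wrap]. In either case two [P]-th powers are merged into one by superadditivity. *)
pose A1 := 16 * c * N.+1%:R * C1; pose A2 := 8 * L; pose A3 := 8 * C2; pose A4 := 8 * ((K * K) ^+ 2 * C1).
have A10 : 0 <= A1 by do 3?apply: mulr_ge0 => //; rewrite ler0n.
have A20 : 0 <= A2 by apply: mulr_ge0.
have A30 : 0 <= A3 by apply: mulr_ge0.
have A40 : 0 <= A4 by apply: mulr_ge0 => //; apply: mulr_ge0 => //; exact: sqr_ge0.
exists (A1 + A2 + (A3 + A4)) => [|d gamma n [//|p0 w] P haar d0 /andP[_ sw] aw cw P0]; first by rewrite !addr_ge0.
pose r : R := P%:R / d%:R ^+ 2; have r0 : 0 <= r by rewrite divr_ge0 ?ler0n ?sqr_ge0.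
have final a b : 0 <= a -> 0 <= b -> a + b <= A1 + A2 + (A3 + A4) ->
    (a * r) ^+ P + (b * r) ^+ P <= ((A1 + A2 + (A3 + A4)) * P%:R / d%:R ^+ 2) ^+ P.
  move=> a0 b0 ab; apply: le_trans (addXn_le _ _ P0) _; rewrite ?mulr_ge0 //.
  rewrite -mulrA -/r -mulrDl; apply: lerXn2r; rewrite ?nnegrE ?mulr_ge0 ?addr_ge0 //.
  exact: ler_wpM2r.
have [w0|w0] := boolP (nilp w).
  rewrite (nilP w0) in cw *; rewrite (wmom_single _ cw P0).
  by apply: exprn_ge0; rewrite divr_ge0 ?sqr_ge0 ?mulr_ge0 ?addr_ge0.
have [hl|hl] := eqVneq (last p0 w).1 p0.1.
  case/lastP: w sw aw cw w0 hl => [//|v [k B]] sw aw cw _; rewrite last_rcons /= => ek.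
  case: p0 sw aw cw ek => k0 A /= sw aw cw ek; subst k0.
  have hA : bdd K A by have [] := cw _ (mem_head _ _).
  have hB : bdd K B by have [] := cw (k, B); rewrite ?in_cons ?mem_rcons ?mem_head ?orbT.
  (* With nothing in between, the outer letters would be adjacent and of equal colour, against
     alternation. *)
  have v0 : (0 < size v)%N.
    by case: v aw {sw cw} => //=; rewrite /alt_word /= eqxx.
  have sv : ((size v).+1 <= N)%N by rewrite size_rcons in sw.
  set Cm := B *m A - (ntr (B *m A))%:M; pose x := (k, Cm) :: v.
  have hBA : bdd (K * K) (B *m A) by exact: bddM.
  have ax : alt_word x.
    move: aw; rewrite /alt_word /= rcons_path => /andP[+ _].
    by rewrite /x; case: (v).
  have av : alt_word v by move: ax; rewrite /alt_word /x /=; exact: path_sorted.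
  have cv_ p : p \in v -> bdd K p.2 /\ ntr p.2 = 0.
    by move=> pv; apply: cw; rewrite in_cons mem_rcons in_cons pv !orbT.
  have cx : centred (2 * (K * K + K * K)) x.
    have KKK : K <= 2 * (K * K + K * K).
      have : K <= K * K by rewrite -[leLHS]mulr1 ler_wpM2l.
      by lra.
    move=> p; rewrite in_cons => /predU1P[->|/cv_[hb ht]]; last by split=> //; exact: bdd_le hb.
    rewrite /=; split; last by rewrite /Cm ntrB -scalemx1 ntrZ ntr1 // mulr1 subrr.
    apply: bddD; [exact: mulr_ge0 | exact: mulr_ge0 | exact: hBA | apply: bddN].
    apply: (@bdd_le _ _ (cabs (ntr (B *m A)) * 1)); first by rewrite mulr1 cabs_ge0.
      by rewrite mulr1; apply: bdd_ntr => //; exact: mulr_ge0.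
    by rewrite -scalemx1; apply: bddZ; exact: bdd1.
  have hx := h2 _ gamma _ x P haar d0 sv ax cx P0.
  have hv : wmom gamma v P <= (C1 * P%:R / d%:R ^+ 2) ^+ P by apply: h1 => //; rewrite v0 ltnW.
  apply: le_trans (wmom_wrap _ _ _ _ K0 hA hB) _; rewrite -/Cm -/x.
  apply: le_trans (final A3 A4 A30 A40 _); last by rewrite lerDr addr_ge0.
  have e3 : (A3 * r) ^+ P = 8 ^+ P * (C2 * r) ^+ P by rewrite /A3 -[8 * _ * r]mulrA exprMn.
  have e4 : (A4 * r) ^+ P = 8 ^+ P * (((K * K) ^+ 2) ^+ P * (C1 * r) ^+ P).
    by rewrite /A4 -[8 * _ * r]mulrA exprMn -[_ * C1 * r]mulrA exprMn.
  rewrite e3 e4 -mulrDr; apply: ler_wpM2l; first exact: exprn_ge0.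
  rewrite -mulrA -/r in hx; rewrite -mulrA -/r in hv.
  by apply: lerD => //; apply: ler_wpM2l => //; apply: exprn_ge0; exact: sqr_ge0.
case: P P0 @r r0 final => // p _ r r0 final.
have sm (m : 'I_(size w)) : wmom gamma (take m.+1 (p0 :: w)) p.+1 <= (C1 * r) ^+ p.+1.
  rewrite /r mulrA; apply: h1 => //.
  - by rewrite /= size_take ltn_ord (leq_trans (ltn_ord m) sw).
  - exact: (alt_take m.+1 aw).
  - exact: centred_take.
have st := @wmom_step d gamma haar _ K N p0 w p K1 d0 sw cw w0 hl.
apply: (le_trans st).
apply: le_trans (final A1 A2 A10 A20 _); last by rewrite lerDl addr_ge0.
have q0 : 0 <= (C1 * r) ^+ p.+1 by apply: exprn_ge0; exact: mulr_ge0.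
have hS : \sum_(m < size w) wmom gamma (take m.+1 (p0 :: w)) p.+1 <= N.+1%:R ^+ p.+1 * (C1 * r) ^+ p.+1.
  apply: le_trans (_ : \sum_(m < size w) (C1 * r) ^+ p.+1 <= _); first exact: ler_sum.
  rewrite sumr_const card_ord -[leLHS]mulr_natl; apply: ler_wpM2r => //.
  apply: le_trans (_ : N.+1%:R <= _); first by rewrite ler_nat leqW.
  by rewrite -[leLHS]expr1 ler_weXn2l // ler1n.
rewrite mulrDr; apply: lerD.
  have -> : (A1 * r) ^+ p.+1 = 16 ^+ p.+1 * (c ^+ p.+1 * (N.+1%:R ^+ p.+1 * (C1 * r) ^+ p.+1)).
    by rewrite -[N.+1%:R ^+ _ * _]exprMn -[c ^+ _ * _]exprMn -exprMn /A1 !mulrA.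
  rewrite -/c -[4 ^+ _ * _ * _]mulrA mulrA; apply: ler_pM.
  - by rewrite mulr_ge0 ?exprn_ge0.
  - by apply: mulr_ge0; [exact: exprn_ge0 | apply: sumr_ge0 => i _; exact: wmom_ge0].
  - rewrite exprS exprM (_ : 4 ^+ 2 = 16 :> R); last by rewrite -natrX.
    by rewrite mulrA exprS; apply: ler_wpM2r; [exact: exprn_ge0 | lra].
  - by apply: ler_wpM2l => //; exact: exprn_ge0.
have -> : A2 * r = 4 * (2 * p.+1%:R * L / d%:R ^+ 2) by rewrite /A2 /r; ring.
rewrite [(4 * _) ^+ _]exprMn mulrA; apply: ler_wpM2r.
  by apply: exprn_ge0; rewrite divr_ge0 ?sqr_ge0 // !mulr_ge0 ?ler0n.
by rewrite exprS; apply: ler_wpM2r; [exact: exprn_ge0 | lra].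
Qed.

End MomentBound.
(** * Microstates *)

Section MicrostateWords.
Local Set Implicit Arguments.
Local Unset Strict Implicit.
Import Order.TTheory GRing.Theory Num.Theory.
Local Open Scope classical_set_scope.
Local Open Scope ring_scope.
Local Open Scope complex_scope.
Local Open Scope sesquilinear_scope.
Context {R : realType} {A : cstar_algebra R} (phi : {scalar A}).
Local Notation C := R[i].

Section Generic.
Context {I J : Type} (X : I -> A) (Y : J -> A).

Definition isr (c : I + J) : bool := if c is inr _ then true else false.
Definition gvar (c : I + J) : A := match c with inl i => X i | inr j => Y j end.
Definition gphi (w : seq (I + J)) : C := phi (\prod_(c <- lr isr w) gvar c).
Definition gmat d (z : @herm_space R I J d) (c : I + J) : 'M[C]_d :=
  match c with inl i => set_val (z.1 i) | inr j => set_val (z.2 j) end.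

Lemma gmat_herm d (z : @herm_space R I J d) c : gmat z c \is hermsymmx.
Proof. by case: c => i; [exact: (set_valP (z.1 i)) | exact: (set_valP (z.2 i))]. Qed.

Lemma lr_word (s : seq I) (t : seq J) :
  lr isr ([seq inl i | i <- s] ++ [seq inr j | j <- t]) = [seq inl i | i <- s] ++ [seq inr j | j <- rev t].
Proof.
rewrite /lr !filter_cat !filter_map.
rewrite (@eq_filter _ (preim inl _) predT) // filter_predT.
rewrite (@eq_filter _ (preim inr _) pred0) // filter_pred0 cats0.
rewrite (@eq_filter _ (preim inl _) pred0) // filter_pred0.
rewrite (@eq_filter _ (preim inr _) predT) // filter_predT /=.
by rewrite -map_rev.
Qed.

Lemma valid_word w : valid isr w -> exists s t, w = [seq inl i | i <- s] ++ [seq inr j | j <- t].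
Proof.
elim: w => [|[i|j] w IH] vw; first by exists [::], [::].
  have [s [t ->]] := IH (@valid_catr _ _ [:: _] _ vw).
  by exists (i :: s), t.
have [s [t ew]] := IH (@valid_catr _ _ [:: _] _ vw).
have : all isr w by apply: (@all_isr_path _ isr (inr j)).
case: s ew => [->|i s -> //] _; exact: (ex_intro _ [::] (ex_intro _ (j :: t) erefl)).
Qed.

Lemma word_valid s t : valid isr ([seq inl i | i <- s] ++ [seq inr j | j <- t]).
Proof.
apply: valid_cat_left; first by elim: s.
by apply: valid_right; elim: t.
Qed.

Lemma gphi_word s t : gphi ([seq inl i | i <- s] ++ [seq inr j | j <- rev t]) =
  phi ((\prod_(i <- s) X i) * \prod_(j <- t) Y j).
Proof. by rewrite /gphi lr_word revK big_cat !big_map. Qed.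

Definition moments_close (M d : nat) (eps : R) (a : I + J -> 'M[C]_d) : Prop :=
  forall w, valid isr w -> (0 < size w <= M)%N -> cabs (gphi w - ntr (\prod_(c <- w) a c)) < eps.

(** The reversal in [microstates] disappears: a word lists its right letters in the order in which
    the matrices multiply, and [lr] restores the order of the operators. *)
Lemma microstatesP rho M d eps (z : herm_space I J d) : 0 <= rho ->
  microstates phi X Y rho M d eps z <->
  (forall c, bdd rho (gmat z c)) /\ moments_close M eps (gmat z).
Proof.
move=> rho0; split=> [[hX hY h]|[hb h]]; split.
- by case=> i; apply/opnorm_bdd => //; [exact: hX | exact: hY].
- move=> w /valid_word[s [t ->]]; rewrite size_cat !size_map => hs.
  have := h s (rev t); rewrite size_rev => /(_ hs).
  by rewrite revK -gphi_word revK big_cat !big_map cabsE ltcR.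
- by move=> i; apply/opnorm_bdd => //; exact: (hb (inl i)).
- by move=> j; apply/opnorm_bdd => //; exact: (hb (inr j)).
move=> s t hs; rewrite cabsE ltcR -gphi_word.
have := h _ (word_valid s (rev t)); rewrite size_cat !size_map size_rev => /(_ hs).
by rewrite big_cat !big_map.
Qed.

Lemma moments_close_le M M' d (eps eps' : R) (a : I + J -> 'M[C]_d) : (M <= M')%N -> eps' <= eps ->
  moments_close M' eps' a -> moments_close M eps a.
Proof.
move=> MM ee h w vw /andP[w0 wM]; apply: lt_le_trans ee; apply: h => //.
by rewrite w0 (leq_trans wM).
Qed.

End Generic.

Context {ell : nat} {n m : 'I_ell -> nat}.
Context (X : forall k, 'I_(n k) -> A) (Y : forall k, 'I_(m k) -> A).
Local Notation lttr := (lttr (n := n) (m := m)).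
Local Notation XX := (all_vars X).
Local Notation YY := (all_vars Y).

Definition emb k (c : 'I_(n k) + 'I_(m k)) : lttr :=
  match c with
  | inl i => inl (Tagged (fun k => 'I_(n k)) i)
  | inr j => inr (Tagged (fun k => 'I_(m k)) j)
  end.

Definition restrict d (z : @herm_space R (indices n) (indices m) d) k :
    @herm_space R 'I_(n k) 'I_(m k) d :=
  (fun i => z.1 (Tagged (fun k => 'I_(n k)) i), fun j => z.2 (Tagged (fun k => 'I_(m k)) j)).

Definition assemble d (z : forall k, @herm_space R 'I_(n k) 'I_(m k) d) :
    @herm_space R (indices n) (indices m) d :=
  (fun i => (z (tag i)).1 (tagged i), fun j => (z (tag j)).2 (tagged j)).

Lemma gmat_restrict d (z : herm_space (indices n) (indices m) d) k c :
  gmat (restrict z k) c = gmat z (emb c).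
Proof. by case: c. Qed.

Lemma restrict_assemble d (z : forall k, @herm_space R 'I_(n k) 'I_(m k) d) k :
  restrict (assemble z) k = z k.
Proof. exact: (esym (surjective_pairing (z k))). Qed.

Lemma emb_surj (c : lttr) : exists c' : 'I_(n (lcol c)) + 'I_(m (lcol c)), c = emb c'.
Proof. by case: c => [[k i]|[k j]]; [exists (inl i) | exists (inr j)]. Qed.

Lemma mono_word k (w : seq lttr) : mono (@lcol _ n m) k w -> exists w', w = map (@emb k) w'.
Proof.
elim: w => [|c w IH] /=; first by exists [::].
move=> /andP[/eqP ck /IH[w' ->]]; have [c' ->] := emb_surj c.
by move: c'; rewrite ck => c'; exists (c' :: w').
Qed.

Lemma isr_emb k (c : 'I_(n k) + 'I_(m k)) : isr (emb c) = isr c.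
Proof. by case: c. Qed.

Lemma valid_emb k (w : seq ('I_(n k) + 'I_(m k))) : valid isr (map (@emb k) w) = valid isr w.
Proof. by rewrite /valid sorted_map; congr sorted; apply/funext => x; apply/funext => y /=; rewrite !isr_emb. Qed.

Lemma gphi_emb k (w : seq ('I_(n k) + 'I_(m k))) :
  gphi XX YY (map (@emb k) w) = gphi (@X k) (@Y k) w.
Proof.
rewrite /gphi /lr !filter_map -map_rev -map_cat big_map.
rewrite (@eq_filter _ (preim _ _) (fun c => ~~ isr c)); last by move=> c; rewrite /= isr_emb.
rewrite (@eq_filter _ (preim _ isr) isr); last by move=> c; rewrite /= isr_emb.
by congr (phi _); apply: eq_bigr; case.
Qed.

Section Orbit.
Context {d : nat}.
Local Notation M_ := 'M[C]_d.
Local Notation G := (borel (@unitary_group R d)).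
Local Notation T := (ell.-tuple G).
Implicit Types (a : lttr -> M_) (u : T).

Definition conjl a u (c : lttr) : M_ := letm (lcol c, a c) u.
Definition omom a u (w : seq lttr) : C := ntr (\prod_(c <- w) conjl a u c).

Lemma gmat_orb_map u (z : herm_space (indices n) (indices m) d) c :
  gmat (orb_map (u : ell.-tuple (unitary_group d), z)) c = conjl (gmat z) u c.
Proof. by case: c. Qed.

Lemma letm1 (k : 'I_ell) u : letm (k, 1%:M) u = 1%:M.
Proof. by rewrite /letm /= mulmx1 unitarymx_mul1 //; exact: uval_unitary. Qed.

Lemma prod_conjl_mono a u k w : mono (@lcol _ n m) k w ->
  \prod_(c <- w) conjl a u c = letm (k, \prod_(c <- w) a c) u.
Proof.
elim: w => [|c w IH] /=; first by rewrite !big_nil letm1.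
by move=> /andP[/eqP ck /IH {}IH]; rewrite !big_cons IH -!mulmxE -letm_mul /conjl ck.
Qed.

Lemma omom_mono a u k w : mono (@lcol _ n m) k w -> omom a u w = ntr (\prod_(c <- w) a c).
Proof. by move=> h; rewrite /omom (prod_conjl_mono a u h) ntr_letm. Qed.

Definition cblocks a (bs : seq ('I_ell * seq lttr)) : seq ('I_ell * M_) :=
  [seq (b.1, \prod_(c <- b.2) a c - (ntr (\prod_(c <- b.2) a c))%:M) | b <- bs].

(** A block of one colour is rotated by a single unitary, so it is one rotated matrix whose trace
    ignores the rotation. A centred product of blocks is thus an alternating word in fixed centred
    matrices. *)
Lemma cent_omom a u acc bs : all (fun b => mono (@lcol _ n m) b.1 b.2) bs ->
  cent (omom a u) acc bs =
  ntr ((\prod_(c <- acc) conjl a u c) *m \prod_(p <- cblocks a bs) letm p u).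
Proof.
elim: bs acc => [|b bs IH] acc /=.
  by move=> _; rewrite [X in _ *m X]big_nil; congr ntr; exact: esym (mulmx1 _).
move=> /andP[hb hbs]; rewrite !IH // big_cat /= big_cons -!mulmxE.
rewrite letm_sub_scalar (prod_conjl_mono a u hb) (omom_mono a u hb).
rewrite -ntrZ -ntrB; congr ntr.
by rewrite [in RHS]mulmxBl [in RHS]mulmxBr mul_scalar_mx -[in RHS]scalemxAr mulmxA.
Qed.

Lemma cent_wntr a u bs : wf_blocks (@lcol _ n m) bs -> cent (omom a u) [::] bs = wntr (cblocks a bs) u.
Proof.
move=> /andP[h _]; rewrite cent_omom; last by apply: sub_all h => b /andP[].
by rewrite big_nil; congr ntr; exact: mul1mx.
Qed.

Lemma alt_cblocks a bs : wf_blocks (@lcol _ n m) bs -> alt_word (cblocks a bs).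
Proof. by move=> /andP[_]; rewrite /alt_word /cblocks sorted_map. Qed.

Lemma centred_cblocks K N a bs : (0 < d)%N -> 1 <= K -> (forall c, bdd K (a c)) ->
  (size (flat bs) <= N)%N -> centred (2 * (K ^+ N + K ^+ N)) (cblocks a bs).
Proof.
move=> d0 K1 ha sN p /mapP[b bbs ->] /=; have K0 : 0 <= K by exact: le_trans K1.
have KN : 0 <= K ^+ N by exact: exprn_ge0.
have hb : bdd (K ^+ N) (\prod_(c <- b.2) a c).
  apply: (bdd_le _ _ (bdd_prod b.2 ha)); first exact: exprn_ge0.
  apply: ler_weXn2l => //; apply: leq_trans sN.
  elim: bs bbs => //= b' bs IH; rewrite in_cons /flat /= size_cat => /predU1P[->|/IH h].
    by rewrite leq_addr.
  by apply: leq_trans h _; rewrite leq_addl.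
split; last by rewrite ntrB -scalemx1 ntrZ ntr1 // mulr1 subrr.
apply: bddD => //; apply: bddN.
apply: (@bdd_le _ _ (cabs (ntr (\prod_(c <- b.2) a c)) * 1)); first by rewrite mulr1 cabs_ge0.
  by rewrite mulr1; exact: bdd_ntr.
by rewrite -scalemx1; apply: bddZ; exact: bdd1.
Qed.

End Orbit.
End MicrostateWords.

(** * Concentration of centred words *)

Section Concentration.
Local Set Implicit Arguments.
Local Unset Strict Implicit.
Import Order.TTheory GRing.Theory Num.Theory.
Local Open Scope classical_set_scope.
Local Open Scope ring_scope.
Local Open Scope complex_scope.
Context {R : realType} {ell : nat} {n m : 'I_ell -> nat}.
Local Notation C := R[i].
Local Notation lttr := (lttr (n := n) (m := m)).

(** Markov's inequality for the moment of order 2P. The constant depends on [K] and [bs] only, so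
    that [P] may be chosen afterwards, even in terms of the dimension. *)
Lemma concentration (K : R) (bs : seq ('I_ell * seq lttr)) :
  1 <= K -> wf_blocks (@lcol _ n m) bs -> (0 < size bs)%N ->
  exists2 c : R, 0 <= c &
  forall d (gamma : probability (borel (@unitary_group R d)) R) (a : lttr -> 'M[C]_d) P delta,
    is_haar gamma -> (0 < d)%N -> (forall x, bdd K (a x)) -> (0 < P)%N -> 0 < delta ->
    (power_prob gamma ell [set u | delta <= cabs (cent (omom a u) [::] bs)]%R <=
     ((c * P%:R / (d%:R ^+ 2 * delta ^+ 2)) ^+ P)%:E)%E.
Proof.
move=> K1 wbs sbs; set N := size (flat bs).
have K21 : 1 <= 2 * (K ^+ N + K ^+ N).
  by have := exprn_ege1 N K1; lra.
have [c c0 hc] := moment_bound (size bs) K21; exists c => // d gamma a P delta haar d0 ha P0 de0.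
have De0 : 0 < (delta ^+ 2) ^+ P by rewrite !exprn_gt0.
rewrite (_ : [set u | _] = [set u | (delta ^+ 2) ^+ P <= (cabs (wntr (cblocks a bs) u) ^+ 2) ^+ P]%R); last first.
  apply/seteqP; split=> u /=; rewrite (cent_wntr a u wbs) -!exprM.
    by move=> h; apply: lerXn2r => //; rewrite nnegrE ?cabs_ge0 // ltW.
  by rewrite ler_pXn2r ?nnegrE ?cabs_ge0 ?muln_gt0 // ltW.
have ge0 (u : ell.-tuple (borel (@unitary_group R d))) : 0 <= (cabs (wntr (cblocks a bs) u) ^+ 2) ^+ P.
  by apply: exprn_ge0; exact: sqr_ge0.
apply: (le_trans (expect_markov (power_prob gamma ell) (bm_wntr (cblocks a bs) P) ge0 De0)).
rewrite lee_fin ler_pdivrMr // -exprMn.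
have -> : c * P%:R / (d%:R ^+ 2 * delta ^+ 2) * delta ^+ 2 = c * P%:R / d%:R ^+ 2.
  by rewrite invfM [c * _ * (_ * _)]mulrA -[LHS]mulrA mulVf ?mulr1 // gt_eqF // exprn_gt0.
apply: hc => //; last exact: (centred_cblocks d0 K1 ha (leqnn _)).
  by rewrite size_map sbs leqnn.
exact: alt_cblocks.
Qed.

Lemma measurable_cent d (a : lttr -> 'M[C]_d) (bs : seq ('I_ell * seq lttr)) (delta : R) :
  wf_blocks (@lcol _ n m) bs ->
  measurable [set u : ell.-tuple (borel (@unitary_group R d)) | cabs (cent (omom a u) [::] bs) < delta].
Proof.
move=> wbs; have [h _] := @bmc_wntr R d ell (cblocks a bs).
have := measurable_cabs_lt delta h; congr measurable; apply/seteqP.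
by split=> u /=; rewrite (cent_wntr a u wbs).
Qed.
End Concentration.

(** * Sections of product sets *)

Section Sections.
Local Set Implicit Arguments.
Local Unset Strict Implicit.
Import Order.TTheory GRing.Theory Num.Theory.
Import numFieldNormedType.Exports.
Local Open Scope classical_set_scope.
Local Open Scope ring_scope.
Local Open Scope ereal_scope.
Context {R : realType} {d1 d2 : measure_display} {T1 : measurableType d1} {T2 : measurableType d2}.
Context (P : probability T1 R).

Lemma product_dirac (z : T2) (S : set (T1 * T2)) : measurable S ->
  (P \x dirac z) S = P (ysection S z).
Proof.
move=> mS; rewrite /product_measure1.
rewrite (eq_integral (fun u => (\1_(ysection S z) u)%:E)).
  by rewrite integral_indic // ?setIT //; exact: measurable_ysection.
by move=> u _; rewrite /= diracE indicE /= mem_ysection mem_xsection.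
Qed.

(** The product measure is the average of the measures of the sections over [mu], so some section is
    at least as large. This replaces an arbitrary measure by fixed matrices. *)
Lemma product_point (mu : probability T2 R) (S : set (T1 * T2)) (e : R) : measurable S -> (0 <= e)%R ->
  e%:E < (P \x mu) S -> exists z, e%:E < P (ysection S z).
Proof.
move=> mS e0; have h12 : (P \x mu) S = (P \x^ mu)%E S.
  by apply: product_measure_unique => // A B mA mB; exact: product_measure2E.
rewrite h12 => h; apply: contrapT => hz; move: h; apply/negP; rewrite -leNgt.
apply: (@le_trans _ _ (\int[mu]_z e%:E)).
  apply: ge0_le_integral => //.
  - exact: measurable_fun_ysection.
  - by move=> z _; rewrite leNgt; apply/negP => h; apply: hz; exists z.
rewrite integral_cst // [X in _ * X](_ : _ = 1); last exact: probability_setT.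
by rewrite mule1.
Qed.
End Sections.

(** * Measurability of the microstate condition and regularity of Dirac measures *)

Section Measurability.
Local Set Implicit Arguments.
Local Unset Strict Implicit.
Import Order.TTheory GRing.Theory Num.Theory.
Import numFieldNormedType.Exports.
Local Open Scope classical_set_scope.
Local Open Scope ring_scope.
Local Open Scope complex_scope.
Local Open Scope sesquilinear_scope.
Context {R : realType}.
Local Notation C := R[i].

Lemma continuous_rsum (T : topologicalType) (I : Type) (r : seq I) (F : I -> T -> R) :
  (forall i, continuous (F i)) -> continuous (fun x => \sum_(i <- r) F i x).
Proof.
move=> h; elim: r => [|i r IH] x.
  rewrite (_ : (fun x => _) = fun=> 0); first exact: cvg_cst.
  by apply/funext => y; rewrite big_nil.
rewrite (_ : (fun x => _) = fun x => F i x + \sum_(j <- r) F j x).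
  exact: cvgD (h i x) (IH x).
by apply/funext => y; rewrite big_cons.
Qed.

Lemma continuous_sqD (T : topologicalType) (f g : T -> R) : continuous f -> continuous g ->
  continuous (fun x => f x * f x + g x * g x).
Proof.
move=> cf cg x; have h (k : T -> R) : continuous k -> {for x, continuous (fun x => k x * k x)}.
  by move=> ck; refine (@cvgM R T (nbhs x) _ k k _ _ (ck x) (ck x)).
exact: cvgD (h f cf) (h g cg).
Qed.

Section Herm.
Context {I J : eqType} {d : nat}.
Local Notation H := (@herm_space R I J d).

Lemma gmat_continuous (c : I + J) i j : continuous (fun z : H => gmat z c i j).
Proof.
have h : continuous (fun z : H => gmat z c).
  case: c => k z; apply: (@continuous_comp _ _ _ _ (fun M : @herm_mx R d => set_val M : 'M[C]_d));
    try exact: herm_val_continuous.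
    apply: (@continuous_comp _ _ _ (fun z : H => z.1) (fun f : {ptws I -> @herm_mx R d} => f k)).
      exact: cvg_fst.
    exact: (@proj_continuous I (fun=> @herm_mx R d) k).
  apply: (@continuous_comp _ _ _ (fun z : H => z.2) (fun f : {ptws J -> @herm_mx R d} => f k)).
    exact: cvg_snd.
  exact: (@proj_continuous J (fun=> @herm_mx R d) k).
move=> z; apply: (@continuous_comp _ _ _ (fun z : H => gmat z c) (fun M : 'M[C]_d => M i j)); first exact: h.
exact: mx_entry_continuous.
Qed.

Lemma gmat_inj (z z' : H) : (forall c, gmat z c = gmat z' c) -> z = z'.
Proof.
case: z z' => [a b] [a' b'] h; congr pair; apply/funext => i.
  by apply/val_inj; exact: (h (inl i)).
by apply/val_inj; exact: (h (inr i)).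
Qed.

Lemma closed_preimage_le (g : H -> R) (K : R) : continuous g -> closed [set z | g z <= K].
Proof.
by move=> cg; apply: (@preimage_closed _ _ g [set x | x <= K]) => [z _|]; [exact: cg | exact: closed_le].
Qed.

Lemma gmat_part_continuous (g : C -> R) c i j : (forall x y, `|g x - g y| <= cabs (x - y)) ->
  continuous (fun z : H => g (gmat z c i j)).
Proof. by move=> hg; apply: (continuous_complex_part hg); exact: gmat_continuous. Qed.

Lemma closed_point (z : H) : closed [set z].
Proof.
have -> : [set z] = \bigcap_(c in setT) \bigcap_(i in setT) \bigcap_(j in setT)
    ([set z' : H | complex.Re (gmat z' c i j) = complex.Re (gmat z c i j)] `&`
     [set z' : H | complex.Im (gmat z' c i j) = complex.Im (gmat z c i j)]).
  apply/seteqP; split=> [z' -> //|z' h]; apply: gmat_inj => c.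
  apply/matrixP => i j; have [h1 h2] := h c Logic.I i Logic.I j Logic.I; move: h1 h2 => /=.
  by case: (gmat z' c i j) (gmat z c i j) => x y [x' y'] /= -> ->.
apply: closed_bigI => c _; apply: closed_bigI => i _; apply: closed_bigI => j _.
apply: closedI.
  apply: (@preimage_closed _ _ (fun z' : H => complex.Re (gmat z' c i j)) [set x | x = _]) => [x _|].
    apply: gmat_part_continuous. exact: Re_dist.
  exact: closed_eq.
apply: (@preimage_closed _ _ (fun z' : H => complex.Im (gmat z' c i j)) [set x | x = _]) => [x _|].
  apply: gmat_part_continuous. exact: Im_dist.
exact: closed_eq.
Qed.

Lemma dirac_regular (z : H) :
  regular_measure (dirac (z : borel H) : probability (borel H) R).
Proof.
have dE (S : set (borel H)) :
    (dirac (z : borel H) : probability (borel H) R) S = (((z : borel H) \in S)%:R)%:E by exact: diracE.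
move=> B mB; rewrite dE; split.
  apply/eqP; rewrite eq_le; apply/andP; split.
    apply: le_ereal_inf_tmp => _ [U [oU BU] <-]; rewrite dE.
    by case: (boolP (z \in B)) => zB; rewrite ?lee_fin ?ler0n // (mem_set (BU _ (set_mem zB))).
  have [zB|zB] := boolP (z \in B).
    apply: ereal_inf_lbound; exists setT; last by rewrite dE mem_set.
    by split => //; exact: openT.
  apply: ereal_inf_lbound; exists (~` [set z]).
    split; first by rewrite openC; exact: closed_point.
    by move=> x Bx /= xz; move: zB; rewrite -xz (mem_set Bx).
  by rewrite dE memNset //= => -[]; exact.
apply/eqP; rewrite eq_le; apply/andP; split.
  have [zB|zB] := boolP (z \in B).
    apply: ereal_sup_ubound; exists [set z]; last by rewrite dE mem_set.
    by split; [exact: compact_set1 | move=> x ->; exact: set_mem].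
  apply: ereal_sup_ubound; exists set0; last by rewrite dE memNset.
  by split; [exact: compact0 | exact: sub0set].
apply: ge_ereal_sup => _ [K [cK KB] <-]; rewrite dE lee_fin ler_nat.
by case: (boolP (z \in K)) => // zK; rewrite (mem_set (KB _ (set_mem zK))).
Qed.

Lemma closed_bdd K c : closed [set z : H | bdd K (gmat z c)].
Proof.
have -> : [set z : H | bdd K (gmat z c)] =
    \bigcap_(v in setT) [set z : H | l2sq (gmat z c *m v) <= K ^+ 2 * l2sq v].
  by apply/seteqP; split=> [z h v _|z h v]; exact: h.
apply: closed_bigI => v _; apply: closed_preimage_le.
have ce i : continuous (fun z : H => (gmat z c *m v) i 0).
  have -> : (fun z : H => (gmat z c *m v) i 0) = (fun z : H => \sum_k gmat z c i k * v k 0).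
    by apply/funext => z; rewrite mxE.
  apply: continuous_csum => k z.
  refine (@cvgM R[i] H (nbhs z) _ _ _ _ _ _ (cvg_cst _)); exact: gmat_continuous.
have -> : (fun z : H => l2sq (gmat z c *m v)) = (fun z : H =>
    \sum_i (complex.Re ((gmat z c *m v) i 0) * complex.Re ((gmat z c *m v) i 0) +
            complex.Im ((gmat z c *m v) i 0) * complex.Im ((gmat z c *m v) i 0))).
  by apply/funext => z; apply: eq_bigr => i _; rewrite cabs_sq !expr2.
apply: continuous_rsum => i.
have h1 : continuous (fun z : H => complex.Re ((gmat z c *m v) i 0)).
  exact: continuous_complex_part (@Re_dist R) (ce i).
have h2 : continuous (fun z : H => complex.Im ((gmat z c *m v) i 0)).
  exact: continuous_complex_part (@Im_dist R) (ce i).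
exact: (@continuous_sqD H _ _ h1 h2).
Qed.
End Herm.

Lemma bdd_letm_inv d ell K (p : 'I_ell * 'M[C]_d) (u : ell.-tuple (borel (@unitary_group R d))) :
  bdd K (letm p u) -> bdd K p.2.
Proof.
have hU := uval_unitary u p.1; move=> /(bdd_conjV hU); congr bdd.
have e1 : uval u p.1 *m (uval u p.1)^t* = 1%:M by exact/unitarymxP.
by rewrite /letm !mulmxA e1 mul1mx -mulmxA e1 mulmx1.
Qed.

(** Measurability is needed for the product sigma-algebra, not for the Borel sets of the product.
    The norm condition is invariant under rotation, hence a closed condition on the matrices alone;
    the others are countably many conditions, one per word, on polynomials in measurable entries. *)
Lemma measurable_orb_map {A : cstar_algebra R} (phi : {scalar A}) ell (n m : 'I_ell -> nat)
    (X : forall k, 'I_(n k) -> A) (Y : forall k, 'I_(m k) -> A) rho M d eps : 0 <= rho ->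
  measurable ((@orb_map R ell n m d @^-1` microstates phi (all_vars X) (all_vars Y) rho M d eps) :
    set (ell.-tuple (borel (@unitary_group R d)) * borel (@herm_space R (indices n) (indices m) d))).
Proof.
move=> rho0; pose H := borel (@herm_space R (indices n) (indices m) d).
pose T := (ell.-tuple (borel (@unitary_group R d)))%type.
pose S (w : seq (indices n + indices m)) : set (T * H) :=
  [set x | cabs (gphi phi (all_vars X) (all_vars Y) w - omom (gmat (x.2 : herm_space _ _ _)) x.1 w) < eps].
pose S' w := if valid isr w && (0 < size w <= M)%N then S w else setT.
have -> : @orb_map R ell n m d @^-1` microstates phi (all_vars X) (all_vars Y) rho M d eps =
   (\bigcap_(c in [set: indices n + indices m]) (setT `*` [set z : H | bdd rho (gmat (z : herm_space _ _ _) c)])) `&`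
   \bigcap_k (if unpickle k is Some w then S' w else setT).
  apply/seteqP; split=> -[u z].
    move=> /(microstatesP _ _ _ _ _ _ rho0)[hb hm]; split=> [c _|k _].
      by split=> //=; have := hb c; rewrite gmat_orb_map => /bdd_letm_inv.
    case: unpickle => // w; rewrite /S'; case: ifP => // /andP[vw sw].
    have := hm w vw sw; rewrite /S /= /omom; congr (cabs (_ - ntr _) < _).
    by apply: eq_bigr => c _; rewrite gmat_orb_map.
  move=> [hb hm]; apply/microstatesP => //; split=> [c|w vw sw].
    by rewrite gmat_orb_map; apply: letm_bdd; have [] := hb c Logic.I.
  have := hm (pickle w) Logic.I; rewrite pickleK /S' vw sw /S /= /omom.
  congr (cabs (_ - ntr _) < _).
  by apply: eq_bigr => c _; rewrite gmat_orb_map.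
apply: measurableI.
  have hA c : measurable ([set: T] `*` [set z : H | bdd rho (gmat (z : herm_space _ _ _) c)]).
    apply: measurableX => //.
    rewrite -[X in measurable X]setCK; apply: measurableC; apply: sub_sigma_algebra.
    by rewrite openC; exact: closed_bdd.
  have hfin : finite_set [set: indices n + indices m] by exact: finite_finset.
  exact: (fin_bigcap_measurable hfin (fun c _ => hA c)).
apply: (@bigcapT_measurable _ _ (fun k => if unpickle k is Some w then S' w else setT)) => k.
case: unpickle => [w|]; last exact: measurableT.
rewrite /S'; case: ifP => _; last exact: measurableT.
apply: measurable_cabs_lt; apply: cmeasB; first exact: cmeas_cst.
apply: cmeas_ntr; apply: mmeas_prod => c.
have hu : mmeas (fun x : T * H => uval x.1 (lcol c)).
  move=> i j; have := @cmeas_comp R _ _ _ _ (fun x : T * H => x.1) (fun u : T => uval u (lcol c) i j).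
  by apply; [exact: measurable_fst | exact: (proj1 (bmcm_uval (lcol c) i j))].
apply: mmeasM => //; apply: mmeasM; first exact: mmeas_adj.
move=> i j; have := @cmeas_comp R _ _ _ _ (fun x : T * H => x.2) (fun z : H => gmat (z : herm_space _ _ _) c i j).
by apply; [exact: measurable_snd | apply: cmeas_continuous; exact: gmat_continuous].
Qed.
End Measurability.
(** * Orbital entropy *)

Section Limsup.
Local Set Implicit Arguments.
Local Unset Strict Implicit.
Import Order.TTheory GRing.Theory Num.Theory.
Local Open Scope classical_set_scope.
Local Open Scope ring_scope.
Local Open Scope ereal_scope.
Context {R : realType}.
Implicit Type u : (\bar R)^nat.

Lemma limn_esup_le0 u : (forall d, u d <= 0) -> limn_esup u <= 0.
Proof.
move=> h; apply: (@le_trans _ _ (ereal_sup (u @` setT))).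
  by apply: ereal_inf_lbound; exists setT => //; exact: filterT.
by apply: ge_ereal_sup => _ [d _ <-].
Qed.

Lemma limn_esup_ge0 u : (forall e : R, (0 < e)%R -> exists D, forall d, (D <= d)%N -> - e%:E <= u d) ->
  0 <= limn_esup u.
Proof.
move=> h; apply: le_ereal_inf_tmp => _ [V [N _ NV] <-].
apply/lee_addgt0Pr => e e0; rewrite -leeBlDr // sub0e.
have [D hD] := h e e0; apply: (@le_trans _ _ (u (maxn N D))).
  by apply: hD; rewrite leq_maxr.
by apply: ereal_sup_ubound; exists (maxn N D) => //; apply: NV => /=; rewrite leq_maxl.
Qed.

Lemma limn_esup_frequently u b D : b < limn_esup u -> exists2 d, (D <= d)%N & b < u d.
Proof.
move=> hb; have : b < ereal_sup (u @` [set d | (D <= d)%N]).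
  apply: lt_le_trans hb _; apply: ereal_inf_lbound.
  by exists [set d | (D <= d)%N] => //; exists D.
by move=> /ereal_sup_gt[_ [d hd <-]]; exists d.
Qed.
End Limsup.

Section OrbitalBounds.
Local Set Implicit Arguments.
Local Unset Strict Implicit.
Import Order.TTheory GRing.Theory Num.Theory.
Local Open Scope classical_set_scope.
Local Open Scope ring_scope.
Local Open Scope ereal_scope.
Context {R : realType} {A : cstar_algebra R} (phi : {scalar A}).
Context (gamma : forall d, probability (borel (@unitary_group R d)) R).
Context {ell : nat} {n m : 'I_ell -> nat}.
Context (X : forall k, 'I_(n k) -> A) (Y : forall k, 'I_(m k) -> A).
Local Notation orbset rho M d eps :=
  (@orb_map R ell n m d @^-1` microstates phi (all_vars X) (all_vars Y) rho M d eps).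

Lemma chi_orb_d_le0 rho M d eps : (0 <= rho)%R -> chi_orb_d phi gamma X Y rho M d eps <= 0.
Proof.
move=> rho0; apply: ge_ereal_sup => _ [mu _ <-]; rewrite /chi_orb_mu lne_le0.
by apply: probability_le1; exact: measurable_orb_map.
Qed.

Lemma chi_orb_le0 : chi_orb phi gamma X Y <= 0.
Proof.
apply: ge_ereal_sup => _ [rho rho0 <-]; apply: (@le_trans _ _ (chi_orb_lim phi gamma X Y rho 1 1)).
  by apply: ereal_inf_lbound; exists 1%N, 1%R.
apply: limn_esup_le0 => d; apply: mule_ge0_le0; last by apply: chi_orb_d_le0; exact: ltW.
by rewrite lee_fin invr_ge0 sqr_ge0.
Qed.

(** A probability bounded below costs a constant in the logarithm, which the factor 1 / d^2 makes
    vanish; the value 1/2 is arbitrary. *)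
Lemma chi_orb_ge0 (rho : R) : (0 < rho)%R ->
  (forall M eps, (0 < M)%N -> (0 < eps)%R -> exists D, forall d, (D <= d)%N ->
     exists mu : probability (borel (herm_space (indices n) (indices m) d)) R,
       regular_measure mu /\ (2^-1)%:E <= (power_prob (gamma d) ell \x mu) (orbset rho M d eps)) ->
  0 <= chi_orb phi gamma X Y.
Proof.
move=> rho0 h; apply: (@le_trans _ _ (chi_orb_R phi gamma X Y rho)); last first.
  by apply: ereal_sup_ubound; exists rho.
apply: le_ereal_inf_tmp => _ [M [eps [M0 eps0 ->]]]; apply: limn_esup_ge0 => e e0.
have [D hD] := h M eps M0 eps0.
have l0 : (ln (2^-1) <= 0 :> R)%R by apply: ln_le0; lra.
(* This ensures - ln (1/2) <= e d, and e d <= e d^2 because d >= 1. *)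
exists (maxn (maxn D 1) (Num.truncn (- ln (2^-1) / e)).+1) => d; rewrite geq_max geq_max => /andP[/andP[dD d1] d2].
have [mu [rmu hmu]] := hD d dD.
have d0 : (0 < d%:R :> R)%R by rewrite ltr0n.
have D0 : (0 < d%:R ^+ 2 :> R)%R by rewrite exprn_gt0.
apply: (@le_trans _ _ (((d%:R ^+ 2)^-1)%:E * (ln (2^-1))%:E)).
  rewrite -EFinM -EFinN lee_fin mulrC ler_pdivlMr //.
  have : (- ln (2^-1) / e < d%:R)%R.
    by apply: lt_le_trans (truncnS_gt _) _; rewrite ler_nat.
  rewrite ltr_pdivrMr // => h1.
  have h2 : (d%:R * e <= d%:R ^+ 2 * e :> R)%R.
    by rewrite ler_pM2r // -[leLHS]expr1 ler_weXn2l // ler1n.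
  lra.
apply: lee_wpmul2l; first by rewrite lee_fin invr_ge0 ltW.
apply: (@le_trans _ _ (lne ((power_prob (gamma d) ell \x mu) (orbset rho M d eps)))).
  move: hmu; move: (_ (orbset rho M d eps)) => p hp.
  have h20 : 0 <= (2^-1)%:E :> \bar R by rewrite lee_fin.
  by rewrite -lne_EFin // lee_lne // in_itv /= leey andbT // (le_trans h20).
by apply: ereal_sup_ubound; exists mu.
Qed.
End OrbitalBounds.

(** * From vanishing centred moments to orbital microstates *)

Section Forward.
Local Set Implicit Arguments.
Local Unset Strict Implicit.
Import Order.TTheory GRing.Theory Num.Theory.
Local Open Scope classical_set_scope.
Local Open Scope ring_scope.
Local Open Scope complex_scope.
Context {R : realType} {A : cstar_algebra R} (phi : {scalar A}).
Context (gamma : forall d, probability (borel (@unitary_group R d)) R).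
Hypothesis haar : forall d, is_haar (gamma d).
Context {ell : nat} {n m : 'I_ell -> nat}.
Context (X : forall k, 'I_(n k) -> A) (Y : forall k, 'I_(m k) -> A).
Variable rho : R.
Hypothesis rho1 : 1 <= rho.
Local Notation P d := (power_prob (gamma d) ell).
Local Notation H d := (@herm_space R (indices n) (indices m) d).
Local Notation gamma_k M d eps k := (microstates phi (@X k) (@Y k) rho M d eps).

Let rho0 : 0 <= rho. Proof. exact: le_trans rho1. Qed.

Definition sample := {d : nat & (H d * ell.-tuple (borel (@unitary_group R d)))%type}.

(* [S] holds in probability, uniformly over the choice of individual microstates. *)
Definition in_prob : set_system sample := fun S => forall eta : R, 0 < eta ->
  exists M eps D, [/\ (0 < M)%N, 0 < eps & forall d (z : H d), (D <= d)%N ->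
    (forall k, gamma_k M d eps k (restrict z k)) ->
    exists B, [/\ measurable B, forall u, B u -> S (existT _ d (z, u)) & ((1 - eta)%:E <= P d B)%E]].

Lemma gamma_k_le M M' d eps eps' k z : (M <= M')%N -> eps' <= eps ->
  gamma_k M' d eps' k z -> gamma_k M d eps k z.
Proof.
move=> MM ee; rewrite !microstatesP // => -[hb hm]; split=> //.
exact: moments_close_le hm.
Qed.

Lemma setI_prob d (B B' : set (ell.-tuple (borel (@unitary_group R d)))) (eta : R) :
  measurable B -> measurable B' -> ((1 - eta / 2)%:E <= P d B)%E -> ((1 - eta / 2)%:E <= P d B')%E ->
  ((1 - eta)%:E <= P d (B `&` B'))%E.
Proof.
move=> mB mB' hB hB'.
have cB (S : set _) : measurable S -> ((1 - eta / 2)%:E <= P d S -> P d (~` S) <= (eta / 2)%:E)%E.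
  move=> mS h; rewrite probability_setC //; rewrite leeBlDl ?fin_num_measure //.
  rewrite -leeBlDr // -EFinB; exact: h.
have hU : (P d (~` (B `&` B')) <= eta%:E)%E.
  rewrite setCI; apply: le_trans (measureU2 _ _ _) _; try exact: measurableC.
  by rewrite [eta in leRHS]splitr EFinD; apply: leeD; exact: cB.
have mI : measurable (B `&` B') by exact: measurableI.
move: hU; rewrite probability_setC // leeBlDl ?fin_num_measure // => hU.
by rewrite EFinB leeBlDr.
Qed.

Global Instance in_prob_filter : Filter in_prob.
Proof.
split.
- move=> eta eta0; exists 1%N, 1, 0%N; split=> // d z _ _; exists setT; split=> //.
  by rewrite probability_setT lee_fin; lra.
- move=> S S' hS hS' eta eta0; have e2 : 0 < eta / 2 by lra.
  have [M [eps [D [M0 eps0 h]]]] := hS _ e2; have [M' [eps' [D' [M0' eps0' h']]]] := hS' _ e2.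
  exists (maxn M M'), (Num.min eps eps'), (maxn D D'); split.
  + by rewrite leq_max M0.
  + by rewrite lt_min eps0.
  move=> d z; rewrite geq_max => /andP[dD dD'] hz.
  have [|B [mB SB PB]] := h d z dD.
    by move=> k; apply: gamma_k_le (hz k); rewrite ?leq_maxl // ge_min lexx.
  have [|B' [mB' SB' PB']] := h' d z dD'.
    by move=> k; apply: gamma_k_le (hz k); rewrite ?leq_maxr // ge_min lexx orbT.
  exists (B `&` B'); split; [exact: measurableI | by move=> u [/SB ? /SB' ?] | exact: setI_prob].
- move=> S S' SS' hS eta eta0; have [M [eps [D [M0 eps0 h]]]] := hS _ eta0.
  exists M, eps, D; split=> // d z dD hz; have [B [mB SB PB]] := h d z dD hz.
  by exists B; split=> // u /SB /SS'.
Qed.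

Definition smom (t : sample) w : R[i] := omom (gmat (projT2 t).1) (projT2 t).2 w.

Lemma in_prob_det (S : set sample) M eps D : (0 < M)%N -> 0 < eps ->
  (forall d (z : H d) u, (D <= d)%N -> (forall k, gamma_k M d eps k (restrict z k)) ->
    S (existT _ d (z, u))) -> in_prob S.
Proof.
move=> M0 eps0 h eta eta0; exists M, eps, D; split=> // d z dD hz; exists setT; split=> //.
  by move=> u _; exact: h.
by rewrite probability_setT lee_fin; lra.
Qed.

Lemma gamma_k_bdd M d eps (z : H d) :
  (forall k, gamma_k M d eps k (restrict z k)) -> forall c, bdd rho (gmat z c).
Proof.
move=> hz c; have [c' ->] := emb_surj c; rewrite -gmat_restrict.
by have /(microstatesP _ _ _ _ _ _ rho0)[] := hz (lcol c).
Qed.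

(** Moments of a single colour are unchanged by rotation, so no probability is involved: they are
    those of the individual microstates. *)
Lemma smom_pure k w : valid (@lright _ n m) w -> mono (@lcol _ n m) k w -> (0 < size w)%N ->
  cv in_prob (smom^~ w) (phimom phi X Y w).
Proof.
move=> vw mw w0; apply/cvP => e e0.
have [w' ew] := mono_word mw.
have er : e = (complex.Re e)%:C.
  by case: e e0 => a b; rewrite ltcE /= => /andP[/eqP -> _].
have e0' : 0 < complex.Re e by move: e0; rewrite er ltcR.
apply: (@in_prob_det _ (size w) (complex.Re e) 1) => // d z u d1 hz /=.
rewrite er cabsE ltcR cabs_distC /smom /= (omom_mono _ _ mw).
have /(microstatesP _ _ _ _ _ _ rho0)[_ hm] := hz k.
have := hm w'; rewrite -gphi_emb -ew -valid_emb -ew => /(_ vw).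
have -> : size w' = size w by rewrite ew size_map.
rewrite w0 leqnn => /(_ isT); congr (cabs (_ - ntr _) < _).
by rewrite ew big_map; apply: eq_bigr => c _; rewrite gmat_restrict.
Qed.

Lemma smom_nil : phi 1 = 1 -> cv in_prob (smom^~ [::]) (phimom phi X Y [::]).
Proof.
move=> phi1; apply/cvP => e e0.
apply: (@in_prob_det _ 1 1 1) => // d z u d1 hz /=.
by rewrite /smom /omom /phimom !big_nil phi1 ntr1 // subrr normr0.
Qed.

Lemma smom_free bs : (1 < size bs)%N -> wf_blocks (@lcol _ n m) bs ->
  cv in_prob (fun t => cent (smom t) [::] bs) 0.
Proof.
move=> sbs wbs; apply/cvP => e e0.
have er : e = (complex.Re e)%:C.
  by case: e e0 => a b; rewrite ltcE /= => /andP[/eqP -> _].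
have de0 : 0 < complex.Re e by move: e0; rewrite er ltcR.
move: (complex.Re e) er de0 => de -> de0 {e e0} eta eta0.
have [c c0 hc] := concentration rho1 wbs (ltnW sbs).
(* Only the norm bounds of the individual microstates are used, so order 1 and error 1 suffice. The
   dimension is such that the bound with P = 1 is at most [eta]. *)
exists 1%N, 1, (maxn 1 (Num.truncn (c / (de ^+ 2 * eta))).+1); split=> // d z.
rewrite geq_max => /andP[d1 dD] hz.
exists [set u | cabs (cent (omom (gmat z) u) [::] bs) < de]; split.
- exact: measurable_cent.
- by move=> u /= hu; rewrite subr0 cabsE ltcR.
have hP := hc d (gamma d) (gmat z) 1%N de (@haar d) d1 (gamma_k_bdd hz) isT de0.
set B := [set u | _]; have mB : measurable B by exact: measurable_cent.
have cB : ~` B = [set u | de <= cabs (cent (omom (gmat z) u) [::] bs)].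
  by apply/seteqP; split=> u /=; rewrite /B /=; [move/negP; rewrite -leNgt | rewrite leNgt => /negP].
move: hP; rewrite -cB probability_setC // leeBlDl ?fin_num_measure // expr1 mulr1 => hP.
rewrite EFinB leeBlDr //; apply: le_trans hP _; apply: leeD => //; rewrite lee_fin.
have d0 : (0 < d%:R :> R) by rewrite ltr0n.
have h1 : c / (de ^+ 2 * eta) < d%:R by apply: lt_le_trans (truncnS_gt _) _; rewrite ler_nat.
rewrite ler_pdivrMr ?mulr_gt0 ?exprn_gt0 //.
rewrite ltr_pdivrMr ?mulr_gt0 ?exprn_gt0 // in h1.
have q0 : 0 <= de ^+ 2 * eta by rewrite mulr_ge0 ?sqr_ge0 // ltW.
apply: le_trans (ltW h1) _; rewrite [leRHS]mulrCA [eta * _]mulrC.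
by apply: ler_wpM2r => //; rewrite -[leLHS]expr1 ler_weXn2l // ler1n.
Qed.

Hypothesis phi1 : phi 1 = 1.
Hypothesis free : free_moments phi X Y.

Lemma smom_cv w : valid (@lright _ n m) w -> cv in_prob (smom^~ w) (phimom phi X Y w).
Proof.
apply: (@moments_cv _ _ (@lcol _ n m) (@lright _ n m) _ _ in_prob _ smom (phimom phi X Y)).
- move=> k [|c v] vv mv; first exact: smom_nil.
  exact: (@smom_pure k (c :: v) vv mv isT).
- exact: free.
- by move=> bs sbs wbs _; exact: smom_free.
- exact: smom_nil.
Qed.

Lemma smom_close M eps : 0 < eps -> in_prob [set t : sample |
  moments_close phi (all_vars X) (all_vars Y) M eps (conjl (gmat (projT2 t).1) (projT2 t).2)].
Proof.
move=> eps0; have h w : in_prob [set t | valid isr w -> cabs (gphi phi (all_vars X) (all_vars Y) w - smom t w) < eps].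
  have [vw|nv] := boolP (valid isr w); last first.
    by apply: (@filterS _ in_prob _ setT) => [t _ //|]; exact: filterT.
  have e0 : (0 : R[i]) < eps%:C by rewrite ltcR.
  have /cvP /(_ _ e0) hc := smom_cv vw.
  apply: (@filterS _ in_prob _ _ _ _ hc) => t /= ht _; move: ht.
  by rewrite cabsE ltcR cabs_distC.
(* Words of length at most [M] are finite in number; tuples index them by a finite type, over which
   the filter is closed under intersection. *)
have hall : in_prob [set t | forall (p : 'I_M.+1) (w : p.-tuple (indices n + indices m)),
    valid isr w -> cabs (gphi phi (all_vars X) (all_vars Y) w - smom t w) < eps].
  exact: (filter_forall in_prob_filter (fun p => filter_forall in_prob_filter (fun w => h (tval w)))).
apply: (@filterS _ in_prob _ _ _ _ hall) => t /= ht w vw /andP[_ sw].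
exact: (ht (Ordinal (sw : (size w < M.+1)%N)) (in_tuple w) vw).
Qed.

Lemma free_orb_set M eps : 0 < eps ->
  exists M' eps' D, [/\ (0 < M')%N, 0 < eps' & forall d, (D <= d)%N ->
    (forall k, gamma_k M' d eps' k !=set0) ->
    exists mu : probability (borel (H d)) R, regular_measure mu /\
      ((2^-1)%:E <= (P d \x mu) (@orb_map R ell n m d @^-1`
        microstates phi (all_vars X) (all_vars Y) rho M d eps))%E].
Proof.
move=> eps0; have e2 : 0 < 2^-1 :> R by [].
have [M' [eps' [D [M0' eps0' h]]]] := smom_close M eps0 e2.
exists M', eps', D; split=> // d dD hne.
pose z : H d := assemble (fun k => projT1 (cid (hne k))).
have hz k : gamma_k M' d eps' k (restrict z k).
  by rewrite restrict_assemble; exact: (projT2 (cid (hne k))).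
have [B [mB SB PB]] := h d z dD hz.
exists (dirac (z : borel (H d)) : probability (borel (H d)) R); split; first exact: dirac_regular.
have mO := @measurable_orb_map R A phi ell n m X Y rho M d eps rho0.
rewrite product_dirac //; apply: (@le_trans _ _ (P d B)).
  by apply: le_trans PB; rewrite lee_fin; lra.
apply: le_measure; rewrite ?inE //; first exact: measurable_ysection.
move=> u Bu; rewrite /ysection /= inE /=; apply/microstatesP => //; split=> [c|].
  by rewrite gmat_orb_map; apply: letm_bdd; exact: gamma_k_bdd hz c.
by have := SB u Bu; congr moments_close; apply/funext => c; rewrite gmat_orb_map.
Qed.
End Forward.

(** * Lowering the cutoff on norms *)

Section TruncatedMoments.
Local Set Implicit Arguments.
Local Unset Strict Implicit.
Import Order.TTheory GRing.Theory Num.Theory.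
Local Open Scope classical_set_scope.
Local Open Scope ring_scope.
Local Open Scope complex_scope.
Local Open Scope sesquilinear_scope.
Context {R : realType} {A : cstar_algebra R} (phi : {scalar A}).
Hypothesis phi_state : is_state phi.
Context {I J : Type} (X : I -> A) (Y : J -> A).
Hypothesis sa : forall c, selfadjoint (gvar X Y c).
Local Notation close M eps a := (moments_close phi X Y M eps a).

Lemma prod_nseq (B : pzRingType) (T : Type) (a : T -> B) k c : \prod_(x <- nseq k c) a x = a c ^+ k.
Proof. by elim: k => [|k IH]; rewrite ?big_nil ?expr0 //= big_cons IH exprS. Qed.

Lemma nseq_word k (c : I + J) : exists s t, [/\ nseq k c = [seq inl i | i <- s] ++ [seq inr j | j <- rev t]
  & (\prod_(i <- s) X i) * \prod_(j <- t) Y j = gvar X Y c ^+ k].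
Proof.
case: c => x.
  exists (nseq k x), [::]; split; first by rewrite /= cats0 map_nseq.
  by rewrite big_nil mulr1 (prod_nseq X).
exists [::], (nseq k x); split; last by rewrite big_nil mul1r (prod_nseq Y).
by rewrite /= rev_nseq map_nseq.
Qed.

(** The moment of order 2m of [a c] is close to that of the operator, hence at most about (4/3)
    q^(2m). As q < rho, this is negligible against rho^(2m) for large m, and so is the error of
    clipping at [rho]. The bound [K] on [a] affects only how close its moments must be. *)
Lemma moments_close_trunc q rho K M eps : 0 <= q -> q < rho -> (forall c, cnorm (gvar X Y c) <= q) ->
  0 <= K -> 0 < eps ->
  exists M' eps', [/\ (0 < M')%N, 0 < eps' & forall d (a b : I + J -> 'M[R[i]]_d),
    (forall c, trunc_close rho (a c) (b c)) -> (forall c, bdd K (a c)) ->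
    close M' eps' a -> close M eps b].
Proof.
move=> q0 qr hq K0 eps0; have r0 : 0 < rho by exact: le_lt_trans qr.
pose L := 1 + K + rho; have L1 : 1 <= L by rewrite /L; lra.
have L0 : 0 <= L by exact: le_trans L1.
pose B := (M.+1)%:R * L ^+ M * rho.
have B0 : 0 < B by rewrite !mulr_gt0 ?ltr0n // exprn_gt0 //; exact: lt_le_trans L1.
have qr1 : q / rho < 1 by rewrite ltr_pdivrMr // mul1r.
have qr0 : 0 <= q / rho by rewrite divr_ge0 // ltW.
have e0 : 0 < eps / (8 * B) by rewrite divr_gt0 // mulr_gt0.
have [N hN] := expr_small qr0 qr1 e0.
pose m := N.+1; have rm0 : 0 < rho ^+ (2 * m) by exact: exprn_gt0.
(* The first entry of the minimum bounds the error on the given word, the second keeps the error of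
   the moment of order 2m small after division by rho^(2m). *)
exists (maxn M (2 * m)), (Num.min (eps / 4) (rho ^+ (2 * m) * (eps / (8 * B)))); split.
- by rewrite leq_max muln_gt0 orbT.
- by rewrite lt_min divr_gt0 //= mulr_gt0.
set eps' := Num.min _ _ => d a b hab ha hm w vw /andP[w0 sw].
have e'1 : eps' <= eps / 4 by rewrite ge_min lexx.
have e'2 : eps' / rho ^+ (2 * m) <= eps / (8 * B).
  by rewrite ler_pdivrMr // mulrC ge_min lexx orbT.
pose delta := rho * (4 / 3 * (q / rho) ^+ (2 * m) + eps' / rho ^+ (2 * m)).
have hR c : complex.Re (ntr (a c ^+ (2 * m))) <= 4 / 3 * q ^+ (2 * m) + eps'.
  have [s [t [ew ep]]] := nseq_word (2 * m) c.
  have vn : valid isr (nseq (2 * m) c) by rewrite ew; exact: word_valid.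
  have gn : gphi phi X Y (nseq (2 * m) c) = phi (gvar X Y c ^+ (2 * m)) by rewrite ew gphi_word ep.
  have sn : (0 < size (nseq (2 * m) c) <= maxn M (2 * m))%N.
    by rewrite size_nseq leq_max leqnn orbT muln_gt0.
  have h1 := hm _ vn sn; rewrite gn (prod_nseq a) in h1.
  have h2 := state_expr_bound phi_state (sa c) (isT : (0 < 2 * m)%N).
  have h3 : cnorm (gvar X Y c) ^+ (2 * m) <= q ^+ (2 * m).
    by apply: lerXn2r; rewrite ?nnegrE ?cnorm_ge0.
  have h4 : cabs (ntr (a c ^+ (2 * m))) <= cabs (phi (gvar X Y c ^+ (2 * m))) +
     cabs (phi (gvar X Y c ^+ (2 * m)) - ntr (a c ^+ (2 * m))).
    have := cabsB (phi (gvar X Y c ^+ (2 * m))) (phi (gvar X Y c ^+ (2 * m)) - ntr (a c ^+ (2 * m))).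
    by rewrite opprB addrC subrK.
  apply: le_trans (le_trans (ler_norm _) (Re_le_cabs _)) _; apply: le_trans h4 _.
  apply: lerD; last exact: ltW h1.
  by apply: le_trans h2 _; apply: ler_wpM2l.
have hd c L' P : 0 <= L' -> bdd L' P -> cabs (ntr (P *m (a c - b c))) <= L' * delta.
  move=> L'0 hP; have [_ _ h] := hab c; apply: le_trans (h m L' P isT L'0 hP) _.
  apply: ler_wpM2l => //; rewrite /delta -mulrA; apply: ler_wpM2l; first exact: ltW.
  rewrite mulrC expr_div_n mulrA -mulrDl; apply: ler_wpM2r; first by rewrite invr_ge0 ltW.
  exact: hR.
have ge0d : 0 <= delta.
  apply: mulr_ge0; first exact: ltW.
  apply: addr_ge0; first by apply: mulr_ge0 => //; exact: exprn_ge0.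
  apply: divr_ge0; last exact: ltW.
  by rewrite le_min divr_ge0 ?(ltW eps0) //= mulr_ge0 // ltW.
have wd := word_dist L1 ge0d (f := a) (g := b) _ _ hd w ler01 bdd1.
have {wd} : cabs (ntr (\prod_(c <- w) a c) - ntr (\prod_(c <- w) b c)) <= (size w)%:R * (L ^+ size w * delta).
  have := wd; rewrite !mul1mx mul1r; apply=> c.
    by apply: (bdd_le _ _ (ha c)) => //; rewrite /L; lra.
  have [_ hb _] := hab c; apply: (bdd_le _ _ hb); first exact: ltW.
  by rewrite /L; lra.
have hwa := hm w vw; rewrite w0 leq_max sw /= in hwa; have {}hwa := hwa isT.
move=> wd; apply: le_lt_trans (_ : eps' + B * (4 / 3 * (q / rho) ^+ (2 * m) + eps' / rho ^+ (2 * m)) < _).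
  have -> : gphi phi X Y w - ntr (\prod_(c <- w) b c) = (gphi phi X Y w - ntr (\prod_(c <- w) a c)) +
      (ntr (\prod_(c <- w) a c) - ntr (\prod_(c <- w) b c)) by rewrite addrA subrK.
  apply: le_trans (cabsD _ _) _; apply: lerD; first exact: ltW.
  apply: le_trans wd _; rewrite /B -mulrA -/delta -mulrA; apply: ler_pM => //.
  - by rewrite mulr_ge0 ?exprn_ge0.
  - by rewrite ler_nat (leq_trans sw).
  - by apply: ler_wpM2r => //; apply: ler_weXn2l.
have h5 : (q / rho) ^+ (2 * m) < eps / (8 * B).
  by apply: hN; rewrite mul2n -addnn /m addSn ltnW // ltnS leq_addr.
have h6 : B * (eps / (8 * B)) = eps / 8 by field; rewrite gt_eqF.
have : B * (4 / 3 * (q / rho) ^+ (2 * m) + eps' / rho ^+ (2 * m)) <= B * (7 / 3 * (eps / (8 * B))).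
  by apply: ler_wpM2l; [exact: ltW | lra].
rewrite [B * (7 / 3 * _)]mulrCA h6; lra.
Qed.
End TruncatedMoments.

(** * Microstates in all large dimensions *)

Section Approximants.
Local Set Implicit Arguments.
Local Unset Strict Implicit.
Import Order.TTheory GRing.Theory Num.Theory.
Local Open Scope classical_set_scope.
Local Open Scope ring_scope.
Local Open Scope complex_scope.
Local Open Scope sesquilinear_scope.
Context {R : realType} {A : cstar_algebra R} (phi : {scalar A}).
Hypothesis phi_state : is_state phi.
Context {I J : Type} (X : I -> A) (Y : J -> A).
Hypothesis sa : forall c, selfadjoint (gvar X Y c).
Local Notation close M eps a := (moments_close phi X Y M eps a).

Lemma gmat_exists d (b : I + J -> 'M[R[i]]_d) : (forall c, b c \is hermsymmx) ->
  exists z : @herm_space R I J d, gmat z = b.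
Proof.
move=> hb; exists (fun i => mk_herm (hb (inl i)), fun j => mk_herm (hb (inr j))).
by apply/funext => -[].
Qed.

(** One sample in a single dimension [d0] is clipped, repeated [d %/ d0] times and padded with
    zeros. The padding scales normalized traces by 1 - (d %% d0) / d, which tends to 1. *)
Lemma microstates_of_sample q K rho M eps : 0 <= q -> q < rho ->
  (forall c, cnorm (gvar X Y c) <= q) -> 0 <= K -> (0 < M)%N -> 0 < eps ->
  (forall M' eps', (0 < M')%N -> 0 < eps' -> exists d (a : I + J -> 'M[R[i]]_d),
     [/\ (0 < d)%N, forall c, a c \is hermsymmx, forall c, bdd K (a c) & close M' eps' a]) ->
  exists D, forall d, (D <= d)%N -> microstates phi X Y rho M d eps !=set0.
Proof.
move=> q0 qr hq K0 M0 eps0 h; have r0 : 0 < rho by exact: le_lt_trans qr.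
have e20 : 0 < eps / 2 by rewrite divr_gt0.
have [M' [eps' [M'0 e'0 ht]]] := moments_close_trunc phi_state sa M q0 qr hq K0 e20.
have [d0 [a [d00 ha ba ca]]] := h M' eps' M'0 e'0.
pose b c := projT1 (cid (exists_trunc r0 (ha c))).
have hb c : trunc_close rho (a c) (b c) by exact: (projT2 (cid (exists_trunc r0 (ha c)))).
have cb := ht d0 a b hb ba ca.
pose L := 1 + rho; have L1 : 1 <= L by rewrite /L; lra.
have L0 : 0 <= L by exact: le_trans L1.
(* Beyond this dimension the error of the padding, at most L^M d0 / d, is below [eps / 2]. *)
exists (Num.truncn (2 * L ^+ M * d0%:R / eps)).+1 => d hd.
have d1 : (0 < d)%N by exact: leq_trans hd.
have hbb c : b c \is hermsymmx /\ bdd rho (b c) by case: (hb c).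
have [b' hb'] := exists_copies (fun c => proj1 (hbb c)) (fun c => proj2 (hbb c)) (d %/ d0) (d %% d0).
move: b' hb'; rewrite -divn_eq => b' [herm' bdd' tr'].
have [z hz] := gmat_exists herm'.
exists z; apply/microstatesP; first exact: ltW.
rewrite hz; split=> // w vw /andP[w0 sw].
have dR : 0 < d%:R :> R by rewrite ltr0n.
have hw := cb w vw; rewrite w0 sw in hw; have {}hw := hw isT.
have wn : ~~ nilp w by rewrite /nilp -lt0n.
have ntrE : ntr (\prod_(c <- w) b c) - ntr (\prod_(c <- w) b' c) =
    ntr (\prod_(c <- w) b c) * ((d %% d0)%:R / d%:R).
  rewrite /ntr (tr' w wn); set t := \tr _.
  have D0 : d%:R != 0 :> R[i] by rewrite pnatr_eq0 -lt0n.
  have D00 : d0%:R != 0 :> R[i] by rewrite pnatr_eq0 -lt0n.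
  have -> : (d %% d0)%:R = d%:R - (d %/ d0)%:R * d0%:R :> R[i].
    by rewrite {2}(divn_eq d d0) natrD natrM addrAC subrr add0r.
  by field; rewrite D0 D00.
have -> : gphi phi X Y w - ntr (\prod_(c <- w) b' c) = (gphi phi X Y w - ntr (\prod_(c <- w) b c)) +
    (ntr (\prod_(c <- w) b c) - ntr (\prod_(c <- w) b' c)) by rewrite addrA subrK.
apply: le_lt_trans (cabsD _ _) _; rewrite ntrE cabsM (cabsM (d %% d0)%:R) cabs_inv !cabs_nat.
have h1 : cabs (ntr (\prod_(c <- w) b c)) <= L ^+ M.
  apply: le_trans (_ : L ^+ size w <= _); last exact: ler_weXn2l.
  apply: bdd_ntr; first exact: exprn_ge0.
  by apply: bdd_prod => c; apply: (bdd_le _ _ (proj2 (hbb c))); [exact: ltW | rewrite /L; lra].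
have h2 : L ^+ M * ((d %% d0)%:R / d%:R) <= eps / 2.
  rewrite mulrA ler_pdivrMr //.
  have h3 : 2 * L ^+ M * d0%:R / eps < d%:R.
    by apply: lt_le_trans (truncnS_gt _) _; rewrite ler_nat.
  rewrite ltr_pdivrMr // in h3.
  have h4 : L ^+ M * (d %% d0)%:R <= L ^+ M * d0%:R.
    by apply: ler_wpM2l; [exact: exprn_ge0 | rewrite ler_nat ltnW // ltn_mod].
  move: h3 h4; rewrite -mulrA; move: (L ^+ M * d0%:R) (L ^+ M * _) => u v; lra.
rewrite [eps in ltRHS]splitr; apply: ltr_leD => //.
apply: le_trans h2; apply: ler_wpM2r => //.
Qed.
End Approximants.

Section Sample.
Local Set Implicit Arguments.
Local Unset Strict Implicit.
Import Order.TTheory GRing.Theory Num.Theory.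
Local Open Scope classical_set_scope.
Local Open Scope ring_scope.
Local Open Scope complex_scope.
Context {R : realType} {A : cstar_algebra R} (phi : {scalar A}).
Context (gamma : forall d, probability (borel (@unitary_group R d)) R).
Context {ell : nat} {n m : 'I_ell -> nat}.
Context (X : forall k, 'I_(n k) -> A) (Y : forall k, 'I_(m k) -> A).
Local Notation XX := (all_vars X).
Local Notation YY := (all_vars Y).
Local Notation H d := (@herm_space R (indices n) (indices m) d).
Hypothesis chi0 : chi_orb phi gamma X Y = 0%E.

(** The quantifiers follow the definition: the cutoff is taken from a supremum and depends on [eta],
    the pair (M, eps) is arbitrary because of the infimum, and d is arbitrarily large because of the
    upper limit. *)
Lemma chi_orb_sample eta : 0 < eta -> exists2 rho, 0 < rho & forall M eps D, (0 < M)%N -> 0 < eps ->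
  exists d (z : H d) (S : set (ell.-tuple (borel (@unitary_group R d)))),
   [/\ (D < d)%N, measurable S,
     forall u, S u -> microstates phi XX YY rho M d eps (orb_map (u : ell.-tuple (unitary_group d), z)) &
     ((expR (- eta * d%:R ^+ 2))%:E < power_prob (gamma d) ell S)%E].
Proof.
move=> eta0; have : ((- eta)%:E < chi_orb phi gamma X Y)%E by rewrite chi0 lte_fin oppr_lt0.
move=> /ereal_sup_gt[_ [rho r0 <-] hrho]; exists rho => // M eps D M0 eps0.
have hlim : ((- eta)%:E < chi_orb_lim phi gamma X Y rho M eps)%E.
  by apply: lt_le_trans hrho _; apply: ereal_inf_lbound; exists M, eps.
have [d dD hd] := limn_esup_frequently D.+1 hlim.
have d0 : 0 < d%:R :> R by rewrite ltr0n (leq_trans _ dD).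
have D0 : 0 < d%:R ^+ 2 :> R by rewrite exprn_gt0.
have hchi : ((- eta * d%:R ^+ 2)%:E < chi_orb_d phi gamma X Y rho M d eps)%E.
  rewrite ltNge; apply/negP => hle; move: hd; apply/negP; rewrite -leNgt.
  apply: (@le_trans _ _ (((d%:R ^+ 2)^-1)%:E * (- eta * d%:R ^+ 2)%:E)%E).
    by apply: lee_wpmul2l => //; rewrite lee_fin invr_ge0 ltW.
  by rewrite -EFinM lee_fin mulrCA mulVf ?mulr1 // gt_eqF.
move: hchi => /ereal_sup_gt[_ [mu _ <-] hmu].
have mO := @measurable_orb_map R A phi ell n m X Y rho M d eps (ltW r0).
have hp : ((expR (- eta * d%:R ^+ 2))%:E < (power_prob (gamma d) ell \x mu)
    (@orb_map R ell n m d @^-1` microstates phi XX YY rho M d eps))%E.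
  rewrite ltNge; apply/negP => hle; move: hmu; apply/negP; rewrite -leNgt /chi_orb_mu.
  have p0 : (0 <= (power_prob (gamma d) ell \x mu)
    (@orb_map R ell n m d @^-1` microstates phi XX YY rho M d eps))%E by exact: measure_ge0.
  apply: (@le_trans _ _ (lne (expR (- eta * d%:R ^+ 2))%:E)).
    move: p0 hle; move: (_ (orb_map (R := R) (d := d) @^-1` _)) => p p0 hle.
    by rewrite lee_lne // in_itv /= leey andbT // lee_fin expR_ge0.
  by rewrite lne_EFin ?expR_gt0 // expRK.
have [z hz] := product_point mO (expR_ge0 _) hp.
exists d, z, (ysection (@orb_map R ell n m d @^-1` microstates phi XX YY rho M d eps) z).
split; [exact: dD | exact: measurable_ysection mO | | exact: hz].
by move=> u; rewrite /ysection /= inE.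
Qed.
End Sample.
Section CentContinuity.
Local Set Implicit Arguments.
Local Unset Strict Implicit.
Import Order.TTheory GRing.Theory Num.Theory.
Local Open Scope classical_set_scope.
Local Open Scope ring_scope.
Local Open Scope complex_scope.
Context {R : realType} {L : Type} {K : eqType} (isr : L -> bool) (phi : seq L -> R[i]).

(** Neighbourhoods of [phi] for moments of valid words, as a filter, so that [cent_cv] yields
    continuity of centred products. The empty word is fixed separately because microstates do not
    test it. *)
Definition near_moments : set_system (seq L -> R[i]) := fun S =>
  exists M (eps : R), [/\ (0 < M)%N, 0 < eps & forall psi, psi [::] = phi [::] ->
    (forall w, valid isr w -> (0 < size w <= M)%N -> cabs (phi w - psi w) < eps) -> S psi].

Lemma near_moments_filter : Filter near_moments.
Proof.
split.
- by exists 1%N, 1.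
- move=> S S' [M [e [M0 e0 h]]] [M' [e' [M'0 e'0 h']]]; exists (maxn M M'), (Num.min e e').
  split; [by rewrite leq_max M0 | by rewrite lt_min e0 |] => psi pn hp; split.
    apply: h => // w vw /andP[w0 wM]; apply: (lt_le_trans (hp w vw _)); last by rewrite ge_min lexx.
    by rewrite w0 leq_max wM.
  apply: h' => // w vw /andP[w0 wM]; apply: (lt_le_trans (hp w vw _)); last by rewrite ge_min lexx orbT.
  by rewrite w0 leq_max wM orbT.
- by move=> S S' SS' [M [e [M0 e0 h]]]; exists M, e; split=> // psi pn hp; apply/SS'/h.
Qed.

Lemma cent_near (bs : seq (K * seq L)) (delta : R) : valid isr (flat bs) -> 0 < delta ->
  near_moments [set psi | cabs (cent psi [::] bs - cent phi [::] bs) < delta].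
Proof.
move=> vf d0; have F := near_moments_filter.
have : cv near_moments (fun psi => cent psi [::] bs) (cent phi [::] bs).
  apply: (@cent_cv _ _ isr _ _ near_moments _ (fun psi => psi) phi) => // w _ vw.
  apply/cvP => e e0.
  have er : e = (complex.Re e)%:C.
    by case: e e0 => a b; rewrite ltcE /= => /andP[/eqP -> _].
  have de0 : 0 < complex.Re e by move: e0; rewrite er ltcR.
  exists (size w).+1, (complex.Re e); split=> // psi pn hp /=.
  rewrite er cabsE ltcR cabs_distC; have [w0|w0] := posnP (size w).
    by rewrite (size0nil w0) pn subrr cabs0.
  by apply: hp => //; rewrite w0 leqnSn.
have e0 : (0 : R[i]) < delta%:C by rewrite ltcR.
move=> /cvP /(_ _ e0) [M [e [M0 e'0 h]]]; exists M, e; split=> // psi pn hp.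
by have := h psi pn hp; rewrite /= cabsE ltcR.
Qed.
End CentContinuity.

(** * Consequences of vanishing orbital entropy *)

Section Backward.
Local Set Implicit Arguments.
Local Unset Strict Implicit.
Import Order.TTheory GRing.Theory Num.Theory.
Local Open Scope classical_set_scope.
Local Open Scope ring_scope.
Local Open Scope complex_scope.
Context {R : realType} {A : cstar_algebra R} (phi : {scalar A}).
Hypothesis phi_state : is_state phi.
Context (gamma : forall d, probability (borel (@unitary_group R d)) R).
Hypothesis haar : forall d, is_haar (gamma d).
Context {ell : nat} {n m : 'I_ell -> nat}.
Context (X : forall k, 'I_(n k) -> A) (Y : forall k, 'I_(m k) -> A).
Local Notation XX := (all_vars X).
Local Notation YY := (all_vars Y).
Local Notation lttr := (lttr (n := n) (m := m)).
Hypothesis sa : forall c, selfadjoint (gvar XX YY c).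
Hypothesis chi0 : chi_orb phi gamma X Y = 0%E.

Let q : R := \sum_(c : indices n + indices m) cnorm (gvar XX YY c).

Let hq c : cnorm (gvar XX YY c) <= q.
Proof. by rewrite /q (bigD1 c) //= lerDl sumr_ge0 // => i _; exact: cnorm_ge0. Qed.

Let q0 : 0 <= q.
Proof. by apply: sumr_ge0 => i _; exact: cnorm_ge0. Qed.

Let rho := 1 + q.

(** The cutoff [rho] is now the same for all [eta], so constants depending on it may be fixed before
    [eta]. Clipping acts on the matrices before rotation and leaves [S] untouched. *)
Lemma truncated_sample eta M eps D : 0 < eta -> 0 < eps ->
  exists d (b : lttr -> 'M[R[i]]_d) (S : set (ell.-tuple (borel (@unitary_group R d)))),
   [/\ (D < d)%N, forall c, b c \is hermsymmx /\ bdd rho (b c), measurable S,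
     forall u, S u -> moments_close phi XX YY M eps (conjl b u) &
     ((expR (- eta * d%:R ^+ 2))%:E < power_prob (gamma d) ell S)%E].
Proof.
move=> eta0 eps0; have [R0 R00 hs] := chi_orb_sample chi0 eta0.
have qr : q < rho by rewrite /rho; lra.
have r0 : 0 < rho by exact: le_lt_trans qr.
have [M' [eps' [M'0 e'0 ht]]] := moments_close_trunc phi_state sa M q0 qr hq (ltW R00) eps0.
have [d [z [S [dD mS hS PS]]]] := hs M' eps' D M'0 e'0.
pose b c := projT1 (cid (exists_trunc r0 (gmat_herm z c))).
have hb c : trunc_close rho (gmat z c) (b c) := projT2 (cid (exists_trunc r0 (gmat_herm z c))).
exists d, b, S; split=> // [c|u Su]; first by case: (hb c).
have := hS u Su => /(microstatesP _ _ _ _ _ _ (ltW R00))[hbd hcl].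
apply: (ht d (conjl (gmat z) u) (conjl b u)).
- by move=> c; exact: (trunc_close_conj (uval_unitary u (lcol c)) (hb c)).
- by move=> c; rewrite -gmat_orb_map; exact: hbd.
by move: hcl; congr moments_close; apply/funext => c; rewrite gmat_orb_map.
Qed.

Lemma chi_orb0_fd k : (0 < n k + m k)%N -> has_fd_approximants phi (@X k) (@Y k).
Proof.
move=> nm0 M eps r M0 eps0 hX hY.
have gE (c : 'I_(n k) + 'I_(m k)) : gvar (@X k) (@Y k) c = gvar XX YY (emb c) by case: c.
(* The maximum is taken, not the sum, since [r] is only known to exceed each norm. *)
pose p : R := \big[Num.max/0]_(c : 'I_(n k) + 'I_(m k)) cnorm (gvar (@X k) (@Y k) c).
have hp c : cnorm (gvar (@X k) (@Y k) c) <= p by exact: le_bigmax.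
have hr c : cnorm (gvar (@X k) (@Y k) c) < r by case: c.
have r0 : 0 < r.
  have [c] : inhabited ('I_(n k) + 'I_(m k)).
    case: (posnP (n k)) => [n0|n0]; last by constructor; exact: inl (Ordinal n0).
    by move: nm0; rewrite n0 => m0; constructor; exact: inr (Ordinal m0).
  by apply: le_lt_trans (hr c); exact: cnorm_ge0.
have p0 : 0 <= p by exact: bigmax_ge_id.
have pr : p < r by apply: bigmax_lt.
have sak (c : 'I_(n k) + 'I_(m k)) : selfadjoint (gvar (@X k) (@Y k) c) by rewrite gE.
have rho0 : 0 <= rho by rewrite /rho addr_ge0.
apply: (microstates_of_sample phi_state sak p0 pr hp rho0 M0 eps0) => M' eps' M'0 e'0.
(* Only nonemptiness of [S] is wanted, so any value of [eta] will do. *)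
have [d [b [S [dD hb mS hS PS]]]] := @truncated_sample 1 M' eps' 0 ltr01 e'0.
have [u Su] : S !=set0.
  apply/set0P/negP => /eqP S0; move: PS; rewrite S0 measure0 lte_fin ltNge.
  by rewrite expR_ge0.
exists d, (fun c => conjl b u (emb c)); split=> // [c|c|w vw sw].
- by apply: herm_conj; case: (hb (emb c)).
- by apply: letm_bdd; case: (hb (emb c)).
have := hS u Su (map (@emb _ _ _ k) w); rewrite valid_emb size_map gphi_emb big_map; exact.
Qed.

(* For [eta] small, a set of measure larger than [expR (- eta * d ^+ 2)] meets the
   complement of the exceptional set of the concentration bound with [P ~ d ^+ 2]. *)
Lemma chi_orb0_free : free_moments phi X Y.
Proof.
move=> bs sbs wbs vf; apply: contrapT => /eqP cn0.
pose delta := cabs (cent (phimom phi X Y) [::] bs) / 2.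
have de0 : 0 < delta.
  rewrite divr_gt0 // lt_neqAle cabs_ge0 andbT eq_sym; apply/eqP => /cabs_eq0/eqP.
  by rewrite (negbTE cn0).
have rho1 : 1 <= rho by rewrite /rho lerDl.
have [c c0 hc] := concentration rho1 wbs (ltnW sbs).
(* For P <= theta d^2 the base c P / (d^2 delta^2) of the bound is at most 1/e; the summand 1 in c +
   1 prevents a division by zero. *)
pose theta := expR (-1) * delta ^+ 2 / (c + 1).
have c10 : 0 < c + 1 by lra.
have th0 : 0 < theta by rewrite divr_gt0 // mulr_gt0 ?expR_gt0 // exprn_gt0.
have [M [eps [M0 eps0 hM]]] := cent_near (phimom phi X Y) vf de0.
have et0 : 0 < theta / 2 by rewrite divr_gt0.
have [d [b [S [dD hb mS hS PS]]]] := @truncated_sample _ M eps (Num.truncn (2 / theta)) et0 eps0.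
have d0 : (0 < d)%N by exact: leq_trans dD.
have dR : 0 < d%:R :> R by rewrite ltr0n.
have D0 : 0 < d%:R ^+ 2 :> R by rewrite exprn_gt0.
(* From theta d^2 > 2 follows that its integer part [P] is positive and at least theta d^2 / 2, so
   e^(-P) <= exp(- theta d^2 / 2). *)
have hth : 2 < theta * d%:R ^+ 2.
  have h1 : 2 / theta < d%:R by apply: lt_le_trans (truncnS_gt _) _; rewrite ler_nat.
  rewrite ltr_pdivrMr // in h1; apply: lt_le_trans h1 _; rewrite [leRHS]mulrC ler_pM2r //.
  by rewrite -[leLHS]expr1 ler_weXn2l // ler1n.
pose P := Num.truncn (theta * d%:R ^+ 2).
have /andP[P1 P2] : P%:R <= theta * d%:R ^+ 2 < P.+1%:R by apply: truncn_itv; lra.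
have P0 : (0 < P)%N.
  by rewrite -(ltr_nat R); move: P2; rewrite -natr1; lra.
have hP := hc d (gamma d) b P delta (@haar d) d0 (fun x => proj2 (hb x)) P0 de0.
have bad : (power_prob (gamma d) ell [set u | delta <= cabs (cent (omom b u) [::] bs)]%R <=
    (expR (- (theta / 2) * d%:R ^+ 2))%:E)%E.
  apply: le_trans hP _; rewrite lee_fin.
  apply: le_trans (_ : expR (-1) ^+ P <= _).
    apply: lerXn2r; rewrite ?nnegrE ?expR_ge0 //.
      by apply: divr_ge0; apply: mulr_ge0; rewrite ?ler0n ?sqr_ge0.
    rewrite ler_pdivrMr; last by apply: mulr_gt0; apply: exprn_gt0.
    apply: le_trans (_ : (c + 1) * (theta * d%:R ^+ 2) <= _).
      by apply: ler_pM => //; lra.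
    rewrite /theta mulrA [(c + 1) * _]mulrC divfK ?gt_eqF //.
    by rewrite -mulrA [delta ^+ 2 * _]mulrC.
  rewrite -expRM_natl ler_expR; move: P2; rewrite -natr1; lra.
have [u [Su hu]] : exists u, S u /\ cabs (cent (omom b u) [::] bs) < delta.
  apply: contrapT => hn; move: PS; apply/negP; rewrite -leNgt; apply: le_trans bad.
  apply: le_measure; rewrite ?inE //; last first.
    by move=> u Su /=; rewrite leNgt; apply/negP => hlt; apply: hn; exists u.
  rewrite -[X in measurable X]setCK; apply: measurableC.
  rewrite (_ : ~` _ = [set u | cabs (cent (omom b u) [::] bs) < delta]); first exact: measurable_cent.
  by apply/seteqP; split=> u /=; [move/negP; rewrite -ltNge | rewrite ltNge => /negP].
have := hM (omom b u) _ (hS u Su) => /(_ _)/wrap[|/= hd].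
  by rewrite /omom /phimom !big_nil ntr1 //; case: phi_state.
have := cabsB (cent (omom b u) [::] bs) (cent (omom b u) [::] bs - cent (phimom phi X Y) [::] bs).
rewrite opprB addrC subrK => h3.
have : cabs (cent (phimom phi X Y) [::] bs) < delta + delta by apply: le_lt_trans h3 (ltrD hu hd).
by rewrite /delta -splitr ltxx.
Qed.
End Backward.
Section Characterization.
Local Set Implicit Arguments.
Local Unset Strict Implicit.
Import Order.TTheory GRing.Theory Num.Theory.
Local Open Scope classical_set_scope.
Local Open Scope ring_scope.
Context {R : realType} {A : cstar_algebra R} (phi : {scalar A}).
Hypothesis phi_state : is_state phi.
Context (gamma : forall d, probability (borel (@unitary_group R d)) R).
Hypothesis haar : forall d, is_haar (gamma d).
Context {ell : nat} {n m : 'I_ell -> nat}.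
Context (X : forall k, 'I_(n k) -> A) (Y : forall k, 'I_(m k) -> A).

Lemma free_moments_chi_orb0 : free_moments phi X Y ->
  (forall k, has_fd_approximants phi (@X k) (@Y k)) -> chi_orb phi gamma X Y = 0%E.
Proof.
move=> free fd.
pose rho : R := 1 + \sum_(c : indices n + indices m) cnorm (gvar (all_vars X) (all_vars Y) c).
have norm_lt (c : indices n + indices m) : cnorm (gvar (all_vars X) (all_vars Y) c) < rho.
  rewrite /rho (bigD1 c) //= addrCA ltrDl ltr_wpDr // sumr_ge0 // => i _; exact: cnorm_ge0.
have rho1 : 1 <= rho by rewrite lerDl sumr_ge0 // => i _; exact: cnorm_ge0.
have rho0 : 0 < rho by exact: lt_le_trans rho1.
apply/eqP; rewrite eq_le chi_orb_le0 /=; apply: (chi_orb_ge0 rho0) => M eps M0 eps0.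
have [M' [eps' [D [M'0 eps'0 h]]]] := free_orb_set haar rho1 (proj2 phi_state) free M eps0.
have approx k : exists Dk, forall d, (Dk <= d)%N -> microstates phi (@X k) (@Y k) rho M' d eps' !=set0.
  apply: (fd k M' eps' rho M'0 eps'0) => [i|j].
    exact: (norm_lt (inl (Tagged (fun k => 'I_(n k)) i))).
  exact: (norm_lt (inr (Tagged (fun k => 'I_(m k)) j))).
pose Dk k := projT1 (cid (approx k)).
exists (maxn D (\max_k Dk k)) => d; rewrite geq_max => /andP[hD hDk].
apply: h => // k; apply: (projT2 (cid (approx k))); apply: leq_trans hDk.
exact: (leq_bigmax k).
Qed.

End Characterization.
Local Open Scope classical_set_scope.
Local Open Scope ring_scope.

Theorem theorem6p1 (R : realType) (A : cstar_algebra R) (phi : {scalar A})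
    (phi_state : is_state phi)
    (gamma : forall d : nat, probability (borel (@unitary_group R d)) R)
    (gamma_haar : forall d, is_haar (gamma d))
    (ell : nat) (ell_gt0 : (0 < ell)%N) (n m : 'I_ell -> nat)
    (nm_gt0 : forall k, (0 < n k + m k)%N)
    (X : forall k, 'I_(n k) -> A) (Y : forall k, 'I_(m k) -> A)
    (XY_bipartite : tracially_bipartite phi (all_vars X) (all_vars Y)) :
  (bifree phi (fun k => alg_gen (range (X k))) (fun k => alg_gen (range (Y k))) /\
   (forall k, has_fd_approximants phi (X k) (Y k)))
  <-> chi_orb phi gamma X Y = 0%E.
Proof.
have [[saX saY] _ _ _] := XY_bipartite.
have sa (c : indices n + indices m) : selfadjoint (gvar (all_vars X) (all_vars Y) c) by case: c.
have phi1 := proj2 phi_state.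
split=> [[bf fd]|chi0].
  exact: (free_moments_chi_orb0 phi_state gamma_haar (bifree_free_moments bf) fd).
split; last by move=> k; exact: (chi_orb0_fd phi_state sa chi0 (nm_gt0 k)).
exact: free_moments_bifree phi1 XY_bipartite (chi_orb0_free phi_state gamma_haar sa chi0).
Qed.
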